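(* Let $\mathbb T$ be a closed convex cone with $\mathbb T\setminus\{0\}\subset(0,\infty)^d$. (1) If $\mathbf E|\xi|^\beta<\infty$ for some $\beta\in[1,2)$, then $$S_n-\mu|n|=o(|n|^{1/\beta})\quad\text{a.s. as }\mathbb T\ni n\to\infty.$$ (2) If $\mathbf E\xi^2<\infty$ and $\sigma^2=\mathrm{Var}(\xi)>0$, then $$\limsup_{\mathbb T\ni n\to\infty}\frac{|S_n-\mu|n||}{\sigma\chi(|n|)}=1\quad\text{a.s.}$$
   Context: Throughout, $d\ge2$ is an integer and $\mathbb N=\{1,2,\dots\}$. Components of a vector $n$ are $n^1,\dots,n^d$; for $n\in\mathbb N^d$ write $|n|=n^1\cdots n^d$ (product of components), while for a real number $|\cdot|$ is the absolute value. $m\le n$ for vectors is the componentwise order. $\mathbb T\ni n\to\infty$ means that $n\in\mathbb N^d\cap\mathbb T$ and $\max\{n^1,\dots,n^d\}\to\infty$. $\{\xi_m,\ m\in\mathbb N^d\}$ are independent copies of an integrable random variable $\xi$ with finite mean $\mu=\mathbf E\xi>0$, and $S_n=\sum_{m\le n}\xi_m$ for $n\in\mathbb N^d$. $\chi(t)=\sqrt{2t\log\log t}$ for $t\ge e^e$ (extended to $[0,\infty)$ so as to be positive and concave). *)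

(* Defs.v *)
From HB Require Import structures.
From mathcomp Require Import all_boot all_order all_algebra finmap.
From mathcomp Require Import all_classical all_reals all_analysis.
Import Order.TTheory GRing.Theory Num.Theory.
Import numFieldNormedType.Exports.

Set Implicit Arguments.
Unset Strict Implicit.
Unset Printing Implicit Defensive.

Local Open Scope classical_set_scope.
Local Open Scope ring_scope.

(* Multi-indices are row vectors of naturals; N^d, with N = {1, 2, ...}, is the
   set of those with all components positive. *)
Definition posvec (d : nat) : set 'rV[nat]_d :=
  [set n | forall i, (0 < n ord0 i)%N].

Definition vecR (R : realType) (d : nat) (n : 'rV[nat]_d) : 'rV[R]_d :=
  \row_i (n ord0 i)%:R.

Definition vol (d : nat) (n : 'rV[nat]_d) : nat := (\prod_i n ord0 i)%N.

Definition is_cone (R : realType) (d : nat) (C : set 'rV[R]_d) :=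
  forall (t : R) (x : 'rV[R]_d), 0 < t -> C x -> C (t *: x).

Definition cone_indices (R : realType) (d : nat) (C : set 'rV[R]_d) :
    set 'rV[nat]_d :=
  [set n | posvec n /\ C (vecR R n)].

(* The filter "C \ni n --> oo": n ranges over the points of N^d in C and
   max (n^1, ..., n^d) tends to infinity. *)
Definition cone_oo (R : realType) (d : nat) (C : set 'rV[R]_d) :
    set_system 'rV[nat]_d :=
  filter_from [set: nat]
    (fun N => [set n | cone_indices C n /\ (N <= \max_i n ord0 i)%N]).

Lemma cone_oo_filter (R : realType) (d : nat) (C : set 'rV[R]_d) :
  Filter (cone_oo C).
Proof.
apply: filter_from_filter; first by exists 0%N.
move=> M N _ _; exists (maxn M N) => // n /= [Cn]; rewrite geq_max.
by move=> /andP[leM leN].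
Qed.
#[global] Existing Instance cone_oo_filter.

Canonical cone_oo_filter_on (R : realType) (d : nat) (C : set 'rV[R]_d) :=
  FilterType (cone_oo C) (cone_oo_filter C).

(* Mutual independence of the subfamily (X i), i in D: product rule over every
   finite subfamily. *)
Definition independent_RVs {dsp : measure_display} {Omega : measurableType dsp}
    {R : realType} (P : probability Omega R) (I : choiceType) (D : set I)
    (X : I -> {RV P >-> R}) :=
  forall (J : {fset I}) (B : I -> set R),
    [set` J] `<=` D -> (forall i, measurable (B i)) ->
    P (\bigcap_(i in [set` J]) (X i @^-1` B i)) =
    (\prod_(i <- J) P (X i @^-1` B i))%E.

Definition same_distribution {dsp : measure_display}
    {Omega : measurableType dsp} {R : realType} (P : probability Omega R)
    (X Y : {RV P >-> R}) :=
  forall B : set R, measurable B -> distribution P X B = distribution P Y B.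

Definition independent_copies {dsp : measure_display}
    {Omega : measurableType dsp} {R : realType} (P : probability Omega R)
    (I : choiceType) (D : set I) (X : I -> {RV P >-> R})
    (xi : {RV P >-> R}) :=
  independent_RVs D X /\ forall i, D i -> same_distribution (X i) xi.

Definition partial_sum {dsp : measure_display} {Omega : measurableType dsp}
    {R : realType} (P : probability Omega R) (d : nat)
    (X : 'rV[nat]_d -> {RV P >-> R}) (n : 'rV[nat]_d) (w : Omega) : R :=
  \sum_(m \in [set m : 'rV[nat]_d |
                posvec m /\ forall i, (m ord0 i <= n ord0 i)%N]) X m w.

(* The extension of sqrt (2 t log log t) below e^e is only required to make
   chi positive and concave on [0, +oo[. *)
Definition is_chi (R : realType) (chi : R -> R) :=
  [/\ forall t, expR (expR 1) <= t -> chi t = Num.sqrt (2 * t * ln (ln t)),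
      forall t, 0 <= t -> 0 < chi t &
      convex_function (`[0, +oo[%classic : set R^o) (fun t => - chi t)].

(* Main.v *)
(* Idea. Let Y_n be the centred sum over the box of n. The cone meets the
   boundary of the positive orthant only at 0, so by compactness the components
   of its points are comparable and 2^(kd) is comparable to |n| if
   2^(k-1) < max n <= 2^k.

   (1) Decompose the box of n into its traces on the dyadic shells
   2^(k-1) < max m <= 2^k. On the k-th shell truncate at 2^(kd/beta) and apply
   a d-dimensional Ottaviani maximal inequality, obtained by freezing the
   coordinates one by one. The error probabilities are summable, and as the
   normalizations grow geometrically in k the shells add up.

   (2) Truncate at a small multiple of (2^(kd) / log k)^(1/2); finiteness of
   the second moment makes the discarded part negligible almost surely. The
   exponential moments of truncated sums then give Gaussian upper and lower tail
   bounds. Along n = 2^i a with a fixed, the maximal inequality and the first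
   Borel-Cantelli lemma yield the upper bound for all m <= 2^i a, and the second
   Borel-Cantelli lemma on the disjoint blocks between the boxes of 2^(qk) a and
   2^(q(k+1)) a yields the lower bound. A general n of the cone lies just below
   some 2^i a with a in a finite set and with |2^i a| close to |n|. *)

Require Import Defs.
From mathcomp Require Import all_boot all_order all_algebra finmap.
From mathcomp Require Import all_classical all_reals all_analysis.
From mathcomp Require Import measurable_realfun ring lra zify.
Import Order.TTheory GRing.Theory Num.Theory.
Import numFieldNormedType.Exports.
Set Implicit Arguments.
Unset Strict Implicit.
Unset Printing Implicit Defensive.
Local Open Scope classical_set_scope.
Local Open Scope ring_scope.

(** The obstacle in (2) is the exact constant 1. Enclosing n in a dyadic cube costs a constant
    factor in the volume. This is harmless in (1) and for the truncation error, where an arbitrary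
    epsilon absorbs it, but not in the main term; hence the dilations 2^i a of fixed shapes, with a
    finite stock of shapes depending on epsilon. Along such a sequence log log |2^i a| is asymptotic
    to log i, so Gaussian tails are powers of i: the upper bound becomes a p-series with p > 1, the
    lower bound a harmonic series. The truncation level balances two demands. Its product with the
    tilt t, of order sqrt(log i / |n|), must be small, so that the log of the moment generating
    function is quadratic up to a factor near 1. It must also be of order at least sqrt(|n| / log
    i), so that the second moment controls the discarded mass on the scale sqrt(|n| log i). The
    maximal inequality costs a factor 2^d in probability and a shift of the order of one standard
    deviation. The factor does not affect summability, and in (2) the shift is negligible against
    sqrt(log i) standard deviations. *)

Lemma big_fsetU_disjoint (T : Type) (idx : T) (op : Monoid.com_law idx)
    (I : choiceType) (J J' : {fset I}) (F : I -> T) : [disjoint J & J']%fset ->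
  \big[op/idx]_(i <- (J `|` J')%fset) F i =
  op (\big[op/idx]_(i <- J) F i) (\big[op/idx]_(i <- J') F i).
Proof.
move=> JJ'; rewrite -big_cat; apply: perm_big; apply: uniq_perm.
- exact: fset_uniq.
- rewrite cat_uniq !fset_uniq andbT /=; apply/hasPn => i iJ' /=.
  by apply/negP => iJ; move/fdisjointP: JJ' => /(_ _ iJ); rewrite iJ'.
- by move=> i; rewrite mem_cat inE.
Qed.

(** * Independence of sigma-algebras generated by disjoint index sets *)

Section grouping.
Context {dsp : measure_display} {Omega : measurableType dsp} {R : realType}.
Variable P : probability Omega R.
Variables (I : choiceType) (D : set I) (Z : I -> {RV P >-> R}).

(** The intersection-stable generator on which [independent_RVs] supplies the product rule. *)
Definition cylinders (A : set I) : set_system Omega :=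
  [set E | exists (J : {fset I}) (B : I -> set R), [/\ [set` J] `<=` A,
     forall i, measurable (B i) &
     E = \bigcap_(i in [set` J]) (Z i @^-1` B i)]].

Definition sig (A : set I) : set_system Omega := <<s cylinders A >>.

Lemma measurable_RV_preimage (i : I) (B : set R) :
  measurable B -> measurable (Z i @^-1` B).
Proof. by move=> mB; rewrite -[X in measurable X]setTI; exact: measurable_funP. Qed.

Lemma cylinders_measurable A : cylinders A `<=` measurable.
Proof.
move=> E [J [B [_ mB ->]]]; apply: fin_bigcap_measurable => // i _.
exact: measurable_RV_preimage.
Qed.

Lemma sig_measurable A : sig A `<=` measurable.
Proof.
apply: smallest_sub; last exact: cylinders_measurable.
exact: sigma_algebra_measurable.
Qed.

Lemma cylinders_setI A : setI_closed (cylinders A).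
Proof.
move=> _ _ [J [B [JA mB ->]]] [J' [B' [J'A mB' ->]]].
exists (J `|` J')%fset.
exists (fun i => (if i \in J then B i else setT) `&`
                 (if i \in J' then B' i else setT)); split.
- move=> i /=; rewrite inE => /orP[]; [exact: JA|exact: J'A].
- by move=> i; apply: measurableI; case: ifP.
- apply/seteqP; split=> w.
    by move=> [h h'] i _ /=; split; case: ifP => // ij; [exact: h|exact: h'].
  move=> h; split=> i /= ij.
    by have /= := h i; rewrite inE ij => /(_ isT)[].
  by have /= := h i; rewrite inE ij orbT => /(_ isT)[].
Qed.

Lemma sub_sig A A' : A `<=` A' -> sig A `<=` sig A'.
Proof.
move=> AA'; apply: sub_sigma_algebra2 => E [J [B [JA mB ->]]].
by exists J, B; split => //; exact: subset_trans AA'.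
Qed.

Hypothesis hZ : independent_RVs D Z.

(** As the index sets are disjoint, the two families of Borel sets patch to one family on the union
    of [J] and [J'], and the product over the union splits. *)
Lemma cylinders_indep A A' E F : A `<=` D -> A' `<=` D -> A `&` A' = set0 ->
  cylinders A E -> cylinders A' F -> P (E `&` F) = (P E * P F)%E.
Proof.
move=> AD A'D AA' [J [B [JA mB ->]]] [J' [B' [J'A mB' ->]]].
pose B2 i := if i \in J then B i else B' i.
have JJ' : [disjoint J & J']%fset.
  apply/fdisjointP => i iJ; apply/negP => iJ'.
  by have : (A `&` A') i by [split; [exact: JA|exact: J'A]]; rewrite AA'.
have nJ i : i \in J' -> i \in J = false.
  by move=> iJ'; apply/negP => iJ; move/fdisjointP: JJ' => /(_ _ iJ); rewrite iJ'.
have -> : \bigcap_(i in [set` J]) Z i @^-1` B i `&`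
          \bigcap_(i in [set` J']) Z i @^-1` B' i =
   \bigcap_(i in [set` (J `|` J')%fset]) Z i @^-1` B2 i.
  apply/seteqP; split => w.
    move=> [h h'] i /=; rewrite inE /B2 => /orP[] iJ; last by rewrite nJ//; exact: h'.
    by rewrite iJ; exact: h.
  move=> h; split => i /= iJ.
    by have /= := h i; rewrite inE iJ /B2 iJ; apply.
  by have /= := h i; rewrite inE iJ /B2 nJ ?orbT//; apply.
rewrite hZ //; last 2 first.
- by move=> i /=; rewrite inE => /orP[/JA/AD|/J'A/A'D].
- by move=> i; rewrite /B2; case: ifP.
rewrite (@hZ J B)//; last by move=> i /JA/AD.
rewrite (@hZ J' B')//; last by move=> i /J'A/A'D.
rewrite big_fsetU_disjoint//=; congr (_ * _)%E.
  by rewrite !big_seq; apply: eq_bigr => i iJ; rewrite /B2 iJ.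
by rewrite !big_seq; apply: eq_bigr => i iJ; rewrite /B2 nJ.
Qed.

Lemma indep_lambda_system (F : set Omega) : measurable F ->
  lambda_system setT [set E | measurable E /\ P (E `&` F) = (P E * P F)%E].
Proof.
move=> mF; apply/dynkin_lambda_system; split.
- by split => //; rewrite setTI probability_setT mul1e.
- move=> E [mE PE]; split; first exact: measurableC.
  rewrite probability_setC// muleBl ?fin_num_measure//.
  rewrite mul1e -PE setIC -setDE measureD//; last first.
    by rewrite ltey_eq fin_num_measure.
  by rewrite setIC.
- move=> E tE hE; split; first by apply: bigcup_measurable => k _; apply hE.
  rewrite setI_bigcupl !measure_bigcup//=.
  + rewrite [RHS]muleC -[P F]fineK ?fin_num_measure// -nneseriesZl//.
    apply: eq_eseriesr => i _; rewrite fineK ?fin_num_measure// muleC.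
    by case: (hE i).
  + by move=> k _; apply hE.
  + move=> k _; apply: measurableI => //; apply hE.
  + apply: trivIset_setIr => //.
Qed.

(** The pi-lambda theorem is used twice: with a cylinder fixed on the right it extends the left
    factor to [sig A]; with the extended left factor fixed it then extends the right one. *)
Lemma sig_indep A A' E F : A `<=` D -> A' `<=` D -> A `&` A' = set0 ->
  sig A E -> sig A' F -> P (E `&` F) = (P E * P F)%E.
Proof.
move=> AD A'D AA' sE sF.
have step G : cylinders A' G -> sig A `<=`
    [set E | measurable E /\ P (E `&` G) = (P E * P G)%E].
  move=> cG; apply: lambda_system_subset => //.
  - exact: cylinders_setI.
  - exact/indep_lambda_system/(cylinders_measurable cG).
  - move=> H cH; split; first exact: (cylinders_measurable cH).
    exact: cylinders_indep cH cG.
suff: sig A' `<=` [set F | measurable F /\ P (F `&` E) = (P F * P E)%E].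
  by move=> /(_ _ sF)[_]; rewrite setIC muleC.
apply: lambda_system_subset => //.
- exact: cylinders_setI.
- exact/indep_lambda_system/(sig_measurable sE).
- move=> H cH; split; first exact: (cylinders_measurable cH).
  by rewrite setIC muleC; case: (step _ cH _ sE).
Qed.

End grouping.

(** * Probabilities and expectations as real numbers *)

Section real_expectation.
Context {dsp : measure_display} {Omega : measurableType dsp} {R : realType}.
Variable P : probability Omega R.
Implicit Types (A B : set Omega) (f g : Omega -> R).

Definition pr A : R := fine (P A).

Lemma prE A : measurable A -> P A = (pr A)%:E.
Proof. by move=> mA; rewrite /pr fineK// fin_num_measure. Qed.

Lemma pr_ge0 A : 0 <= pr A.
Proof. by rewrite /pr fine_ge0. Qed.

Lemma pr_le1 A : measurable A -> pr A <= 1.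
Proof. by move=> mA; rewrite -lee_fin -prE// probability_le1. Qed.

Lemma pr_le A B : measurable A -> measurable B -> A `<=` B -> pr A <= pr B.
Proof. by move=> mA mB AB; rewrite -lee_fin -!prE// le_measure ?inE. Qed.

Lemma prC A : measurable A -> pr (~` A) = 1 - pr A.
Proof.
move=> mA; apply: EFin_inj; rewrite -prE; last exact: measurableC.
by rewrite probability_setC// prE.
Qed.

Lemma prU A B : measurable A -> measurable B -> A `&` B = set0 ->
  pr (A `|` B) = pr A + pr B.
Proof.
move=> mA mB AB; apply: EFin_inj; rewrite -prE; last exact: measurableU.
by rewrite measureU// EFinD -!prE.
Qed.

Lemma prU_le A B : measurable A -> measurable B ->
  pr (A `|` B) <= pr A + pr B.
Proof.
move=> mA mB; rewrite -lee_fin EFinD -!prE//; last exact: measurableU.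
exact: measureU2.
Qed.


Definition Ex f : R := \int[P]_w f w.

(** Bounded measurable functions are integrable and stable under the algebra needed below, so
    working with truncated variables avoids integrability side conditions. *)
Definition bm f := measurable_fun setT f /\ exists M : R, forall w, `|f w| <= M.

Lemma bm_int f : bm f -> P.-integrable setT (EFin \o f).
Proof.
move=> [mf [M fM]]; apply: (@le_integrable _ _ _ P _ _ _ (EFin \o cst M)) => //.
- exact/measurable_EFinP.
- by move=> w _; rewrite /= lee_fin (le_trans (fM w))// ler_norm.
- exact: finite_measure_integrable_cst.
Qed.

Lemma ExE f : P.-integrable setT (EFin \o f) ->
  (\int[P]_w (f w)%:E)%E = (Ex f)%:E.
Proof. by move=> fi; rewrite /Ex /Rintegral fineK// integrable_fin_num. Qed.

Lemma Ex_cst c : Ex (cst c) = c.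
Proof.
by rewrite /Ex Rintegral_cst// /= probability_setT mulr1.
Qed.

Lemma bm_cst c : bm (cst c).
Proof. by split; [exact: measurable_cst|exists `|c|]. Qed.

Lemma bmD f g : bm f -> bm g -> bm (fun w => f w + g w).
Proof.
move=> [mf [M fM]] [mg [N gN]]; split; first exact: measurable_funD.
by exists (M + N) => w; rewrite (le_trans (ler_normD _ _))// lerD.
Qed.

Lemma bmM f g : bm f -> bm g -> bm (fun w => f w * g w).
Proof.
move=> [mf [M fM]] [mg [N gN]]; split; first exact: measurable_funM.
by exists (M * N) => w; rewrite normrM ler_pM.
Qed.

Lemma bmZ c f : bm f -> bm (fun w => c * f w).
Proof. by move=> bf; apply: bmM => //; exact: bm_cst. Qed.

Lemma bmN f : bm f -> bm (fun w => - f w).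
Proof.
move=> [mf [M fM]]; split; first exact: measurableT_comp.
by exists M => w; rewrite normrN.
Qed.

Lemma bmB f g : bm f -> bm g -> bm (fun w => f w - g w).
Proof. by move=> bf bg; apply: bmD => //; exact: bmN. Qed.

Lemma bm_sum (I : Type) (s : seq I) (f : I -> Omega -> R) :
  (forall i, bm (f i)) -> bm (fun w => \sum_(i <- s) f i w).
Proof.
move=> bf; elim: s => [|i s IH].
  by under eq_fun do rewrite big_nil; exact: bm_cst.
by under eq_fun do rewrite big_cons; apply: bmD.
Qed.

Lemma bm_indic A : measurable A -> bm (\1_A).
Proof.
move=> mA; split; first exact: measurable_indic.
by exists 1 => w; rewrite indicE; case: (w \in A); rewrite ?normr1 ?normr0.
Qed.

Lemma bm_expR f : bm f -> bm (fun w => expR (f w)).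
Proof.
move=> [mf [M fM]]; split; first exact: measurableT_comp.
exists (expR M) => w; rewrite ger0_norm ?expR_ge0// ler_expR.
by rewrite (le_trans (ler_norm _)).
Qed.

Lemma ExD f g : bm f -> bm g -> Ex (fun w => f w + g w) = Ex f + Ex g.
Proof. by move=> bf bg; rewrite /Ex RintegralD//; exact: bm_int. Qed.

Lemma ExZ c f : bm f -> Ex (fun w => c * f w) = c * Ex f.
Proof. by move=> bf; rewrite /Ex RintegralZl//; exact: bm_int. Qed.

Lemma ExB f g : bm f -> bm g -> Ex (fun w => f w - g w) = Ex f - Ex g.
Proof. by move=> bf bg; rewrite /Ex RintegralB//; exact: bm_int. Qed.

Lemma le_Ex f g : bm f -> bm g -> (forall w, f w <= g w) -> Ex f <= Ex g.
Proof. by move=> bf bg fg; apply: le_Rintegral => //; exact: bm_int. Qed.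

Lemma Ex_sum (I : Type) (s : seq I) (f : I -> Omega -> R) :
  (forall i, bm (f i)) ->
  Ex (fun w => \sum_(i <- s) f i w) = \sum_(i <- s) Ex (f i).
Proof.
move=> bf; elim: s => [|i s IH].
  by under eq_fun do rewrite big_nil; rewrite big_nil; exact: Ex_cst.
under eq_fun do rewrite big_cons; rewrite big_cons ExD ?IH//.
exact: bm_sum.
Qed.

Lemma Ex_indic A : measurable A -> Ex (\1_A) = pr A.
Proof. by move=> mA; rewrite /Ex /Rintegral integral_indic// setIT. Qed.

Definition indepf f g := forall A B : set R, measurable A -> measurable B ->
  P (f @^-1` A `&` g @^-1` B) = (P (f @^-1` A) * P (g @^-1` B))%E.

(** Independence says that the law of the pair is the product of the two laws, so Tonelli's theorem
    factors the integral. *)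
Lemma ge0_integralM_indep (f g : {RV P >-> R}) : indepf f g ->
  (forall w, 0 <= f w) -> (forall w, 0 <= g w) ->
  (\int[P]_w (f w * g w)%:E = \int[P]_w (f w)%:E * \int[P]_w (g w)%:E)%E.
Proof.
move=> fg f0 g0.
have mh : measurable_fun setT (fun w => (f w, g w)).
  by apply/measurable_fun_pairP; split.
pose h : {RV P >-> (R * R)%type} := mfun_Sub (mem_set mh).
(* The absolute values make the integrand nonnegative on the whole plane; on the range of [h] they
   change nothing. *)
pose F (z : R * R) : \bar R := (`|z.1| * `|z.2|)%:E.
have mF : measurable_fun setT F.
  apply/measurable_EFinP; apply: measurable_funM; apply: measurableT_comp => //.
have -> : (\int[P]_w (f w * g w)%:E = \int[distribution P h]_z F z)%E.
  rewrite ge0_integral_distribution//.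
    by apply: eq_integral => w _; rewrite /F /= !ger0_norm.
  by move=> z; rewrite lee_fin mulr_ge0.
transitivity (\int[distribution P f \x distribution P g]_z F z)%E.
  apply: eq_measure_integral => A mA _; apply/esym.
  exact: product_measure_unique.
rewrite fubini_tonelli1//; last by move=> z; rewrite lee_fin mulr_ge0.
rewrite /fubini_F/=.
have mn : measurable_fun [set: R] (fun y : R => `|y|%:E).
  by apply/measurable_EFinP; exact: normr_measurable.
have Eg : (\int[P]_w (g w)%:E = \int[distribution P g]_y (`|y|)%:E)%E.
  rewrite ge0_integral_distribution//.
  by apply: eq_integral => w _; rewrite /= ger0_norm.
have Ef : (\int[P]_w (f w)%:E = \int[distribution P f]_y (`|y|)%:E)%E.
  rewrite ge0_integral_distribution//.
  by apply: eq_integral => w _; rewrite /= ger0_norm.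
rewrite Ef Eg -ge0_integralZr//; last by apply: integral_ge0 => y _; rewrite lee_fin.
apply: eq_integral => x _; rewrite /F/=.
under eq_integral do rewrite EFinM.
by rewrite ge0_integralZl ?lee_fin.
Qed.

(** Adding the bounds [M] and [N] reduces to nonnegative factors; the extra terms cancel by
    linearity. *)
Lemma ExM_indep f g : bm f -> bm g -> indepf f g ->
  Ex (fun w => f w * g w) = Ex f * Ex g.
Proof.
move=> bf bg fg; have [mf [M fM]] := bf; have [mg [N gN]] := bg.
have bf1 : bm (fun w => f w + M) by apply: bmD => //; exact: bm_cst.
have bg1 : bm (fun w => g w + N) by apply: bmD => //; exact: bm_cst.
have f1 w : 0 <= f w + M.
  by have := fM w; rewrite ler_norml => /andP[]; rewrite -subr_ge0 opprK.
have g1 w : 0 <= g w + N.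
  by have := gN w; rewrite ler_norml => /andP[]; rewrite -subr_ge0 opprK.
pose F : {RV P >-> R} := mfun_Sub (mem_set bf1.1).
pose G : {RV P >-> R} := mfun_Sub (mem_set bg1.1).
have FG : indepf F G.
  move=> A B mA mB.
  apply: (fg ((fun x => x + M) @^-1` A) ((fun x => x + N) @^-1` B)).
    by rewrite -[X in measurable X]setTI; apply: measurable_funD.
  by rewrite -[X in measurable X]setTI; apply: measurable_funD.
have := ge0_integralM_indep FG f1 g1.
rewrite /F /G/= !ExE; [|exact: bm_int|exact: bm_int|exact/bm_int/bmM].
rewrite -EFinM => -[].
rewrite !ExD//; [|exact: bm_cst|exact: bm_cst].
rewrite !Ex_cst.
have -> : (fun w => (f w + M) * (g w + N)) =
          (fun w => f w * g w + (N * f w + (M * g w + M * N))).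
  by apply/funext => w; ring.
rewrite !ExD ?ExZ ?Ex_cst//; try by repeat (exact: bm_cst || apply: bmD || apply: bmM).
move=> h; apply/eqP; rewrite -subr_eq0; apply/eqP.
rewrite -[RHS](subrr ((Ex f + M) * (Ex g + N))) -{1}h; ring.
Qed.

Lemma pr_bigU_le (I : Type) (s : seq I) (F : I -> set Omega) :
  (forall i, measurable (F i)) ->
  pr (\big[setU/set0]_(i <- s) F i) <= \sum_(i <- s) pr (F i).
Proof.
move=> mF; elim: s => [|i s IH]; first by rewrite !big_nil /pr measure0.
rewrite !big_cons; apply: le_trans; first apply: prU_le => //.
  exact: bigsetU_measurable.
by rewrite lerD2l.
Qed.

(** The first Borel-Cantelli lemma, with summability stated as a uniform bound on real partial sums
    so that explicit estimates apply directly. *)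
Lemma ae_eventually_not (E : nat -> set Omega) (C : R) :
  (forall k, measurable (E k)) ->
  (forall N, \sum_(k < N) pr (E k) <= C) ->
  {ae P, forall w, exists K, forall k, (K <= k)%N -> ~ E k w}.
Proof.
move=> mE hC.
exists (lim_sup_set E); split.
- apply: bigcap_measurable => // n _; exact: bigcup_measurable.
- apply: lim_sup_set_cvg0 => //.
  apply: (@le_lt_trans _ _ C%:E); last exact: ltry.
  apply: lime_le; first exact: is_cvg_nneseries.
  apply: nearW => N; rewrite big_mkord.
  rewrite (eq_bigr (fun i : 'I_N => (pr (E i))%:E) (fun i _ => prE (mE i))).
  by rewrite sumEFin lee_fin; exact: hC.
- move=> w /= h; move=> n _ /=.
  apply: contrapT => hn; apply: h; exists n => k nk Ek; apply: hn.
  by exists k.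
Qed.

End real_expectation.

(** * Sums of independent variables *)

Section independent_sums.
Context {dsp : measure_display} {Omega : measurableType dsp} {R : realType}.
Variable P : probability Omega R.
Variables (I : choiceType) (D : set I) (Z : I -> {RV P >-> R}).
Hypothesis hZ : independent_RVs D Z.

Definition smf (A : set I) (f : Omega -> R) :=
  forall B, measurable B -> sig Z A (f @^-1` B).

(** Reading [smf] as measurability for the generated sigma-algebra makes the closure properties of
    measurable functions available. *)
Lemma smfP A f : smf A f <->
  measurable_fun setT (f : g_sigma_algebraType (cylinders Z A) -> R).
Proof.
split=> [h _ B mB|h B mB]; first by rewrite setTI; exact: h.
by have := h measurableT B mB; rewrite setTI.
Qed.

Lemma smf_RV (A : set I) i : A i -> smf A (Z i).
Proof.
move=> Ai B mB; apply: sub_sigma_algebra.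
exists [fset i]%fset, (fun=> B); split => //.
  by move=> j /=; rewrite inE => /eqP ->.
apply/seteqP; split=> w.
  by move=> h j /=; rewrite inE => /eqP ->.
by apply; rewrite /= inE.
Qed.

Lemma smf_sum (A : set I) (s : seq I) (f : I -> Omega -> R) :
  (forall i, i \in s -> smf A (f i)) -> smf A (fun w => \sum_(i <- s) f i w).
Proof.
move=> sA; apply/smfP; elim: s sA => [|i s IH] sA.
  by under eq_fun do rewrite big_nil; exact: measurable_cst.
under eq_fun do rewrite big_cons; apply: measurable_funD.
  exact: (smfP A (f i)).1 (sA i (mem_head _ _)).
by apply: IH => j js; apply: sA; exact: (@mem_behead _ (i :: s)).
Qed.

Lemma smf_sum_RV (A : set I) (s : seq I) : [set` s] `<=` A ->
  smf A (fun w => \sum_(i <- s) Z i w).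
Proof. by move=> sA; apply: smf_sum => i si; apply: smf_RV; exact: sA. Qed.

Lemma smf_comp A f (phi : R -> R) : measurable_fun setT phi ->
  smf A f -> smf A (phi \o f).
Proof.
move=> mphi h B mB; rewrite comp_preimage; apply: h.
by rewrite -[X in measurable X]setTI; exact: mphi.
Qed.

Lemma smf_indep A A' f g : A `<=` D -> A' `<=` D -> A `&` A' = set0 ->
  smf A f -> smf A' g -> indepf P f g.
Proof.
move=> AD A'D AA' hf hg B B' mB mB'.
by apply: (sig_indep hZ AD A'D AA'); [exact: hf|exact: hg].
Qed.

Hypothesis bZ : forall i, bm (Z i).

Lemma cons_disjoint (i : I) (s : seq I) : i \notin s ->
  [set i] `&` [set` s] = set0.
Proof.
move=> /negP si; rewrite -subset0 => j [-> js]; exact: si.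
Qed.

Lemma mgf_sum t (s : seq I) : uniq s -> [set` s] `<=` D ->
  Ex P (fun w => expR (t * \sum_(i <- s) Z i w)) =
  \prod_(i <- s) Ex P (fun w => expR (t * Z i w)).
Proof.
elim: s => [_ _|i s IH /= /andP[si us] sD].
  rewrite big_nil; under eq_fun do rewrite big_nil mulr0 expR0.
  exact: Ex_cst.
have Di : D i by apply: sD; exact: mem_head.
have sD' : [set` s] `<=` D by move=> j js; apply: sD; exact: (@mem_behead _ (i :: s)).
rewrite big_cons -IH// -ExM_indep.
- by under eq_fun do rewrite big_cons mulrDr expRD.
- by apply: bm_expR; apply: bmZ.
- by apply: bm_expR; apply/bmZ/bm_sum.
- apply: (@smf_indep [set i] [set` s]) => //.
  + by move=> j ->.
  + exact: cons_disjoint.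
  + apply: (@smf_comp _ _ (fun x => expR (t * x))); last exact: smf_RV.
    by apply: measurableT_comp => //; exact: mulrl_measurable.
  + apply: (@smf_comp _ _ (fun x => expR (t * x))); last exact: smf_sum_RV.
    by apply: measurableT_comp => //; exact: mulrl_measurable.
Qed.

Lemma variance_sum (s : seq I) : uniq s -> [set` s] `<=` D ->
  (forall i, i \in s -> Ex P (Z i) = 0) ->
  Ex P (fun w => (\sum_(i <- s) Z i w) ^+ 2) =
  \sum_(i <- s) Ex P (fun w => Z i w ^+ 2).
Proof.
elim: s => [_ _ _|i s IH /= /andP[si us] sD cs].
  rewrite big_nil; under eq_fun do rewrite big_nil expr0n/=.
  exact: Ex_cst.
have Di : D i by apply: sD; exact: mem_head.
have sD' : [set` s] `<=` D by move=> j js; apply: sD; exact: (@mem_behead _ (i :: s)).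
rewrite big_cons -IH//; last by move=> j js; apply: cs; rewrite inE js orbT.
have -> : (fun w => (\sum_(j <- i :: s) Z j w) ^+ 2) =
  (fun w => Z i w * Z i w + (2 * (Z i w * \sum_(j <- s) Z j w) +
    (\sum_(j <- s) Z j w) * (\sum_(j <- s) Z j w))).
  by apply/funext => w; rewrite big_cons; ring.
have bs : bm (fun w => \sum_(j <- s) Z j w) by exact: bm_sum.
rewrite ExD; [|exact: bmM|by apply: bmD; [exact/bmZ/bmM|exact: bmM]].
rewrite ExD; [|exact/bmZ/bmM|exact: bmM].
rewrite ExZ; last exact: bmM.
rewrite (ExM_indep (bZ i) bs); last first.
  apply: (@smf_indep [set i] [set` s]) => //.
  + by move=> j ->.
  + exact: cons_disjoint.
  + exact: smf_RV.
  + exact: smf_sum_RV.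
rewrite cs ?inE ?eqxx// mul0r mulr0 add0r.
by under [in RHS]eq_fun do rewrite expr2.
Qed.

Lemma chebyshev_sum (s : seq I) (u V : R) : uniq s -> [set` s] `<=` D ->
  (forall i, i \in s -> Ex P (Z i) = 0) -> 0 < u ->
  \sum_(i <- s) Ex P (fun w => Z i w ^+ 2) <= V ->
  pr P [set w | u < `|\sum_(i <- s) Z i w|] <= V / u ^+ 2.
Proof.
move=> us sD cs u0 hV; set S := fun w => \sum_(i <- s) Z i w.
have bS : bm S by exact: bm_sum.
have mA : measurable [set w | u < `|S w|].
  rewrite -[X in measurable X]setTI; apply: measurable_fun_ltr => //.
  by apply: measurableT_comp => //; exact: bS.1.
rewrite -Ex_indic// ler_pdivlMr ?exprn_gt0// mulrC -ExZ; last exact: bm_indic.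
apply: le_trans hV; rewrite -variance_sum//.
apply: le_Ex.
- by apply: bmZ; exact: bm_indic.
- by under eq_fun do rewrite expr2; exact: bmM.
- move=> w; rewrite indicE -/(S w).
  case: (boolP (w \in _)) => [|_] /=; last by rewrite mulr0 sqr_ge0.
  rewrite inE /= mulr1 -[leRHS]real_normK ?num_real// => uS.
  by rewrite ler_pXn2r ?nnegrE ?normr_ge0 ?ltW.
Qed.


Lemma sigC A E : sig Z A E -> sig Z A (~` E).
Proof. exact: (@measurableC _ (g_sigma_algebraType (cylinders Z A))). Qed.

Lemma sigU A E F : sig Z A E -> sig Z A F -> sig Z A (E `|` F).
Proof. exact: (@measurableU _ (g_sigma_algebraType (cylinders Z A))). Qed.

Lemma sigI A E F : sig Z A E -> sig Z A F -> sig Z A (E `&` F).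
Proof. exact: (@measurableI _ (g_sigma_algebraType (cylinders Z A))). Qed.

Lemma sig_set0 A : sig Z A set0.
Proof. exact: (@measurable0 _ (g_sigma_algebraType (cylinders Z A))). Qed.

Lemma sig_setT A : sig Z A setT.
Proof. exact: (@measurableT _ (g_sigma_algebraType (cylinders Z A))). Qed.

Lemma sig_bigcup_countType (J : countType) A (Q : set J)
    (E : J -> set Omega) :
  (forall i, Q i -> sig Z A (E i)) -> sig Z A (\bigcup_(i in Q) E i).
Proof.
move=> hE; rewrite bigcup_mkcond.
apply: (@countable_bigcupT_measurable _ (g_sigma_algebraType (cylinders Z A))).
  exact: countableP.
move=> i; case: ifPn => [|_]; last exact: sig_set0.
by rewrite inE; exact: hE.
Qed.

Lemma sig_gt_sum (A : set I) (t : R) (s : seq I) : [set` s] `<=` A ->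
  sig Z A [set w | t < `|\sum_(i <- s) Z i w|].
Proof.
move=> sA; have -> : [set w | t < `|\sum_(i <- s) Z i w|] =
   (@Num.norm _ R \o (fun w => \sum_(i <- s) Z i w)) @^-1` `]t, +oo[.
  by apply/seteqP; split => w /=; rewrite in_itv/= andbT.
by apply: (smf_comp (@normr_measurable _ _) (smf_sum_RV sA)).
Qed.

(* At the first j at which E j occurs, F j is independent of the past and has
   probability at least 1/2. *)
Lemma ottaviani (N : nat) (E F : nat -> set Omega) (G : set Omega)
    (A B : nat -> set I) :
  (forall j, A j `<=` D) -> (forall j, B j `<=` D) ->
  (forall j, A j `&` B j = set0) ->
  (forall i j, (i <= j)%N -> A i `<=` A j) ->
  (forall j, sig Z (A j) (E j)) -> (forall j, sig Z (B j) (F j)) ->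
  measurable G -> (forall j, (j < N)%N -> E j `&` F j `<=` G) ->
  (forall j, (j < N)%N -> 1 / 2 <= pr P (F j)) ->
  pr P (\big[setU/set0]_(j < N) E j) <= 2 * pr P G.
Proof.
move=> AD BD AB Amono sE sF mG EFG hF.
pose U n := \big[setU/set0]_(j < n) E j.
have mE j : measurable (E j) by apply: sig_measurable (sE j).
have mF j : measurable (F j) by apply: sig_measurable (sF j).
have mU n : measurable (U n) by apply: bigsetU_measurable.
have sU n : (0 < n)%N -> sig Z (A n.-1) (U n).
  case: n => // n _; elim: n => [|n IH].
    by rewrite /U big_ord_recr/= big_ord0 set0U; exact: sE.
  rewrite /U big_ord_recr/=; apply: sigU; last exact: sE.
  by apply: sub_sig IH; exact: Amono.
suff h n : (n <= N)%N -> 1 / 2 * pr P (U n) <= pr P (G `&` U n).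
  have := h N (leqnn _).
  have : pr P (G `&` U N) <= pr P G by apply: pr_le => //; exact: measurableI.
  by rewrite /U; lra.
elim: n => [_|n IH nN].
  by rewrite /U big_ord0 /pr measure0/= mulr0 fine_ge0.
have {IH} := IH (ltnW nN).
have -> : U n.+1 = U n `|` (E n `\` U n).
  rewrite /U big_ord_recr/=; apply/seteqP; split=> w; last by case; [left|case; right].
  case=> [h|h]; first by left.
  by have [|] := pselect (U n w); [left|right].
rewrite setIUr.
have mEU : measurable (E n `\` U n) by exact: measurableD.
rewrite prU//; last by rewrite setDE setICA setICr setI0.
rewrite prU; [|exact: measurableI|exact: measurableI|]; last first.
  by rewrite setIACA setIid setDE [U n `&` _]setICA setICr !setI0.
have : pr P (F n `&` (E n `\` U n)) <= pr P (G `&` (E n `\` U n)).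
  apply: pr_le; [exact: measurableI|exact: measurableI|].
  by move=> w [Fw [Ew Uw]]; split => //; apply: (EFG n nN).
have : pr P (F n `&` (E n `\` U n)) = pr P (F n) * pr P (E n `\` U n).
  apply: EFin_inj; rewrite EFinM -!prE//; last exact: measurableI.
  rewrite muleC setIC.
  apply: (sig_indep hZ (AD n) (BD n) (AB n)) => //.
  apply: sigI => //; apply: sigC.
  case: n {nN mEU} => [|n]; first by rewrite /U big_ord0; exact: sig_set0.
  by apply: sub_sig (sU n.+1 isT); exact: Amono.
have := hF n nN; have := pr_ge0 P (E n `\` U n); nra.
Qed.


(** The second Borel-Cantelli lemma. Disjoint index sets make the events independent, so the
    probability that none of [E K], ..., [E (K + n - 1)] occurs is a product of factors 1 - p <=
    exp(-p). *)
Lemma borel_cantelli2 (E : nat -> set Omega) (B : nat -> set I) :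
  (forall k, B k `<=` D) -> (forall i j, (i < j)%N -> B i `&` B j = set0) ->
  (forall k, sig Z (B k) (E k)) ->
  (forall M : R, exists N, M <= \sum_(k < N) pr P (E k)) ->
  {ae P, forall w, forall K, exists k, (K <= k)%N /\ E k w}.
Proof.
move=> BD Bdisj sE hdiv; apply/ae_foralln => K.
have mE k : measurable (E k) by apply: sig_measurable (sE k).
pose G n := \big[setI/setT]_(j < n) ~` E (K + j)%N.
have sG n : sig Z (\bigcup_(k in [set k | (k < K + n)%N]) B k) (G n).
  elim: n => [|n IH]; first by rewrite /G big_ord0; exact: sig_setT.
  rewrite /G big_ord_recr/=; apply: sigI.
    by apply: sub_sig IH => i [k /= kn Bi]; exists k => //=; rewrite addnS ltnW.
  by apply: sigC; apply: sub_sig (sE (K + n)%N) => i Bi; exists (K + n)%N; rewrite //= addnS.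
have mG n : measurable (G n) by apply: sig_measurable (sG n).
have hG n : pr P (G n) <= expR (- \sum_(j < n) pr P (E (K + j)%N)).
  elim: n => [|n IH].
    rewrite /G !big_ord0 oppr0 expR0; exact: pr_le1.
  have -> : pr P (G n.+1) = pr P (G n) * (1 - pr P (E (K + n)%N)).
    rewrite -prC//; apply: EFin_inj.
    rewrite EFinM -!prE//; last exact: measurableC.
    rewrite /G big_ord_recr/= -/(G n).
    apply: (sig_indep hZ _ (BD (K + n)%N) _ (sG n)) => //.
    - by move=> i [k _ /BD].
    - rewrite -subset0 => i [[k /= kn Bk] Bi].
      by have : (B k `&` B (K + n)%N) i by []; rewrite Bdisj.
    - exact: sigC.
  rewrite big_ord_recr/= opprD expRD.
  apply: ler_pM => //; first exact: pr_ge0.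
    by rewrite subr_ge0 pr_le1.
  exact: expR_ge1Dx.
pose N := \bigcap_n G n.
have mN : measurable N by exact: bigcapT_measurable.
exists N; split => //; last first.
  move=> w /= h n _; rewrite /G.
  elim: n => [|n IH]; first by rewrite big_ord0.
  rewrite big_ord_recr/=; split => //= Ew; apply: h; exists (K + n)%N.
  by split => //; exact: leq_addr.
transitivity (pr P N)%:E; first exact: prE.
congr (_%:E).
apply/eqP; rewrite eq_le pr_ge0 andbT leNgt; apply/negP => N0.
(* With this threshold the tail sum is at least 1 - ln P(N), whence P(N) <= exp(-1) P(N),
   contradicting P(N) > 0. *)
have [n hn] := hdiv (\sum_(k < K) pr P (E k) + 1 - ln (pr P N)).
have hn' : 1 - ln (pr P N) <= \sum_(j < n) pr P (E (K + j)%N).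
  have : \sum_(k < n) pr P (E k) <= \sum_(k < K + n) pr P (E k).
    rewrite -!(big_mkord xpredT (fun k => pr P (E k))).
    rewrite (@big_cat_nat _ _ _ n _ (K + n))//=; last exact: leq_addl.
    by rewrite lerDl; apply: sumr_ge0 => i _; exact: pr_ge0.
  by rewrite big_split_ord/=; lra.
have : pr P N <= expR (- (1 - ln (pr P N))).
  apply: (@le_trans _ _ (pr P (G n))).
    by apply: pr_le => //; apply: bigcap_inf.
  by apply: (le_trans (hG n)); rewrite ler_expR lerN2.
rewrite opprB expRD lnK ?posrE// => h.
have : expR (-1) < (1:R) by rewrite expR_lt1; lra.
by nra.
Qed.

End independent_sums.

Definition lev (d : nat) (m n : 'rV[nat]_d) : bool :=
  [forall i, m ord0 i <= n ord0 i]%N.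

Lemma levP (d : nat) (m n : 'rV[nat]_d) :
  reflect (forall i, m ord0 i <= n ord0 i)%N (lev m n).
Proof. exact: forallP. Qed.

(** * A maximal inequality for multi-indexed sums *)

Section multi_index.
Context {dsp : measure_display} {Omega : measurableType dsp} {R : realType}.
Variable P : probability Omega R.
Variables (d : nat) (D : set 'rV[nat]_d) (Z : 'rV[nat]_d -> {RV P >-> R}).
Hypothesis hZ : independent_RVs D Z.
Hypothesis bZ : forall i, bm (Z i).
Hypothesis cZ : forall i, D i -> Ex P (Z i) = 0.
Notation I := 'rV[nat]_d.

Definition psum (s : seq I) (n : I) (w : Omega) : R :=
  \sum_(m <- s | lev m n) Z m w.

Lemma psumE s n w : psum s n w = \sum_(m <- [seq m <- s | lev m n]) Z m w.
Proof. by rewrite /psum big_filter. Qed.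

(* The coordinates from k on are frozen at those of n. *)
Definition exceed (k : nat) (s : seq I) (n : I) (t : R) : set Omega :=
  \bigcup_(m in [set m | lev m n /\
       forall i : 'I_d, (k <= i)%N -> m ord0 i = n ord0 i])
    [set w | t < `|psum s m w|].

Lemma sig_exceed (A : set I) k s n t :
  (forall m, lev m n -> (forall i : 'I_d, (k <= i)%N -> m ord0 i = n ord0 i) ->
    forall l, l \in s -> lev l m -> A l) -> sig Z A (exceed k s n t).
Proof.
move=> h; apply: sig_bigcup_countType => m [mn mk].
have -> : [set w | t < `|psum s m w|] =
  [set w | t < `|\sum_(i <- [seq m' <- s | lev m' m]) Z i w|].
  by apply/seteqP; split => w; rewrite /= psumE.
apply: sig_gt_sum => l /=; rewrite mem_filter => /andP[lm ls].
exact: (h m).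
Qed.

Lemma exceed_measurable k s n t : measurable (exceed k s n t).
Proof. by apply: (@sig_measurable _ _ _ P _ Z setT); exact: sig_exceed. Qed.

Lemma psum_gt_measurable s n t : measurable [set w | t < `|psum s n w|].
Proof.
have -> : [set w | t < `|psum s n w|] =
  [set w | t < `|\sum_(i <- [seq m' <- s | lev m' n]) Z i w|].
  by apply/seteqP; split => w; rewrite /= psumE.
by apply: (@sig_measurable _ _ _ P _ Z setT); exact: sig_gt_sum.
Qed.

Definition upd (n : I) (k : 'I_d) (j : nat) : I :=
  \row_i (if i == k then j else n ord0 i).

Lemma exceed_S (k : 'I_d) s (n : I) t :
  exceed k.+1 s n t `<=`
  \big[setU/set0]_(j < (n ord0 k).+1) exceed k s (upd n k j) t.
Proof.
move=> w [m [/levP mn mk] tm].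
rewrite -(bigcup_mkord _ (fun j => exceed k s (upd n k j) t)).
exists (m ord0 k); first by rewrite /= ltnS.
exists m => //; split.
  by apply/levP => i; rewrite mxE; case: eqP => [->|_].
move=> i ki; rewrite mxE; case: eqP => [->//|/eqP ik].
by apply: mk; rewrite ltn_neqAle ki andbT eq_sym.
Qed.

(** Raising coordinate [k] from [j] to that of [n] adds the slab of indices beyond [j]. If the slab
    contributes at most [u] whatever the lower coordinates are, an excess over [t + u] leaves an
    excess over [t]. *)
Lemma exceed_psum (k : 'I_d) s (n : I) t u (j : nat) : (j <= n ord0 k)%N ->
  exceed k s (upd n k j) (t + u) `&`
  ~` exceed k [seq m : I <- s | (j < m ord0 k)%N] n u `<=` exceed k s n t.
Proof.
move=> jn w [[m [/levP mn mk] tm] hF].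
have mkj : m ord0 k = j by rewrite mk// mxE eqxx.
pose m' := upd m k (n ord0 k).
have m'n : lev m' n.
  apply/levP => i; rewrite mxE; case: eqP => [->//|/eqP ik].
  by have := mn i; rewrite mxE (negbTE ik).
have m'k (i : 'I_d) : (k <= i)%N -> m' ord0 i = n ord0 i.
  move=> ki; rewrite mxE; case: eqP => [->//|/eqP ik].
  by rewrite mk// mxE (negbTE ik).
exists m' => //=.
have : ~ (u < `|psum [seq m : I <- s | (j < m ord0 k)%N] m' w|).
  by move=> h; apply: hF; exists m'.
suff -> : psum s m' w =
    psum s m w + psum [seq m : I <- s | (j < m ord0 k)%N] m' w.
  move/negP; rewrite -leNgt => h2; move: tm => /= tm.
  have := ler_normB (psum s m w + psum [seq m : I <- s | (j < m ord0 k)%N] m' w)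
     (psum [seq m : I <- s | (j < m ord0 k)%N] m' w).
  by rewrite addrK; lra.
rewrite /psum big_filter_cond [LHS](bigID (fun l : I => (l ord0 k <= j)%N))/=.
congr (_ + _); apply: eq_bigl => l; last by rewrite -ltnNge andbC.
apply/andP/idP => [[/levP h1 h2]|/levP h1].
  apply/levP => i; have := h1 i; rewrite mxE.
  by case: eqP => [->|//]; rewrite mkj.
split; last by rewrite -mkj.
apply/levP => i; rewrite mxE; case: eqP => [->|//].
by apply: leq_trans (h1 k) _; rewrite mkj.
Qed.

Lemma sum_var_filter_le (Q : pred I) (s : seq I) :
  \sum_(m <- [seq m <- s | Q m]) Ex P (fun w => Z m w ^+ 2) <=
  \sum_(m <- s) Ex P (fun w => Z m w ^+ 2).
Proof.
rewrite big_filter big_mkcond/=; apply: ler_sum => m _.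
by case: ifP => // _; apply: Rintegral_ge0 => w _; exact: sqr_ge0.
Qed.

Lemma chebyshev_psum (s : seq I) (n : I) (u V : R) : uniq s ->
  [set` s] `<=` D -> 0 < u ->
  \sum_(m <- s) Ex P (fun w => Z m w ^+ 2) <= V ->
  pr P [set w | u < `|psum s n w|] <= V / u ^+ 2.
Proof.
move=> us sD u0 hV.
have -> : [set w | u < `|psum s n w|] =
    [set w | u < `|\sum_(i <- [seq m' <- s | lev m' n]) Z i w|].
  by apply/seteqP; split => w; rewrite /= psumE.
apply: (chebyshev_sum hZ bZ) => //.
- exact: filter_uniq.
- by move=> m /=; rewrite mem_filter => /andP[_ /sD].
- by move=> m; rewrite mem_filter => /andP[_ /sD]; exact: cZ.
- exact: le_trans (sum_var_filter_le _ _) hV.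
Qed.

(** Induction on the number of free coordinates: releasing one more doubles the probability by
    [ottaviani]. The induction hypothesis is used twice, on the box itself and on the slabs, to show
    that these are small with probability at least 1/2. *)
Lemma multi_ottaviani k : (k <= d)%N -> forall (s : seq I) (n : I) (x sg : R),
  uniq s ->
  [set` s] `<=` D -> 0 < sg ->
  \sum_(m <- s) Ex P (fun w => Z m w ^+ 2) <= sg ^+ 2 ->
  pr P (exceed k s n (x + k%:R * 2 ^+ k * sg)) <=
  2 ^+ k * pr P [set w | x < `|psum s n w|].
Proof.
elim: k => [_|k IH kd] s n x sg us sD sg0 hs.
  rewrite !mul0r addr0 expr0 mul1r; apply: pr_le.
  - exact: exceed_measurable.
  - exact: psum_gt_measurable.
  - move=> w [m [_ mn]]; suff -> : m = n by [].
    by apply/rowP => i; exact: mn.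
pose kk := Ordinal kd.
pose x' := x + k%:R * 2 ^+ k * sg.
(* The first summand is a Chebyshev level: there the slab maximum is exceeded with probability at
   most 2^k 4^-(k+1) <= 1/4. The second is the shift of the induction hypothesis; with the one in
   [x'] the total is (k+1) 2^(k+1) sg. *)
pose a := 2 ^+ k.+1 * sg + k%:R * 2 ^+ k * sg.
pose sj j := [seq m : I <- s | (j < m ord0 kk)%N].
have -> : x + k.+1%:R * 2 ^+ k.+1 * sg = x' + a.
  by rewrite /x' /a -addn1 natrD addn1 exprS; ring.
have IHn := IH (ltnW kd).
apply: (@le_trans _ _ (2 * pr P (exceed k s n x'))); last first.
  by rewrite exprS -mulrA ler_pM2l//; exact: IHn.
apply: (@le_trans _ _ (pr P (\big[setU/set0]_(j < (n ord0 kk).+1)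
    exceed k s (upd n kk j) (x' + a)))).
  apply: pr_le; [exact: exceed_measurable| |exact: (@exceed_S kk)].
  by apply: bigsetU_measurable => j _; exact: exceed_measurable.
(* The past at time [j] is the half-space where coordinate [kk] is at most [j], the future its
   complement. *)
apply: (ottaviani hZ (E := fun j => exceed k s (upd n kk j) (x' + a))
  (F := fun j => ~` exceed k (sj j) n a)
  (A := fun j => D `&` [set m : I | (m ord0 kk <= j)%N])
  (B := fun j => D `&` [set m : I | (j < m ord0 kk)%N])).
- by move=> j m [].
- by move=> j m [].
- move=> j; rewrite -subset0 => m [[_ /= h1] [_ /=]].
  by rewrite ltnNge h1.
- by move=> i j ij m [Dm /= mi]; split => //=; exact: leq_trans ij.
- move=> j; apply: sig_exceed => m mn mk l ls /levP lm; split; first exact: sD.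
  by have := lm kk; rewrite mk//= mxE eqxx.
- move=> j; apply: sigC; apply: sig_exceed => m _ _ l.
  by rewrite mem_filter => /andP[jl ls] _; split; [exact: sD|].
- exact: exceed_measurable.
- by move=> j; rewrite ltnS; exact: (@exceed_psum kk).
- move=> j _; rewrite prC; last exact: exceed_measurable.
  have usj : uniq (sj j) by exact: filter_uniq.
  have sjD : [set` sj j] `<=` D.
    by move=> m /=; rewrite mem_filter => /andP[_]; exact: sD.
  have hsj := le_trans (sum_var_filter_le _ s) hs.
  have := IHn (sj j) n (2 ^+ k.+1 * sg) sg usj sjD sg0 (hsj _).
  rewrite -/a.
  have u0 : 0 < 2 ^+ k.+1 * sg by rewrite mulr_gt0// exprn_gt0.
  have := chebyshev_psum n usj sjD u0 (hsj _).
  have -> : sg ^+ 2 / (2 ^+ k.+1 * sg) ^+ 2 = (2 ^+ k)^-1 * (2 ^+ k)^-1 / 4.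
    have : (2:R) ^+ k != 0 by rewrite expf_neq0// pnatr_eq0.
    have : sg != 0 by rewrite gt_eqF.
    rewrite (exprS _ k); move: (2 ^+ k) => e s0 e0.
    by field; rewrite ?e0 ?s0.
  have e0 : 0 < (2:R) ^+ k by rewrite exprn_gt0.
  have e1 : 1 <= (2:R) ^+ k by rewrite exprn_ege1// ler1n.
  have : (2 ^+ k)^-1 * (2:R) ^+ k = 1 by rewrite mulVf// gt_eqF.
  have : 0 < ((2:R) ^+ k)^-1 by rewrite invr_gt0.
  have : ((2:R) ^+ k)^-1 <= 1 by rewrite invf_le1.
  move: e0 {e1}; move: (2 ^+ k) (2 ^- k) (pr P (exceed _ _ _ _)) (pr P _).
  move=> z y p q z0 y1 y0 yz hq hp.
  have : z * q <= z * (y * y / 4) by rewrite ler_pM2l.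
  have -> : z * (y * y / 4) = y / 4 by rewrite !mulrA [z * y]mulrC yz mul1r.
  by lra.
Qed.

Lemma exceed_anti k s n t u : t <= u -> exceed k s n u `<=` exceed k s n t.
Proof. by move=> tu w [m hm um]; exists m => //; exact: le_lt_trans um. Qed.

(** With c = 2 (d 2^d + 1), the first summand serves when V <= (t/c)^2, where the shift fits into
    t/2 and Chebyshev is applied at t/2. Otherwise c^2 V / t^2 >= 1 and the second summand makes the
    bound trivial. *)
Definition max_cst : R := 2 ^+ d * 4 + (2 * (d%:R * 2 ^+ d + 1)) ^+ 2.

Lemma max_cst_gt0 : 0 < max_cst.
Proof.
rewrite /max_cst; apply: ltr_wpDr; first exact: sqr_ge0.
by rewrite mulr_gt0// exprn_gt0.
Qed.

Lemma max_chebyshev (s : seq I) (n : I) (t V : R) : uniq s ->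
  [set` s] `<=` D -> 0 < t ->
  \sum_(m <- s) Ex P (fun w => Z m w ^+ 2) <= V ->
  pr P (exceed d s n t) <= max_cst * V / t ^+ 2.
Proof.
move=> us sD t0 hV.
have V0 : 0 <= V.
  apply: le_trans hV; apply: sumr_ge0 => m _.
  by apply: Rintegral_ge0 => w _; exact: sqr_ge0.
pose q : R := d%:R * 2 ^+ d.
have q0 : 0 <= q by rewrite /q mulr_ge0// exprn_ge0.
pose c := 2 * (q + 1).
have c0 : 0 < c by rewrite /c; lra.
have sg0 : 0 < t / c by rewrite divr_gt0.
have e0 : 0 < (2 : R) ^+ d by rewrite exprn_gt0.
have t20 : 0 < t ^+ 2 by rewrite exprn_gt0.
rewrite ler_pdivlMr// /max_cst -/q -/c.
have [Vs|/ltW sV] := leP V ((t / c) ^+ 2); last first.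
  have : pr P (exceed d s n t) <= 1 by apply: pr_le1; exact: exceed_measurable.
  have h : t ^+ 2 <= c ^+ 2 * V.
    rewrite expr_div_n in sV; rewrite mulrC.
    by move: sV; rewrite ler_pdivrMr// exprn_gt0.
  move=> h1; apply: (@le_trans _ _ (t ^+ 2)).
    by rewrite -[leRHS]mul1r ler_pM2r.
  apply: (le_trans h); rewrite ler_wpM2r// lerDr.
  by rewrite mulr_ge0// ltW.
have h1 := multi_ottaviani (leqnn d) n (t / 2) us sD sg0 (le_trans hV Vs).
have h2 : pr P (exceed d s n t) <= pr P (exceed d s n (t / 2 + q * (t / c))).
  apply: pr_le; try exact: exceed_measurable.
  apply: exceed_anti.
  have : q * (t / c) <= t / 2; last lra.
  by rewrite mulrA ler_pdivrMr// /c; nra.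
have h3 : pr P [set w | t / 2 < `|psum s n w|] <= V / (t / 2) ^+ 2.
  by apply: chebyshev_psum => //; rewrite divr_gt0.
have h4 : pr P (exceed d s n t) <= 2 ^+ d * (V / (t / 2) ^+ 2).
  by apply: (le_trans h2); apply: (le_trans h1); rewrite ler_pM2l.
have -> : (2 ^+ d * 4 + c ^+ 2) * V =
  2 ^+ d * (V / (t / 2) ^+ 2) * t ^+ 2 + c ^+ 2 * V.
  by field; rewrite gt_eqF.
have : 0 <= c ^+ 2 * V by rewrite mulr_ge0// sqr_ge0.
have : pr P (exceed d s n t) * t ^+ 2 <= 2 ^+ d * (V / (t / 2) ^+ 2) * t ^+ 2.
  by rewrite ler_pM2r.
by move=> {h1 h2 h3 h4} h h'; lra.
Qed.

End multi_index.

(** * Exponential bounds for truncated variables *)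

Section exp_bounds.
Context {R : realType}.
Implicit Types x : R.

Lemma nondecr_of_deriv (f f' : R -> R) x :
  (forall y : R, is_derive y 1 f (f' y)) ->
  (forall y, 0 <= y -> 0 <= f' y) -> 0 <= x -> f 0 <= f x.
Proof.
move=> df hf x0.
have [c] : exists2 c, c \in `[0, x] & f x - f 0 = f' c * (x - 0).
  apply: MVT_segment => //.
  by apply: derivable_within_continuous => y _; exact: ex_derive.
rewrite in_itv/= => /andP[c0 _] h.
by rewrite -subr_ge0 h subr0 mulr_ge0// hf.
Qed.

(** The derivative of the gap between the two sides is nonnegative by the Taylor bound one order
    lower; [expRN_ge3] continues in the same way. *)
Lemma expRN_le2 x : 0 <= x -> expR (- x) <= 1 - x + x ^+ 2 / 2.
Proof.
move=> x0.
have df (y : R) : is_derive y 1 (fun y : R => y ^+ 2 / 2 + (1 - y) - expR (- y))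
    (y - 1 + expR (- y)).
  by apply: is_derive_eq; rewrite /GRing.scale/=; field.
have := nondecr_of_deriv df _ x0.
rewrite oppr0 expR0 expr0n/=.
have h (y : R) : 0 <= y -> 0 <= y - 1 + expR (- y).
  by move=> _; have := expR_ge1Dx (- y); lra.
by move=> /(_ h); lra.
Qed.

Lemma expRN_ge3 x : 0 <= x -> 1 - x + x ^+ 2 / 2 - x ^+ 3 / 6 <= expR (- x).
Proof.
move=> x0.
have df (y : R) : is_derive y 1
    (fun y : R => expR (- y) - (1 - y + y ^+ 2 / 2 - y ^+ 3 / 6))
    (1 - y + y ^+ 2 / 2 - expR (- y)).
  by apply: is_derive_eq; rewrite /GRing.scale/=; field.
have := nondecr_of_deriv df _ x0.
rewrite oppr0 expR0 !expr0n/=.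
have h (y : R) : 0 <= y -> 0 <= 1 - y + y ^+ 2 / 2 - expR (- y).
  by move=> /expRN_le2; rewrite subr_ge0.
by move=> /(_ h); lra.
Qed.

(** For u < 0 these are the Taylor bounds above; for u >= 0 they follow by inverting the bounds on
    expR(-u). The coefficient 1 of the cubic term leaves room for the inversion. *)
Lemma expR_cubic (u : R) : `|u| <= 1 / 2 ->
  1 + u + u ^+ 2 / 2 - `|u| ^+ 3 <= expR u <= 1 + u + u ^+ 2 / 2 + `|u| ^+ 3.
Proof.
have [u0|u0] := leP 0 u; [rewrite (ger0_norm u0) => u2|rewrite (ltr0_norm u0) => u2].
  have h2 := expRN_le2 u0; have h3 := expRN_ge3 u0.
  have e0 : 0 < expR (- u) by exact: expR_gt0.
  have eu : expR u = (expR (- u))^-1 by rewrite expRN invrK.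
  rewrite eu; apply/andP; split.
    rewrite -[leLHS]mulr1 -[leRHS]mul1r ler_pdivlMr// mulr1.
    apply: (@le_trans _ _ ((1 + u + u ^+ 2 / 2 - u ^+ 3) * (1 - u + u ^+ 2 / 2))).
      rewrite ler_wpM2l//.
      have : u ^+ 3 <= u by rewrite exprSr; nra.
      by have := sqr_ge0 u; lra.
    have -> : (1 + u + u ^+ 2 / 2 - u ^+ 3) * (1 - u + u ^+ 2 / 2) =
      1 + u ^+ 3 * (u / 4 - 1 + u - u ^+ 2 / 2) by field.
    have : 0 <= u ^+ 3 by rewrite exprn_ge0.
    have : u / 4 - 1 + u - u ^+ 2 / 2 <= 0 by nra.
    by nra.
  rewrite -[leRHS]mulr1 -[leLHS]mul1r ler_pdivrMr// mulr1.
  apply: (@le_trans _ _ ((1 + u + u ^+ 2 / 2 + u ^+ 3) *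
       (1 - u + u ^+ 2 / 2 - u ^+ 3 / 6))).
    have -> : (1 + u + u ^+ 2 / 2 + u ^+ 3) * (1 - u + u ^+ 2 / 2 - u ^+ 3 / 6) =
      1 + u ^+ 3 * (u / 4 + (1 - u + u ^+ 2 / 2)
        - (1 + u + u ^+ 2 / 2 + u ^+ 3) / 6) by field.
    have u3 : 0 <= u ^+ 3 by rewrite exprn_ge0.
    rewrite lerDl mulr_ge0//.
    have : u ^+ 3 <= u by rewrite exprSr; nra.
    by nra.
  rewrite ler_wpM2l//.
  by rewrite !addr_ge0// ?divr_ge0 ?exprn_ge0.
have u0' : 0 <= - u by lra.
have := expRN_le2 u0'; have := expRN_ge3 u0'; rewrite opprK.
have : 0 <= (- u) ^+ 3 by rewrite exprn_ge0.
rewrite sqrrN; move: (u ^+ 2) ((- u) ^+ 3) (expR u) => a b c *.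
by apply/andP; split; lra.
Qed.

Lemma expR_quadratic (u e : R) : `|u| <= e -> e <= 1 / 2 ->
  1 + u + (1 - 2 * e) * (u ^+ 2 / 2) <= expR u <=
  1 + u + (1 + 2 * e) * (u ^+ 2 / 2).
Proof.
move=> ue e2; have /andP[h1 h2] := expR_cubic (le_trans ue e2).
have : `|u| ^+ 3 <= e * u ^+ 2.
  by rewrite exprS real_normK ?num_real// ler_wpM2r ?sqr_ge0.
by move=> h; apply/andP; split; lra.
Qed.

(** Turns a lower bound 1 + v on a moment generating function into an exponential, which can be
    raised to a power. *)
Lemma expR_le_quad (v e : R) : 0 <= v <= e -> e <= 1 / 2 ->
  expR (v * (1 - e)) <= 1 + v.
Proof.
move=> /andP[v0 ve] e2.
have h : `|v * (1 - e)| <= 1 / 2 by rewrite ger0_norm; nra.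
have /andP[_ h1] := expR_quadratic (lexx _) h.
apply: (le_trans h1).
set w := v * (1 - e); have w0 : 0 <= w by rewrite /w; nra.
rewrite ger0_norm//.
have : w <= v by rewrite /w; nra.
have : w + v * e = v by rewrite /w; ring.
nra.
Qed.

(** One term dominates in each region: the first for y <= x1, the indicator term in the window, the
    last for y > x2. *)
Lemma tilt_pointwise (t dl x1 x2 y : R) : 0 <= t -> 0 <= dl ->
  expR (t * y) <= expR (dl * t * x1) * expR ((1 - dl) * t * y) +
  (expR (t * x2) * (x1 < y)%R%:R +
   expR (- (dl * t * x2)) * expR ((1 + dl) * t * y)).
Proof.
move=> t0 dl0; have dt0 : 0 <= dl * t by rewrite mulr_ge0.
rewrite -!expRD.
have p1 := expR_ge0 (dl * t * x1 + (1 - dl) * t * y).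
have p2 := expR_ge0 (t * x2).
have p3 := expR_ge0 (- (dl * t * x2) + (1 + dl) * t * y).
have [xy|yx] := ltP x1 y; rewrite ?mulr1 ?mulr0.
  have [yx|xy2] := leP y x2.
    have : expR (t * y) <= expR (t * x2) by rewrite ler_expR ler_wpM2l.
    lra.
  have : expR (t * y) <= expR (- (dl * t * x2) + (1 + dl) * t * y).
    have : 0 <= dl * t * (y - x2) by rewrite mulr_ge0// subr_ge0 ltW.
    by rewrite ler_expR; lra.
  lra.
have : expR (t * y) <= expR (dl * t * x1 + (1 - dl) * t * y).
  have : 0 <= dl * t * (x1 - y) by rewrite mulr_ge0// subr_ge0.
  by rewrite ler_expR; lra.
lra.
Qed.

Lemma expRN2_le : expR (- 2) <= 1 / 4 :> R.
Proof.
have := expR_ge1Dx (1 : R); rewrite expRN -[2]/(1 + 1) expRD => h.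
by rewrite div1r lef_pV2 ?posrE ?mulr_gt0 ?expR_gt0//; nra.
Qed.

Lemma tilt_small (b t e dl : R) : 0 <= b -> 0 <= t -> 0 < dl <= 1 ->
  (1 + dl) * t * (2 * b) <= e -> e <= dl ^+ 2 / 24 ->
  [/\ 0 <= e, e <= 1 / 2, `|t| * (2 * b) <= e,
      `|(1 - dl) * t| * (2 * b) <= e & `|(1 + dl) * t| * (2 * b) <= e].
Proof.
move=> b0 t0 /andP[dl0 dl1] te edl.
have dl2 : dl ^+ 2 <= 1 by rewrite exprn_ile1// ltW.
have y0 : 0 <= t * (2 * b) by rewrite mulr_ge0// mulr_ge0.
have dy0 : 0 <= dl * (t * (2 * b)) by rewrite mulr_ge0// ltW.
rewrite !ger0_norm//; try by rewrite mulr_ge0//; lra.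
by split; lra.
Qed.

(** At x1 = (1 - dl) t v and x2 = (1 + dl) t v both outer exponents are E (1 - dl^2) / 2 up to
    errors in [e]. All errors together are at most 11 e / 2 <= dl^2 / 4, which is the origin of 24;
    the remaining loss E dl^2 / 4 >= 2 gives the factor exp(-2) <= 1/4. *)
Lemma tilt_exponents (v t e dl : R) : 0 <= v -> 0 < dl <= 1 -> 0 <= e ->
  e <= dl ^+ 2 / 24 -> 8 <= t ^+ 2 * v * dl ^+ 2 ->
  let E := t ^+ 2 * v in let M := expR ((1 - 3 * e) * (E / 2)) in
  [/\ expR (dl * t * ((1 - dl) * t * v)) *
        expR ((1 + 2 * e) * (((1 - dl) * t) ^+ 2 * v / 2)) <= M / 4,
      expR (- (dl * t * ((1 + dl) * t * v))) *
        expR ((1 + 2 * e) * (((1 + dl) * t) ^+ 2 * v / 2)) <= M / 4 &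
      expR (- (E * (1 / 2 + 2 * dl))) / 2 <=
        expR (- (t * ((1 + dl) * t * v))) * (M / 2)].
Proof.
move=> v0 /andP[dl0 dl1] e0 edl hE E M.
have E0 : 0 <= E by rewrite /E mulr_ge0 ?sqr_ge0.
have hq c : c <= (1 - 3 * e) / 2 - dl ^+ 2 / 4 -> expR (E * c) <= M / 4.
  move=> h; apply: (@le_trans _ _ (expR ((1 - 3 * e) * (E / 2) - 2))).
    by rewrite ler_expR; have := ler_wpM2l E0 h; rewrite -/E in hE; lra.
  rewrite expRD /M ler_pM2l ?expR_gt0//; have := expRN2_le; lra.
rewrite -!expRD; split.
- have -> : dl * t * ((1 - dl) * t * v) +
      (1 + 2 * e) * (((1 - dl) * t) ^+ 2 * v / 2) =
      E * (dl * (1 - dl) + (1 + 2 * e) * (1 - dl) ^+ 2 / 2).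
    by rewrite /E; ring.
  apply: hq; have : (1 - dl) ^+ 2 <= 1 by rewrite exprn_ile1//; lra.
  by move/(ler_wpM2l e0); lra.
- have -> : - (dl * t * ((1 + dl) * t * v)) +
      (1 + 2 * e) * (((1 + dl) * t) ^+ 2 * v / 2) =
      E * (- (dl * (1 + dl)) + (1 + 2 * e) * (1 + dl) ^+ 2 / 2).
    by rewrite /E; ring.
  apply: hq.
  have : (1 + dl) ^+ 2 <= 4.
    have : dl ^+ 2 <= 1 by rewrite exprn_ile1// ltW.
    by rewrite sqrrD !expr1n; lra.
  by move/(ler_wpM2l e0); lra.
- rewrite mulrA ler_pM2r// -expRD ler_expR.
  have -> : t * ((1 + dl) * t * v) = E * (1 + dl) by rewrite /E; ring.
  have : 0 <= E * (dl - 3 * e / 2).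
    rewrite mulr_ge0//.
    have : dl * dl <= dl by rewrite ger_pMr.
    by rewrite -expr2; lra.
  by lra.
Qed.

Lemma expR1_le3 : expR 1 <= 3 :> R.
Proof.
have h := expRN_ge3 (@ler01 R).
have e0 := expR_gt0 (-1 : R).
have -> : expR 1 = (expR (-1))^-1 :> R by rewrite expRN invrK.
rewrite -[leRHS]invrK lef_pV2 ?posrE ?invr_gt0//.
by move: h; rewrite !expr1n; lra.
Qed.

End exp_bounds.

(** * Truncated and centred copies, and their exponential moments *)

Section truncation.
Context {dsp : measure_display} {Omega : measurableType dsp} {R : realType}.
Variable P : probability Omega R.

Definition mkRV (f : Omega -> R) (mf : measurable_fun setT f) : {RV P >-> R} :=
  mfun_Sub (mem_set mf).

Lemma law_Ex (X Y : {RV P >-> R}) (phi : R -> R) : same_distribution X Y ->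
  measurable_fun setT phi -> (exists M : R, forall x, `|phi x| <= M) ->
  Ex P (fun w => phi (X w)) = Ex P (fun w => phi (Y w)).
Proof.
move=> XY mphi [M hM].
have bmc (Z : {RV P >-> R}) : P.-integrable setT ((EFin \o phi) \o Z).
  apply: (@bm_int _ _ _ P (phi \o Z)); split; last by exists M => w; exact: hM.
  exact: measurableT_comp.
have mEphi : measurable_fun setT (EFin \o phi) by exact/measurable_EFinP.
rewrite /Ex /Rintegral; congr fine.
transitivity (\int[distribution P X]_y (EFin \o phi) y)%E.
  by rewrite integral_distribution.
transitivity (\int[distribution P Y]_y (EFin \o phi) y)%E.
  by apply: eq_measure_integral => A mA _; exact: XY.
by rewrite integral_distribution.
Qed.

Lemma law_ge0_integral (X Y : {RV P >-> R}) (phi : R -> R) :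
  same_distribution X Y -> measurable_fun setT phi -> (forall x, 0 <= phi x) ->
  (\int[P]_w (phi (X w))%:E = \int[P]_w (phi (Y w))%:E)%E.
Proof.
move=> XY mphi phi0.
have mEphi : measurable_fun setT (EFin \o phi) by exact/measurable_EFinP.
transitivity (\int[distribution P X]_y (EFin \o phi) y)%E.
  by rewrite ge0_integral_distribution// => y; rewrite lee_fin.
transitivity (\int[distribution P Y]_y (EFin \o phi) y)%E.
  by apply: eq_measure_integral => A mA _; exact: XY.
by rewrite ge0_integral_distribution// => y; rewrite lee_fin.
Qed.

Lemma indep_comp (I : choiceType) (D : set I) (X Z : I -> {RV P >-> R})
    (phi : R -> R) : measurable_fun setT phi ->
  (forall i w, Z i w = phi (X i w)) -> independent_RVs D X ->
  independent_RVs D Z.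
Proof.
move=> mphi ZX hX J B JD mB.
have ZB i : Z i @^-1` B i = X i @^-1` (phi @^-1` B i).
  by apply/seteqP; split => w /=; rewrite ZX.
under eq_bigcapr do rewrite ZB.
under eq_bigr do rewrite ZB.
apply: (hX J (fun i => phi @^-1` B i)) => // i.
by rewrite -[X in measurable X]setTI; exact: mphi.
Qed.

(** Large values are sent to 0 rather than clipped to the level, so the discarded part is x itself
    wherever truncation acts. *)
Definition trunc (b x : R) : R := if `|x| <= b then x else 0.

Lemma trunc_measurable b : measurable_fun setT (trunc b).
Proof.
apply: measurable_fun_ifT => //.
by apply: measurable_fun_ler => //; exact: normr_measurable.
Qed.

Lemma trunc_le b x : 0 <= b -> `|trunc b x| <= b.
Proof. by rewrite /trunc; case: ifP; rewrite ?normr0. Qed.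

Lemma bm_trunc b (X : {RV P >-> R}) : 0 <= b -> bm (fun w => trunc b (X w)).
Proof.
move=> b0; split; last by exists b => w; exact: trunc_le.
by apply: measurableT_comp => //; exact: trunc_measurable.
Qed.

Variables (I : choiceType) (D : set I) (X : I -> {RV P >-> R}).
Variable xi : {RV P >-> R}.
Hypothesis hX : independent_copies D X xi.

Definition tmean b : R := Ex P (fun w => trunc b (xi w)).

Definition tvar b : R := Ex P (fun w => (trunc b (xi w) - tmean b) ^+ 2).

Definition ctrunc b x := trunc b x - tmean b.

Lemma ctrunc_measurable b : measurable_fun setT (ctrunc b).
Proof. by apply: measurable_funB => //; exact: trunc_measurable. Qed.

Lemma ctrunc_RV_measurable b i : measurable_fun setT (fun w => ctrunc b (X i w)).
Proof. by apply: measurableT_comp => //; exact: ctrunc_measurable. Qed.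

Definition tZ b i : {RV P >-> R} := mkRV (ctrunc_RV_measurable b i).

Lemma tmean_le b : 0 <= b -> `|tmean b| <= b.
Proof.
move=> b0; have bt := bm_trunc xi b0; rewrite ler_norml; apply/andP; split.
  rewrite -[leLHS](Ex_cst P); apply: le_Ex => //; first exact: bm_cst.
  by move=> w /=; have := trunc_le (xi w) b0; rewrite ler_norml => /andP[].
rewrite -[leRHS](Ex_cst P); apply: le_Ex => //; first exact: bm_cst.
by move=> w /=; have := trunc_le (xi w) b0; rewrite ler_norml => /andP[].
Qed.

Lemma ctrunc_le b x : 0 <= b -> `|ctrunc b x| <= 2 * b.
Proof.
move=> b0; rewrite (le_trans (ler_normB _ _))//.
have := trunc_le x b0; have := tmean_le b0; lra.
Qed.

Lemma tZ_indep b : independent_RVs D (tZ b).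
Proof. by apply: (indep_comp (@ctrunc_measurable b) _ hX.1). Qed.

Lemma tZ_bm b : 0 <= b -> forall i, bm (tZ b i).
Proof.
move=> b0 i; split; first exact: ctrunc_RV_measurable.
by exists (2 * b) => w; exact: ctrunc_le.
Qed.

Lemma tZ_mean b i : 0 <= b -> D i -> Ex P (tZ b i) = 0.
Proof.
move=> b0 Di; rewrite (law_Ex (hX.2 i Di) (@ctrunc_measurable b)).
  rewrite /ctrunc ExB ?Ex_cst//; [|exact: bm_trunc|exact: bm_cst].
  by rewrite /tmean subrr.
by exists (2 * b) => x; exact: ctrunc_le.
Qed.

Lemma tZ_var b i : 0 <= b -> D i -> Ex P (fun w => tZ b i w ^+ 2) = tvar b.
Proof.
move=> b0 Di.
apply: (law_Ex (phi := fun x => ctrunc b x ^+ 2) (hX.2 i Di)).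
  by apply: measurable_funX; exact: ctrunc_measurable.
exists ((2 * b) ^+ 2) => x; rewrite normrX.
by rewrite ler_pXn2r ?nnegrE ?mulr_ge0 ?ctrunc_le.
Qed.

Lemma tvar_ge0 b : 0 <= tvar b.
Proof. by apply: Rintegral_ge0 => w _; exact: sqr_ge0. Qed.

Lemma tvarE b : 0 <= b ->
  tvar b = Ex P (fun w => trunc b (xi w) ^+ 2) - tmean b ^+ 2.
Proof.
move=> b0; have bt := bm_trunc xi b0.
rewrite /tvar; have -> : (fun w => (trunc b (xi w) - tmean b) ^+ 2) =
  (fun w => trunc b (xi w) * trunc b (xi w) -
     ((2 * tmean b) * trunc b (xi w) - tmean b ^+ 2)).
  by apply/funext => w; ring.
rewrite ExB; [|exact: bmM|by apply: bmB; [exact: bmZ|exact: bm_cst]].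
rewrite ExB; [|exact: bmZ|exact: bm_cst].
rewrite ExZ// Ex_cst -/(tmean b).
under [in RHS]eq_fun do rewrite expr2.
by ring.
Qed.

Definition tmgf b t := Ex P (fun w => expR (t * ctrunc b (xi w))).

Lemma tmgf_sum b t (s : seq I) : 0 <= b -> uniq s -> [set` s] `<=` D ->
  Ex P (fun w => expR (t * \sum_(i <- s) tZ b i w)) = tmgf b t ^+ size s.
Proof.
move=> b0 us sD; rewrite (mgf_sum (@tZ_indep b) (tZ_bm b0))//.
rewrite (eq_big_seq (fun=> tmgf b t)); last first.
  move=> i /sD Di.
  apply: (law_Ex (phi := fun x => expR (t * ctrunc b x)) (hX.2 i Di)).
    apply: measurableT_comp => //; apply: measurableT_comp => //.
    exact: ctrunc_measurable.
  exists (expR (`|t| * (2 * b))) => x.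
  rewrite ger0_norm ?expR_ge0// ler_expR (le_trans (ler_norm _))// normrM.
  by rewrite ler_wpM2l// ctrunc_le.
by rewrite big_const_seq count_predT iter_mulr_1.
Qed.

(** The quadratic estimate of the exponential is integrated; centring removes the linear term. *)
Lemma tmgf_bounds b t e : 0 <= b -> `|t| * (2 * b) <= e -> e <= 1 / 2 ->
  1 + (1 - 2 * e) * (t ^+ 2 * tvar b / 2) <= tmgf b t <=
  1 + (1 + 2 * e) * (t ^+ 2 * tvar b / 2).
Proof.
move=> b0 te e2.
have bc : bm (fun w => ctrunc b (xi w)).
  by apply: bmB; [exact: bm_trunc|exact: bm_cst].
have hu w : `|t * ctrunc b (xi w)| <= e.
  by rewrite (le_trans _ te)// normrM ler_wpM2l// ctrunc_le.
have E (c : R) : Ex P (fun w => 1 + (t * ctrunc b (xi w) +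
    (c * t ^+ 2 / 2) * (ctrunc b (xi w) * ctrunc b (xi w)))) =
    1 + c * (t ^+ 2 * tvar b / 2).
  rewrite ExD; [|exact: bm_cst|by apply: bmD; [exact: bmZ|exact/bmZ/bmM]].
  rewrite ExD; [|exact: bmZ|exact/bmZ/bmM].
  rewrite Ex_cst !ExZ//; last exact: bmM.
  have -> : Ex P (fun w => ctrunc b (xi w)) = 0.
    rewrite ExB ?Ex_cst; [|exact: bm_trunc|exact: bm_cst].
    by rewrite /tmean subrr.
  under eq_fun do rewrite -expr2.
  by rewrite -/(tvar b) /tvar; ring.
have bq (c : R) : bm (fun w => 1 + (t * ctrunc b (xi w) +
    (c * t ^+ 2 / 2) * (ctrunc b (xi w) * ctrunc b (xi w)))).
  by apply: bmD; [exact: bm_cst|apply: bmD; [exact: bmZ|exact/bmZ/bmM]].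
rewrite -!E /tmgf; apply/andP; split; apply: le_Ex => //.
- exact/bm_expR/bmZ.
- move=> w; have /andP[h _] := expR_quadratic (hu w) e2.
  by apply: le_trans h; rewrite exprMn; lra.
- exact/bm_expR/bmZ.
- move=> w; have /andP[_ h] := expR_quadratic (hu w) e2.
  by apply: (le_trans h); rewrite exprMn; lra.
Qed.


Let S b (s : seq I) := fun w => \sum_(i <- s) tZ b i w.

Lemma tsum_bm b (s : seq I) : 0 <= b -> bm (S b s).
Proof. by move=> b0; apply: bm_sum => i; exact: tZ_bm. Qed.

Lemma tsum_mgf_le b (s : seq I) (t e : R) : 0 <= b -> uniq s ->
  [set` s] `<=` D -> `|t| * (2 * b) <= e -> e <= 1 / 2 ->
  Ex P (fun w => expR (t * S b s w)) <=
  expR ((size s)%:R * ((1 + 2 * e) * (t ^+ 2 * tvar b / 2))).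
Proof.
move=> b0 us sD te e2; rewrite /S tmgf_sum//.
have /andP[_ h] := tmgf_bounds b0 te e2.
rewrite expRM_natl; apply: lerXn2r; rewrite ?nnegrE ?expR_ge0//.
  by apply: Rintegral_ge0 => w _; exact: expR_ge0.
exact: (le_trans h (expR_ge1Dx _)).
Qed.

(** The factor 1 - 3 e is a lower bound for (1 - 2 e)(1 - e): one factor comes from the moment
    estimate, the other from passing from 1 + v to an exponential. *)
Lemma tsum_mgf_ge b (s : seq I) (t e : R) : 0 <= b -> uniq s ->
  [set` s] `<=` D -> `|t| * (2 * b) <= e -> e <= 1 / 2 ->
  expR ((size s)%:R * ((1 - 3 * e) * (t ^+ 2 * tvar b / 2))) <=
  Ex P (fun w => expR (t * S b s w)).
Proof.
move=> b0 us sD te e2; rewrite /S tmgf_sum//.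
have /andP[h _] := tmgf_bounds b0 te e2.
have e0 : 0 <= e by apply: le_trans te; rewrite mulr_ge0// mulr_ge0.
have v0 : 0 <= t ^+ 2 * tvar b / 2.
  by rewrite divr_ge0// mulr_ge0 ?sqr_ge0 ?tvar_ge0.
have vb : tvar b <= (2 * b) ^+ 2.
  rewrite -[leRHS](Ex_cst P) /tvar; apply: le_Ex.
  - under eq_fun do rewrite expr2; apply: bmM.
      by apply: bmB; [exact: bm_trunc|exact: bm_cst].
    by apply: bmB; [exact: bm_trunc|exact: bm_cst].
  - exact: bm_cst.
  - move=> w /=; rewrite -[leLHS]real_normK ?num_real//.
    by rewrite ler_pXn2r ?nnegrE ?mulr_ge0// ctrunc_le.
have ve : t ^+ 2 * tvar b <= e ^+ 2.
  apply: (@le_trans _ _ ((`|t| * (2 * b)) ^+ 2)).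
    by rewrite exprMn real_normK ?num_real// ler_wpM2l// sqr_ge0.
  by rewrite ler_pXn2r ?nnegrE// mulr_ge0// mulr_ge0.
rewrite expRM_natl; apply: lerXn2r; rewrite ?nnegrE ?expR_ge0//.
  by apply: Rintegral_ge0 => w _; exact: expR_ge0.
apply: le_trans h.
have ue : 0 <= (1 - 2 * e) * (t ^+ 2 * tvar b / 2) <= e.
  by apply/andP; split; nra.
apply: le_trans (expR_le_quad ue e2); rewrite ler_expR; nra.
Qed.

(** Chernoff's bound at [t] and at [- t], one for each sign of the sum. *)
Lemma exp_upper b (s : seq I) (t x e : R) : 0 <= b -> uniq s ->
  [set` s] `<=` D -> 0 <= t -> t * (2 * b) <= e -> e <= 1 / 2 ->
  pr P [set w | x < `|S b s w|] <=
  2 * expR (- (t * x) + (size s)%:R * ((1 + 2 * e) * (t ^+ 2 * tvar b / 2))).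
Proof.
move=> b0 us sD t0 te e2.
have bS := tsum_bm s b0.
have half (u : R) : `|u| = t ->
    Ex P (fun w => expR (- (t * x)) * expR (u * S b s w)) <=
    expR (- (t * x) + (size s)%:R * ((1 + 2 * e) * (t ^+ 2 * tvar b / 2))).
  move=> ut; rewrite ExZ; last exact/bm_expR/bmZ.
  rewrite [leRHS]expRD ler_pM2l ?expR_gt0//.
  have u2 : u ^+ 2 = t ^+ 2 by rewrite -[in LHS](@real_normK _ u) ?num_real// ut.
  by rewrite -u2; apply: tsum_mgf_le; rewrite ?ut.
have mA : measurable [set w | x < `|S b s w|].
  rewrite -[X in measurable X]setTI; apply: measurable_fun_ltr => //.
  by apply: measurableT_comp => //; exact: bS.1.
have be (u : R) : bm (fun w => expR (- (t * x)) * expR (u * S b s w)).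
  by apply: bmZ; apply: bm_expR; exact: bmZ.
have h1 := half t (ger0_norm t0).
have h2 := half (- t) (etrans (normrN t) (ger0_norm t0)).
apply: (@le_trans _ _ (Ex P (fun w => expR (- (t * x)) * expR (t * S b s w) +
   expR (- (t * x)) * expR (- t * S b s w)))); last by rewrite ExD//; lra.
rewrite -Ex_indic//; apply: le_Ex; [exact: bm_indic|exact: bmD|].
move=> w; rewrite indicE -!expRD.
case: (boolP (w \in _)) => [|_] /=; last by rewrite addr_ge0// expR_ge0.
rewrite inE /= => xS.
have [S0|S0] := leP 0 (S b s w).
  rewrite (ger0_norm S0) in xS.
  apply: (@le_trans _ _ (expR (- (t * x) + t * S b s w))).
    rewrite -[leLHS]expR0 ler_expR.
    have : 0 <= t * (S b s w - x) by rewrite mulr_ge0// subr_ge0 ltW.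
    by lra.
  by rewrite lerDl expR_ge0.
rewrite (ltr0_norm S0) in xS.
apply: (@le_trans _ _ (expR (- (t * x) + - t * S b s w))).
  rewrite -[leLHS]expR0 ler_expR.
  have : 0 <= t * (- S b s w - x) by rewrite mulr_ge0// subr_ge0 ltW.
  by lra.
by rewrite lerDr expR_ge0.
Qed.

(* exp (t S) is split according to whether S is below, in or above the window
   between (1 - dl) t v and (1 + dl) t v; tilting by -dl t and dl t shows that
   the outer parts carry at most half of the exponential moment. *)
Lemma exp_lower b (s : seq I) (t e dl : R) : 0 <= b -> uniq s ->
  [set` s] `<=` D -> 0 <= t -> (1 + dl) * t * (2 * b) <= e ->
  0 < dl <= 1 -> e <= dl ^+ 2 / 24 ->
  8 <= t ^+ 2 * ((size s)%:R * tvar b) * dl ^+ 2 ->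
  expR (- (t ^+ 2 * ((size s)%:R * tvar b) * (1 / 2 + 2 * dl))) / 2 <=
  pr P [set w | (1 - dl) * t * ((size s)%:R * tvar b) < S b s w].
Proof.
move=> b0 us sD t0 te dl01 edl.
set v := (size s)%:R * tvar b; set E := t ^+ 2 * v => hE.
have bS := tsum_bm s b0.
have v0 : 0 <= v by rewrite /v mulr_ge0 ?tvar_ge0.
have [dl0 dl1] := andP dl01.
have [e0 e2 te1 te2 te3] := tilt_small b0 t0 dl01 te edl.
have hM := tsum_mgf_ge b0 us sD te1 e2.
have hA := tsum_mgf_le b0 us sD te2 e2.
have hB := tsum_mgf_le b0 us sD te3 e2.
pose x1 := (1 - dl) * t * v; pose x2 := (1 + dl) * t * v.
have mA : measurable [set w | x1 < S b s w].
  by rewrite -[X in measurable X]setTI; apply: measurable_fun_ltr => //; exact: bS.1.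
have be (u : R) : bm (fun w => expR (u * S b s w)) by apply: bm_expR; exact: bmZ.
have key : Ex P (fun w => expR (t * S b s w)) <=
   expR (dl * t * x1) * Ex P (fun w => expR ((1 - dl) * t * S b s w)) +
   (expR (t * x2) * pr P [set w | x1 < S b s w] +
   expR (- (dl * t * x2)) * Ex P (fun w => expR ((1 + dl) * t * S b s w))).
  rewrite -Ex_indic// -!ExZ//; last exact: bm_indic.
  rewrite -ExD; [|by apply: bmZ; exact: bm_indic|exact: bmZ].
  rewrite -ExD; [|exact: bmZ|by apply: bmD; [exact/bmZ/bm_indic|exact: bmZ]].
  apply: le_Ex => //.
    by apply: bmD; [exact: bmZ|apply: bmD; [exact/bmZ/bm_indic|exact: bmZ]].
  move=> w; rewrite indicE.
  have -> : (w \in [set w | x1 < S b s w]) = (x1 < S b s w).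
    by apply/idP/idP; rewrite inE.
  exact: (tilt_pointwise _ _ _ t0 (ltW dl0)).
have [hA' hB' hP] := tilt_exponents v0 dl01 e0 edl hE.
have eqM : (size s)%:R * ((1 - 3 * e) * (t ^+ 2 * tvar b / 2)) =
    (1 - 3 * e) * (E / 2) by rewrite /E /v; ring.
have eqA u : (size s)%:R * ((1 + 2 * e) * (u ^+ 2 * tvar b / 2)) =
    (1 + 2 * e) * (u ^+ 2 * v / 2) by rewrite /v; ring.
rewrite eqM in hM; rewrite eqA in hA; rewrite eqA in hB.
have h1 := le_trans (ler_wpM2l (expR_ge0 (dl * t * x1)) hA) hA'.
have h3 := le_trans (ler_wpM2l (expR_ge0 (- (dl * t * x2))) hB) hB'.
apply: (le_trans hP); rewrite mulrC -ler_pdivlMr ?expR_gt0// -expRN opprK.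
rewrite [leRHS]mulrC.
by move: h1 h3 key hM; clear; rewrite /x1 /x2; lra.
Qed.

End truncation.

(** * Boxes and dyadic shells *)

Section boxes.
Variable d : nat.
Notation I := 'rV[nat]_d.
Implicit Types m n : I.

(** Ordinals start at 0 and multi-indices at 1, hence the successor. *)
Definition bx n : seq I :=
  [seq (\row_i (f i : nat).+1) | f : {dffun forall i : 'I_d, 'I_(n ord0 i)}].

Lemma bx_uniq n : uniq (bx n).
Proof.
rewrite map_inj_uniq ?enum_uniq// => f g /rowP fg.
apply/ffunP => i; apply: val_inj => /=.
by have := fg i; rewrite !mxE => -[].
Qed.

Lemma size_bx n : size (bx n) = vol n.
Proof.
rewrite size_map -cardE card_dep_ffun /vol foldrE big_map big_enum/=.
by apply: eq_bigr => i _; rewrite card_ord.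
Qed.

Lemma bxP m n : reflect (posvec m /\ lev m n) (m \in bx n).
Proof.
apply: (iffP mapP) => [[f _ ->]|[pm /levP mn]].
  by split=> [i|]; [|apply/levP => i]; rewrite mxE//; exact: ltn_ord.
have H i : ((m ord0 i).-1 < n ord0 i)%N.
  by apply: leq_trans (mn i); rewrite prednK// pm.
exists [ffun i => Ordinal (H i)]; first by rewrite mem_enum.
by apply/rowP => i; rewrite mxE ffunE /= prednK// pm.
Qed.

Lemma bx_posvec n : [set` bx n] `<=` posvec (d := d).
Proof. by move=> m /= /bxP[]. Qed.

Lemma lev_trans m n p : lev m n -> lev n p -> lev m p.
Proof.
move=> /levP mn /levP np; apply/levP => i; exact: leq_trans (np i).
Qed.

Lemma lev_refl n : lev n n.
Proof. by apply/levP. Qed.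

Definition cube K : I := const_mx (2 ^ K)%N.

Lemma cube_lev K K' : (K <= K')%N -> lev (cube K) (cube K').
Proof. by move=> KK'; apply/levP => i; rewrite !mxE leq_exp2l. Qed.

Lemma vol_cube K : vol (cube K) = (2 ^ (K * d))%N.
Proof.
rewrite /vol (eq_bigr (fun=> (2 ^ K)%N)); last by move=> i _; rewrite mxE.
by rewrite prod_nat_const card_ord expnM.
Qed.

Definition shell K : seq I :=
  if K is K'.+1 then [seq m <- bx (cube K) | ~~ lev m (cube K')]
  else bx (cube 0).

Lemma shell_sub K : {subset shell K <= bx (cube K)}.
Proof. by case: K => // K m; rewrite mem_filter => /andP[]. Qed.

Lemma shell_uniq K : uniq (shell K).
Proof. by case: K => [|K]; [|apply: filter_uniq]; exact: bx_uniq. Qed.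

Lemma shell_posvec K : [set` shell K] `<=` posvec (d := d).
Proof. by move=> m /= /shell_sub/bxP[]. Qed.

Lemma size_shell K : (size (shell K) <= 2 ^ (K * d))%N.
Proof.
by rewrite -vol_cube -size_bx; apply: uniq_leq_size; [exact: shell_uniq|exact: shell_sub].
Qed.

Context {V : nmodType}.

(** The predicate [Q] allows the box of an arbitrary n inside the cube to be cut into its shell
    traces. *)
Lemma sum_cube_shells K (Q : pred I) (f : I -> V) :
  \sum_(m <- bx (cube K) | Q m) f m =
  \sum_(k < K.+1) \sum_(m <- shell k | Q m) f m.
Proof.
elim: K => [|K IH]; first by rewrite big_ord_recr/= big_ord0 add0r.
rewrite big_ord_recr/= -IH (bigID (fun m => lev m (cube K)))/=; congr (_ + _).
  rewrite -big_filter -[RHS]big_filter; apply: perm_big; apply: uniq_perm.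
  - by rewrite filter_uniq// bx_uniq.
  - by rewrite filter_uniq// bx_uniq.
  - move=> m; rewrite !mem_filter; apply/idP/idP.
      move=> /andP[/andP[-> mK]] /bxP[pm _]; exact/bxP.
    move=> /andP[-> /bxP[pm mK]]; rewrite mK/=; apply/bxP; split => //.
    exact: lev_trans (cube_lev (leqnSn _)).
by rewrite big_filter_cond; apply: eq_bigl => m; rewrite andbC.
Qed.

Lemma sum_bx_sub n p (f : I -> V) : lev n p ->
  \sum_(m <- bx n) f m = \sum_(m <- bx p | lev m n) f m.
Proof.
move=> np; rewrite -[RHS]big_filter; apply: perm_big; apply: uniq_perm.
- exact: bx_uniq.
- by rewrite filter_uniq// bx_uniq.
- move=> m; rewrite mem_filter; apply/bxP/andP => [[pm mn]|[mn /bxP[pm _]]].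
    by split => //; apply/bxP; split => //; exact: lev_trans np.
  by split.
Qed.

End boxes.

Lemma partial_sumE {dsp : measure_display} {Omega : measurableType dsp}
    {R : realType} (P : probability Omega R) (d : nat)
    (X : 'rV[nat]_d -> {RV P >-> R}) n w :
  partial_sum X n w = \sum_(m <- bx n) X m w.
Proof.
rewrite /partial_sum [RHS]fsbig_seq ?bx_uniq//.
suff -> : [set m | posvec m /\ forall i, (m ord0 i <= n ord0 i)%N] =
  [set` bx n] by [].
apply/seteqP; split=> m /=.
  by move=> [pm mn]; apply/bxP; split=> //; apply/levP.
by move=> /bxP[pm /levP].
Qed.

(** * Geometrically growing weights and a Toeplitz lemma *)

Lemma ratio_ge0 {R : realType} (r : R) : 1 < r -> 0 <= r / (r - 1).
Proof. by move=> r1; rewrite divr_ge0; lra. Qed.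

Section weighted_averages.
Context {R : realType}.
Variables (r : R) (c : nat -> R).
Hypothesis r1 : 1 < r.
Hypothesis c0 : forall k, 0 < c k.
Hypothesis cr : forall k, r * c k <= c k.+1.

Lemma weight_sum_le K : \sum_(k < K.+1) c k <= r / (r - 1) * c K.
Proof.
have r10 : 0 < r - 1 by rewrite subr_gt0.
have r0 : 0 < r by rewrite (lt_trans _ r1).
elim: K => [|K IH].
  rewrite big_ord_recr/= big_ord0 add0r ler_peMl ?ltW//.
  by rewrite ltr_pdivlMr// mul1r gtrBl.
rewrite big_ord_recr/=; apply: (@le_trans _ _ (c K.+1 / (r - 1) + c K.+1)).
  rewrite lerD2r (le_trans IH)// mulrAC ler_pM2r ?invr_gt0//; exact: cr.
have -> : c K.+1 / (r - 1) + c K.+1 = r / (r - 1) * c K.+1.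
  by field; rewrite gt_eqF.
by [].
Qed.

Lemma weight_ge_exp K : r ^+ K * c 0 <= c K.
Proof.
elim: K => [|K IH]; first by rewrite expr0 mul1r.
rewrite exprS -mulrA; apply: le_trans (cr K).
by rewrite ler_pM2l// (lt_trans _ r1).
Qed.

Lemma weight_unbounded (M : R) : exists K0, forall K, (K0 <= K)%N -> M <= c K.
Proof.
have r10 : 0 < r - 1 by rewrite subr_gt0.
pose K0 := Num.truncn (`|M| / ((r - 1) * c 0)).
exists K0.+1 => K K0K; apply: le_trans (weight_ge_exp K).
have bern : 1 + K%:R * (r - 1) <= r ^+ K.
  elim: K {K0K} => [|K IH]; first by rewrite mul0r addr0 expr0.
  rewrite exprS -addn1 natrD.
  have : r * (1 + K%:R * (r - 1)) <= r * r ^+ K.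
    by rewrite ler_pM2l// (lt_trans _ r1).
  have : 0 <= K%:R * (r - 1) * (r - 1) by rewrite !mulr_ge0// ltW.
  by lra.
have h : `|M| / ((r - 1) * c 0) <= K%:R.
  apply: (@le_trans _ _ K0.+1%:R); last by rewrite ler_nat.
  by rewrite ltW// Num.Theory.truncnS_gt.
apply: (le_trans (ler_norm M)).
move: h; rewrite ler_pdivrMr ?mulr_gt0// => h; apply: (le_trans h).
by rewrite mulrA ler_pM2r//; lra.
Qed.

(** The finitely many early terms are absorbed by the growth of [c K], the later ones by the
    geometric sum. Uniformity in the parameter is what allows it to be the corner n of a box. *)
Lemma toeplitz (T : Type) (a : nat -> T -> R) (B : nat -> R) :
  (forall k x, `|a k x| <= B k) ->
  (forall e, 0 < e -> exists k0, forall k, (k0 <= k)%N ->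
     forall x, `|a k x| <= e * c k) ->
  forall e, 0 < e -> exists K0, forall K, (K0 <= K)%N ->
    forall x, `|\sum_(k < K.+1) a k x| <= e * c K.
Proof.
move=> aB ae e e0.
have r10 : 0 < r - 1 by rewrite subr_gt0.
have r0 : 0 < r by rewrite (lt_trans _ r1).
(* Chosen so that e' r / (r - 1) = e / 2; the other half of [e] pays for the early terms. *)
pose e' := e / 2 * ((r - 1) / r).
have e'0 : 0 < e' by rewrite /e' mulr_gt0 ?divr_gt0.
have [k0 hk0] := ae _ e'0.
have [K1 hK1] := weight_unbounded (2 / e * \sum_(k < k0) B k).
exists (maxn k0 K1) => K; rewrite geq_max => /andP[k0K K1K] x.
have {}hK1 : \sum_(k < k0) B k <= e / 2 * c K.
  have := hK1 K K1K; rewrite -ler_pdivlMl ?divr_gt0// invf_div.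
  by rewrite mulrC.
have hall k : `|a k x| <= (if (k < k0)%N then B k else 0) + e' * c k.
  case: ltnP => [_|k0k]; last by rewrite add0r; exact: hk0.
  by apply: (le_trans (aB k x)); rewrite lerDl mulr_ge0// ltW.
apply: (le_trans (ler_norm_sum _ _ _)).
apply: (@le_trans _ _ (\sum_(k < K.+1) ((if (k < k0)%N then B k else 0) + e' * c k))).
  by apply: ler_sum => k _; exact: hall.
rewrite big_split/= -mulr_sumr.
have h1 : \sum_(k < K.+1) (if (k < k0)%N then B k else 0) = \sum_(k < k0) B k.
  rewrite -big_mkcond/= (big_ord_widen _ _ (leq_trans k0K (leqnSn K))).
  by [].
have h2 : e' * \sum_(k < K.+1) c k <= e / 2 * c K.
  apply: (@le_trans _ _ (e' * (r / (r - 1) * c K))).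
    by rewrite ler_pM2l// weight_sum_le.
  have -> : e' * (r / (r - 1) * c K) = e / 2 * c K.
    by rewrite /e'; field; rewrite !gt_eqF.
  by [].
by rewrite h1; lra.
Qed.

(* Geometric growth bounds the sum over the levels below x by its last term. *)
Lemma weight_sum_below (x : R) N :
  \sum_(k < N) (if c k < x then c k else 0) <= r / (r - 1) * Num.max x 0.
Proof.
have r10 : 0 < r - 1 by rewrite subr_gt0.
have r0 : 0 < r by rewrite (lt_trans _ r1).
have q0 := ratio_ge0 r1.
elim: N => [|N IH]; first by rewrite big_ord0 mulr_ge0// le_max lexx orbT.
have [cx|xc] := ltP (c N) x.
  apply: (@le_trans _ _ (\sum_(k < N.+1) c k)).
    by apply: ler_sum => k _; case: ifP => // _; exact: ltW.
  apply: (le_trans (weight_sum_le N)); rewrite ler_wpM2l//.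
  by rewrite le_max ltW.
by rewrite big_ord_recr/= ltNge xc/= addr0.
Qed.

Lemma weight_inv_sum_above (x : R) N : 0 < x ->
  \sum_(k < N) (if x <= c k then (c k)^-1 else 0) <= r / (r - 1) / x.
Proof.
move=> x0.
have r10 : 0 < r - 1 by rewrite subr_gt0.
have r0 : 0 < r by rewrite (lt_trans _ r1).
have q0 := ratio_ge0 r1.
(* The sharper claim telescopes, because 1 / c_n <= r / (r - 1) (1 / c_n - 1 / c_(n+1)). *)
suff h n : \sum_(k < n) (if x <= c k then (c k)^-1 else 0) <=
    (if x <= c n then r / (r - 1) * (x^-1 - (c n)^-1) else 0).
  apply: (le_trans (h N)); case: ifP => _; last by rewrite divr_ge0// ltW.
  by rewrite ler_wpM2l// gerBl invr_ge0 ltW.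
elim: n => [|n IH].
  rewrite big_ord0; case: ifP => // xc0.
  by rewrite mulr_ge0// subr_ge0 lef_pV2 ?posrE.
rewrite big_ord_recr/=; have [xn|xn] := leP x (c n).
  have xn1 : x <= c n.+1.
    by apply: (le_trans xn); apply: le_trans (cr n); rewrite ler_peMl// ltW.
  rewrite xn1; rewrite xn in IH.
  have : r / (r - 1) / c n.+1 <= r / (r - 1) / c n - (c n)^-1.
    have -> : r / (r - 1) / c n - (c n)^-1 = (r - 1)^-1 / c n.
      by field; rewrite !gt_eqF.
    rewrite [r / _]mulrC -mulrA ler_pM2l ?invr_gt0//.
    by rewrite ler_pdivrMr// mulrC ler_pdivlMr// mulrC cr.
  by lra.
rewrite (lt_geF xn) in IH; rewrite addr0; apply: (le_trans IH).
case: ifP => // xn1.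
by rewrite mulr_ge0// subr_ge0 lef_pV2 ?posrE.
Qed.

End weighted_averages.

Lemma powR_gt1 {R : realType} (a x : R) : 1 < a -> 0 < x -> 1 < a `^ x.
Proof.
move=> a1 x0; have := @gt0_ltr_powR _ x x0 1 a; rewrite powR1; apply; rewrite ?nnegrE//.
by rewrite ltW// (lt_trans _ a1).
Qed.

Lemma powRD_gt0 {R : realType} (x y z : R) : 0 < x ->
  x `^ (y + z) = x `^ y * x `^ z.
Proof. by move=> x0; rewrite powRD// (gt_eqF x0) implybT. Qed.

Lemma norm_gt_measurable {R : realType} (b : R) :
  measurable [set x : R | b < `|x|].
Proof.
have -> : [set x : R | b < `|x|] = @Num.norm R R @^-1` `]b, +oo[.
  by apply/seteqP; split => x /=; rewrite in_itv/= andbT.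
by rewrite -[X in measurable X]setTI; apply: normr_measurable.
Qed.

(** * Moments beyond a truncation level *)

Section moments.
Context {dsp : measure_display} {Omega : measurableType dsp} {R : realType}.
Variable P : probability Omega R.
Variable xi : {RV P >-> R}.
Implicit Types h : R -> R.

Lemma le_Ex_int (f g : Omega -> R) : bm f -> P.-integrable setT (EFin \o g) ->
  (forall w, f w <= g w) -> Ex P f <= Ex P g.
Proof. by move=> bf ig fg; apply: le_Rintegral => //; exact: bm_int. Qed.

Lemma Zl_int (c : R) (f : Omega -> R) : P.-integrable setT (EFin \o f) ->
  P.-integrable setT (EFin \o (fun w => c * f w)).
Proof. by move=> fi; exact: (integrableZl measurableT c fi). Qed.

Definition above (b : R) h x : R := if `|x| <= b then 0 else h x.

Lemma above_measurable b h : measurable_fun setT h ->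
  measurable_fun setT (above b h).
Proof.
move=> mh; apply: measurable_fun_ifT => //.
by apply: measurable_fun_ler => //; exact: normr_measurable.
Qed.

Lemma above_le b h x : 0 <= h x -> 0 <= above b h x <= h x.
Proof. by rewrite /above; case: ifP => _ h0; rewrite ?lexx ?h0. Qed.

Lemma above_int b h : measurable_fun setT h ->
  P.-integrable setT (EFin \o (h \o xi)) ->
  P.-integrable setT (EFin \o (above b h \o xi)).
Proof.
move=> mh ih; apply: (le_integrable _ _ _ ih) => //.
  apply/measurable_EFinP; apply: measurableT_comp => //.
  exact: above_measurable.
by move=> w _; rewrite /= lee_fin /above; case: ifP => _; rewrite ?normr0.
Qed.

(** Dominated convergence along integer levels, followed by monotonicity in the level. *)
Lemma above_small h (e : R) : measurable_fun setT h -> (forall x, 0 <= h x) ->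
  P.-integrable setT (EFin \o (h \o xi)) -> 0 < e ->
  exists B : R, forall b, B <= b -> Ex P (above b h \o xi) <= e.
Proof.
move=> mh h0 ih e0.
pose f n w := (above n%:R h (xi w))%:E.
have [_ _ +] : [/\ P.-integrable setT (EFin \o cst (0 : R)),
    (\int[P]_(x in setT) `|f n x - 0%:E| @[n --> \oo] --> 0)%E &
    (\int[P]_(x in setT) f n x @[n --> \oo] --> \int[P]_(x in setT) 0%:E)%E].
  apply: (@dominated_convergence _ _ _ P setT measurableT f (EFin \o cst 0)
     (EFin \o (h \o xi))) => //.
  - move=> n; apply/measurable_EFinP; apply: measurableT_comp => //.
    exact: above_measurable.
  - by apply/measurable_EFinP; exact: measurable_cst.
  - apply: aeW => w _; rewrite /f /=.
    apply: cvg_near_cst; near=> n; rewrite /above ifT//.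
    near: n; exact: nbhs_infty_ger.
  - apply: aeW => w n _; rewrite /f /= lee_fin.
    by have /andP[a1 a2] := above_le n%:R (h0 (xi w)); rewrite ger0_norm.
rewrite integral0 => cvf.
have := cvf => /fine_cvgP[_ cvf2].
have : \forall n \near \oo, (fine (\int[P]_x f n x) <= e)%R.
  have /cvgrPdist_le := cvf2 => /(_ _ e0).
  apply: filterS => n /=; rewrite add0r normrN => hn.
  exact: le_trans (ler_norm _) hn.
move=> [N _ hN]; exists N%:R => b Nb.
apply: le_trans (hN N (leqnn _)); rewrite /Ex /Rintegral; apply: fine_le.
- by apply: integrable_fin_num => //; exact: above_int.
- by apply: integrable_fin_num => //; exact: above_int.
apply: ge0_le_integral => //.
- move=> w _; rewrite lee_fin; by have /andP[] := above_le b (h0 (xi w)).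
- by apply/measurable_EFinP; apply: measurableT_comp => //; exact: above_measurable.
- by apply/measurable_EFinP; apply: measurableT_comp => //; exact: above_measurable.
- move=> w _; rewrite /f lee_fin /above /=.
  case: ifPn => xb; first by case: ifP.
  by case: ifP => // xN; rewrite (le_trans xN Nb) in xb.
Unshelve. all: by end_near. Qed.


Lemma sub_trunc b x : x - trunc b x = above b id x.
Proof. by rewrite /trunc /above; case: ifP => _; rewrite ?subrr ?subr0. Qed.

Lemma mean_tmean b : 0 <= b -> P.-integrable setT (EFin \o xi) ->
  `|Ex P xi - tmean xi b| <= Ex P (above b Num.norm \o xi).
Proof.
move=> b0 ixi.
have it := bm_int P (bm_trunc xi b0).
rewrite /tmean /Ex -RintegralB//.
apply: le_trans; first by apply: le_normr_Rintegral => //; exact: (integrableB measurableT ixi it).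
rewrite le_eqVlt; apply/orP; left; apply/eqP.
apply: eq_Rintegral => w _ /=.
by rewrite sub_trunc /above; case: ifP; rewrite ?normr0.
Qed.

End moments.

(** * The strong law *)

Section strong_law.
Context {dsp : measure_display} {Omega : measurableType dsp} {R : realType}.
Variable P : probability Omega R.
Variables (d : nat) (X : 'rV[nat]_d -> {RV P >-> R}) (xi : {RV P >-> R}).
Hypothesis d0 : (0 < d)%N.
Hypothesis hX : independent_copies (posvec (d := d)) X xi.
Hypothesis hint : P.-integrable setT (EFin \o xi).
Variable beta : R.
Hypothesis beta12 : 1 <= beta < 2.
Hypothesis hbeta : P.-integrable setT (EFin \o (fun w => `|xi w| `^ beta)).
Notation I := 'rV[nat]_d.

Let beta1 : 1 <= beta. Proof. by case/andP: beta12. Qed.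
Let beta2 : beta < 2. Proof. by case/andP: beta12. Qed.
Let beta0 : 0 < beta. Proof. exact: lt_le_trans beta1. Qed.

Definition cvol k : R := (2 ^ (k * d))%:R.
Definition lev1 k : R := cvol k `^ beta^-1.

Lemma cvol_gt0 k : 0 < cvol k.
Proof. by rewrite /cvol ltr0n expn_gt0. Qed.

Lemma cvolS k : cvol k.+1 = 2 ^+ d * cvol k.
Proof. by rewrite /cvol mulSn expnD natrM natrX. Qed.

Lemma lev1_gt0 k : 0 < lev1 k.
Proof. by rewrite powR_gt0// cvol_gt0. Qed.

Lemma lev1_beta k : lev1 k `^ beta = cvol k.
Proof. by rewrite /lev1 -powRrM mulVf ?gt_eqF// powRr1// ltW// cvol_gt0. Qed.

Lemma lev1S k : lev1 k.+1 = (2 ^+ d) `^ beta^-1 * lev1 k.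
Proof. by rewrite /lev1 cvolS powRM// ?ltW ?cvol_gt0// exprn_ge0. Qed.

Let two_d_gt1 : 1 < (2 : R) ^+ d.
Proof. by rewrite exprn_egt1 ?ltr1n// -lt0n. Qed.

Let r1 : 1 < (2 ^+ d : R) `^ beta^-1.
Proof. by rewrite powR_gt1// invr_gt0. Qed.

Lemma lev1_unbounded (M : R) : exists K0, forall K, (K0 <= K)%N -> M <= lev1 K.
Proof.
by apply: (weight_unbounded r1 lev1_gt0) => k; rewrite lev1S.
Qed.

Let hmom : P.-integrable setT (EFin \o ((fun x => `|x| `^ beta) \o xi)).
Proof. exact: hbeta. Qed.

Let mpow (a : R) : measurable_fun setT (fun x : R => `|x| `^ a).
Proof.
apply: (@measurableT_comp _ _ _ _ _ _ (@powR R ^~ a)).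
  exact: measurable_powR.
exact: normr_measurable.
Qed.

Let Mb := Ex P (fun w => `|xi w| `^ beta).

Definition tailp k : R := pr P [set w | lev1 k < `|xi w|].

Lemma gt_measurable (Y : {RV P >-> R}) b : measurable [set w | b < `|Y w|].
Proof.
rewrite -[X in measurable X]setTI; apply: measurable_fun_ltr => //.
exact: measurableT_comp.
Qed.

Lemma lev1_lt k x : 0 <= x -> (lev1 k < x) = (cvol k < x `^ beta).
Proof.
move=> x0; rewrite -lev1_beta; apply/idP/idP => h.
  by rewrite gt0_ltr_powR// ?nnegrE// ltW// lev1_gt0.
rewrite ltNge; apply/negP => xl.
have := ge0_ler_powR (ltW beta0) _ _ xl; rewrite !nnegrE => /(_ x0 (ltW (lev1_gt0 k))).
by rewrite leNgt h.
Qed.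

(** Under the expectation, the volumes [cvol k] below |xi|^beta form a geometric sum and are bounded
    by a multiple of |xi|^beta. *)
Lemma tailp_sum N :
  \sum_(k < N) cvol k * tailp k <= (2 ^+ d) / (2 ^+ d - 1) * Mb.
Proof.
have bi k : bm (\1_([set w | lev1 k < `|xi w|]) : Omega -> R).
  by apply: bm_indic; exact: gt_measurable.
rewrite /Mb /Ex -RintegralZl//.
have -> : \sum_(k < N) cvol k * tailp k =
    Ex P (fun w => \sum_(k < N) cvol k * \1_([set w | lev1 k < `|xi w|]) w).
  rewrite Ex_sum; last by move=> k; exact: bmZ.
  apply: eq_bigr => k _; rewrite ExZ// Ex_indic//; exact: gt_measurable.
apply: le_Ex_int.
- by apply: bm_sum => k; exact: bmZ.
- exact: (integrableZl measurableT _ hbeta).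
- move=> w; have x0 : 0 <= `|xi w| `^ beta by exact: powR_ge0.
  have := @weight_sum_below _ (2 ^+ d) cvol two_d_gt1 cvol_gt0 _ (`|xi w| `^ beta) N.
  rewrite (max_idPl x0) => h; apply: le_trans (h _).
    apply: ler_sum => k _; rewrite indicE.
    have -> : (w \in [set w | lev1 k < `|xi w|]) = (cvol k < `|xi w| `^ beta).
      by rewrite -lev1_lt//; apply/idP/idP; rewrite inE.
    by case: ifP => _; rewrite ?mulr1 ?mulr0.
  by move=> k; rewrite cvolS.
Qed.

(** This is [lev1 k ^+ 2 / cvol k], the gain in Chebyshev's inequality on shell k; it grows
    geometrically because beta < 2. *)
Let lev2 k : R := cvol k `^ (2 / beta - 1).

Let e2 : 0 < 2 / beta - 1.
Proof. by rewrite subr_gt0 ltr_pdivlMr// mul1r. Qed.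

Lemma lev1_sq k : lev1 k ^+ 2 = cvol k * lev2 k.
Proof.
rewrite /lev2 -[X in X * _](@powRr1 _ (cvol k)) ?ltW ?cvol_gt0//.
rewrite -powRD_gt0 ?cvol_gt0//.
by rewrite /lev1 -powR_mulrn ?powR_ge0// -powRrM; congr (_ `^ _); ring.
Qed.

Lemma lev1_le k x : 0 <= x -> (x <= lev1 k) = (x `^ (2 - beta) <= lev2 k).
Proof.
have b2 : 0 < 2 - beta by rewrite subr_gt0.
have -> : lev2 k = lev1 k `^ (2 - beta).
  rewrite /lev1 -powRrM /lev2; congr (_ `^ _); field; exact: lt0r_neq0.
move=> x0; apply/idP/idP => h.
  by rewrite ge0_ler_powR// ?nnegrE ?ltW// lev1_gt0.
rewrite leNgt; apply/negP => xl.
have := gt0_ltr_powR b2 _ _ xl; rewrite !nnegrE => /(_ (ltW (lev1_gt0 k)) x0).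
by rewrite ltNge h.
Qed.

(** For a fixed value x of |xi|, the levels that keep x satisfy x^(2 - beta) <= lev2 k. The
    reciprocals of these add up to a multiple of x^(beta - 2), which times x^2 is x^beta. *)
Lemma tvar_sum : exists C : R, forall N,
  \sum_(k < N) tvar xi (lev1 k) / lev2 k <= C.
Proof.
pose r := (2 ^+ d : R) `^ (2 / beta - 1).
have r2 : 1 < r by exact: powR_gt1.
exists (r / (r - 1) * Mb) => N.
have l2 k : 0 < lev2 k by rewrite powR_gt0// cvol_gt0.
have l2S k : r * lev2 k <= lev2 k.+1.
  by rewrite /lev2 cvolS powRM// ?ltW ?cvol_gt0// exprn_ge0.
have bt k : bm (fun w => trunc (lev1 k) (xi w)).
  by apply: bm_trunc; rewrite ltW// lev1_gt0.
rewrite /Mb /Ex -RintegralZl//.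
apply: (@le_trans _ _ (Ex P (fun w => \sum_(k < N) (lev2 k)^-1 *
   (trunc (lev1 k) (xi w) * trunc (lev1 k) (xi w))))).
  rewrite Ex_sum; last by move=> k; apply: bmZ; exact: bmM.
  apply: ler_sum => k _; rewrite ExZ; last exact: bmM.
  rewrite mulrC ler_pM2l ?invr_gt0// (tvarE _ (ltW (lev1_gt0 k))).
  by under eq_fun do rewrite expr2; rewrite gerBl sqr_ge0.
apply: le_Ex_int.
- by apply: bm_sum => k; apply: bmZ; exact: bmM.
- exact: (integrableZl measurableT _ hbeta).
- move=> w; have [->|x0] := eqVneq (xi w) 0.
    rewrite big1 => [|k _]; last by rewrite /trunc; case: ifP; rewrite !mulr0.
    by apply: mulr_ge0; [exact: ratio_ge0|exact: powR_ge0].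
  have nx : 0 < `|xi w| by rewrite normr_gt0.
  have := @weight_inv_sum_above _ r lev2 r2 l2 l2S (`|xi w| `^ (2 - beta)) N.
  rewrite powR_gt0// => /(_ isT) h.
  have -> : \sum_(k < N) (lev2 k)^-1 *
       (trunc (lev1 k) (xi w) * trunc (lev1 k) (xi w)) =
     `|xi w| ^+ 2 * \sum_(k < N) (if `|xi w| `^ (2 - beta) <= lev2 k then
        (lev2 k)^-1 else 0).
    rewrite mulr_sumr; apply: eq_bigr => k _; rewrite /trunc lev1_le//.
    case: ifP => _; rewrite ?mulr0// real_normK ?num_real//; ring.
  apply: (le_trans (ler_wpM2l (sqr_ge0 _) h)).
  have -> : `|xi w| ^+ 2 = `|xi w| `^ beta * `|xi w| `^ (2 - beta).
    rewrite -powRD_gt0//.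
    by rewrite -powR_mulrn//; congr (_ `^ _); ring.
  rewrite le_eqVlt; apply/orP; left; apply/eqP.
  by field; rewrite !gt_eqF ?subr_gt0// powR_gt0.
Qed.

(** Beyond the level, |x| <= |x|^beta / lev1^(beta - 1), and cvol = lev1 lev1^(beta - 1); the error
    is thus a tail of the beta-moment. *)
Lemma center_small (e : R) : 0 < e -> exists K, forall k, (K <= k)%N ->
  cvol k * `|Ex P xi - tmean xi (lev1 k)| <= e * lev1 k.
Proof.
move=> e0; have [B hB] := above_small (mpow beta) (fun x => powR_ge0 _ _) hmom e0.
have [K hK] := lev1_unbounded B; exists K => k Kk.
have l0 := lev1_gt0 k.
have h1 := mean_tmean (ltW l0) hint.
have h2 := hB _ (hK _ Kk).
have hc : cvol k = lev1 k * lev1 k `^ (beta - 1).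
  rewrite -lev1_beta -[X in _ = X * _](@powRr1 _ (lev1 k)) ?ltW//.
  rewrite -powRD_gt0//.
  by congr (_ `^ _); ring.
rewrite hc -mulrA mulrC ler_pM2r//.
apply: le_trans h2; apply: (le_trans (ler_wpM2l (powR_ge0 _ _) h1)).
rewrite /Ex -RintegralZl//; last first.
  apply: above_int; first exact: normr_measurable.
  exact: (integrable_norm hint).
apply: le_Rintegral => //.
- apply: Zl_int; apply: above_int; first exact: normr_measurable.
  exact: (integrable_norm hint).
- exact: above_int.
- move=> w _; rewrite /above /=; case: ifPn => [_|]; first by rewrite mulr0.
  rewrite -ltNge => lx.
  have x0 : 0 < `|xi w| by exact: lt_trans lx.
  have -> : `|xi w| `^ beta = `|xi w| `^ (beta - 1) * `|xi w|.
    rewrite -[X in _ = _ * X](@powRr1 _ `|xi w|)//.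
    rewrite -powRD_gt0//.
    by congr (_ `^ _); ring.
  rewrite ler_pM2r//; apply: ge0_ler_powR; rewrite ?nnegrE ?subr_ge0// ltW//.
Qed.


(** Off this event truncation changes nothing on shell [k], and the trace of every box on it has a
    truncated centred sum of size at most [e * lev1 k]. *)
Definition bad_shell (e : R) k : set Omega :=
  \big[setU/set0]_(m <- shell d k) [set w | lev1 k < `|X m w|] `|`
  exceed (tZ X xi (lev1 k)) d (shell d k) (cube d k) (e * lev1 k).

Lemma bad_shell_measurable e k : measurable (bad_shell e k).
Proof.
apply: measurableU; last exact: exceed_measurable.
by apply: bigsetU_measurable => m _; exact: gt_measurable.
Qed.

Lemma bad_shell_sum (e : R) : 0 < e ->
  exists C : R, forall N, \sum_(k < N) pr P (bad_shell e k) <= C.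
Proof.
move=> e0; have [C hC] := tvar_sum.
exists ((2 ^+ d) / (2 ^+ d - 1) * Mb + (max_cst d : R) / e ^+ 2 * C) => N.
have hk k : pr P (bad_shell e k) <=
    cvol k * tailp k + (max_cst d : R) / e ^+ 2 * (tvar xi (lev1 k) / lev2 k).
  have l0 := lev1_gt0 k; have l0' := ltW l0.
  have sk : (size (shell d k))%:R <= cvol k by rewrite ler_nat size_shell.
  apply: le_trans; first apply: prU_le.
  - by apply: bigsetU_measurable => m _; exact: gt_measurable.
  - exact: exceed_measurable.
  apply: lerD.
    apply: le_trans; first by apply: pr_bigU_le => m; exact: gt_measurable.
    rewrite (eq_big_seq (fun=> tailp k)); last first.
      move=> m /shell_posvec pm; rewrite /tailp /pr; congr fine.
      apply: (hX.2 m pm [set x | lev1 k < `|x|]).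
      exact: norm_gt_measurable.
    rewrite big_const_seq count_predT iter_addr_0 -mulr_natl ler_wpM2r//.
    exact: pr_ge0.
  have := @max_chebyshev _ _ _ P d (posvec (d := d)) (tZ X xi (lev1 k))
    (tZ_indep hX (lev1 k)) (tZ_bm X xi l0') (fun i => tZ_mean hX l0' (i := i))
    (shell d k) (cube d k) (e * lev1 k) (cvol k * tvar xi (lev1 k))
    (@shell_uniq d k) (@shell_posvec d k) (mulr_gt0 e0 l0).
  have -> : (max_cst d : R) * (cvol k * tvar xi (lev1 k)) / (e * lev1 k) ^+ 2 =
      (max_cst d : R) / e ^+ 2 * (tvar xi (lev1 k) / lev2 k).
    rewrite exprMn lev1_sq; field.
    by rewrite !gt_eqF// ?powR_gt0 ?cvol_gt0.
  apply.
  rewrite (eq_big_seq (fun=> tvar xi (lev1 k))); last first.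
    by move=> m /shell_posvec pm; exact: (tZ_var hX).
  rewrite big_const_seq count_predT iter_addr_0 -mulr_natl ler_wpM2r//.
  exact: tvar_ge0.
apply: le_trans; first by apply: ler_sum => k _; exact: hk.
rewrite big_split/= -mulr_sumr; apply: lerD; first exact: tailp_sum.
apply: ler_wpM2l (hC N); apply: divr_ge0; last exact: sqr_ge0.
by apply: ltW; exact: max_cst_gt0.
Qed.

Lemma ae_shells : {ae P, forall w, forall e : R, 0 < e -> exists K, forall k,
  (K <= k)%N -> ~ bad_shell e k w}.
Proof.
have : {ae P, forall w, forall j : nat, exists K, forall k,
    (K <= k)%N -> ~ bad_shell j.+1%:R^-1 k w}.
  apply/ae_foralln => j.
  have j0 : 0 < (j.+1%:R^-1 : R) by rewrite invr_gt0.
  have [C hC] := bad_shell_sum j0.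
  apply: ae_eventually_not hC => k; exact: bad_shell_measurable.
apply: filterS => w hw e e0.
pose j := Num.truncn e^-1.
have je : j.+1%:R^-1 <= e.
  rewrite -[leRHS]invrK lef_pV2 ?posrE ?invr_gt0//.
  by rewrite ltW// Num.Theory.truncnS_gt.
have [K hK] := hw j; exists K => k Kk hb; apply: (hK k Kk).
case: hb => [h|h]; [by left|right].
apply: exceed_anti h; rewrite ler_pM2r//; exact: lev1_gt0.
Qed.


Lemma shell_sum_le (e : R) k w n : ~ bad_shell e k w ->
  `|\sum_(m <- shell d k | lev m n) (X m w - Ex P xi)| <=
  e * lev1 k + cvol k * `|Ex P xi - tmean xi (lev1 k)|.
Proof.
(* Boxes of n and n' meet shell k in the same set, and n' lies below the corner of the cube, as
   [exceed] demands. *)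
move=> hb; pose n' : I := \row_i minn (n ord0 i) (2 ^ k).
have nn' m : m \in shell d k -> lev m n = lev m n'.
  move=> /shell_sub/bxP[_ /levP mk]; apply/levP/levP => mn i.
    by rewrite mxE leq_min mn/=; have := mk i; rewrite mxE.
  by have := mn i; rewrite mxE leq_min => /andP[].
have hX1 m : m \in shell d k -> X m w - Ex P xi =
    tZ X xi (lev1 k) m w + (tmean xi (lev1 k) - Ex P xi).
  move=> mk; rewrite /tZ/= /ctrunc /trunc ifT; first by ring.
  rewrite leNgt; apply/negP => h; apply: hb; left.
  by rewrite -bigcup_seq; exists m.
rewrite big_seq_cond (eq_bigr (fun m => tZ X xi (lev1 k) m w +
   (tmean xi (lev1 k) - Ex P xi))); last by move=> m /andP[mk _]; exact: hX1.
rewrite (eq_bigl (fun m => (m \in shell d k) && lev m n')); last first.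
  by move=> m; case: (boolP (m \in shell d k)) => //= mk; rewrite nn'.
rewrite -big_seq_cond big_split/=.
apply: (le_trans (ler_normD _ _)); apply: lerD.
  rewrite leNgt; apply/negP => h; apply: hb; right.
  exists n' => //; split; first by apply/levP => i; rewrite !mxE geq_minr.
  by move=> i; rewrite leqNgt ltn_ord.
rewrite big_const_seq iter_addr_0 -mulr_natl normrM normr_nat distrC.
rewrite ler_wpM2r// ler_nat (leq_trans _ (size_shell d k))//.
exact: count_size.
Qed.

(** A bound uniform over all boxes inside the cube, before the cone enters: balance is needed only
    to compare [lev1 K] with the volume of n. *)
Lemma strong_law_cubes : {ae P, forall w, forall e : R, 0 < e ->
  exists K0, forall K, (K0 <= K)%N -> forall n, lev n (cube d K) ->
  `|partial_sum X n w - Ex P xi * (vol n)%:R| <= e * lev1 K}.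
Proof.
apply: filterS ae_shells => w hw e e0.
pose a k n := \sum_(m <- shell d k | lev m n) (X m w - Ex P xi).
pose B k := \sum_(m <- shell d k) `|X m w - Ex P xi|.
have aB k n : `|a k n| <= B k.
  apply: (le_trans (ler_norm_sum _ _ _)); rewrite /B [leRHS](bigID (fun m => lev m n))/=.
  by rewrite lerDl sumr_ge0.
have ae (e' : R) : 0 < e' -> exists k0, forall k, (k0 <= k)%N ->
    forall n, `|a k n| <= e' * lev1 k.
  move=> e'0; have e20 : 0 < e' / 2 by rewrite divr_gt0.
  have [K1 hK1] := hw _ e20; have [K2 hK2] := center_small e20.
  exists (maxn K1 K2) => k; rewrite geq_max => /andP[K1k K2k] n.
  apply: (le_trans (shell_sum_le n (hK1 k K1k))).
  by have := hK2 k K2k; lra.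
have l1S k : (2 ^+ d : R) `^ beta^-1 * lev1 k <= lev1 k.+1 by rewrite lev1S.
have [K0 hK0] := toeplitz r1 lev1_gt0 l1S aB ae e0.
exists K0 => K KK n nK.
have := hK0 K KK n; rewrite /a -sum_cube_shells -(sum_bx_sub _ nK).
suff -> : \sum_(m <- bx n) (X m w - Ex P xi) =
    partial_sum X n w - Ex P xi * (vol n)%:R by [].
rewrite sumrB partial_sumE; congr (_ - _).
by rewrite big_const_seq count_predT iter_addr_0 size_bx mulr_natr.
Qed.

End strong_law.

(** * Comparability of coordinates and volume inside the cone *)

Section cone.
Context {R : realType}.
Variables (d : nat) (C : set 'rV[R]_d).
Hypothesis d0 : (0 < d)%N.
Hypothesis hCclosed : closed C.
Hypothesis hCcone : is_cone C.
Hypothesis hCpos : forall x, C x -> x <> 0 -> forall i, 0 < x ord0 i.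

(** Each coordinate is continuous and positive on the compact unit slice [S] of the cone, hence
    bounded below there; homogeneity transfers the bound to all indices. *)
Lemma cone_balanced : exists2 c : R, 0 < c & forall n, cone_indices C n ->
  forall i, c * (\max_j n ord0 j)%N%:R <= (n ord0 i)%:R.
Proof.
pose S := C `&` [set x : 'rV[R]_d | `|x| = 1].
have normS n : cone_indices C n -> 0 < `|vecR R n| /\ S (`|vecR R n|^-1 *: vecR R n).
  move=> [pn Cn]; have x0 : vecR R n != 0.
    apply/eqP => /rowP /(_ (Ordinal d0)); rewrite !mxE => /eqP.
    by rewrite pnatr_eq0 => /eqP h; have := pn (Ordinal d0); rewrite h.
  have n0 : 0 < `|vecR R n| by rewrite normr_gt0.
  split=> //; split; first by apply: hCcone => //; rewrite invr_gt0.
  by rewrite /= normrZ gtr0_norm ?invr_gt0// mulVf// gt_eqF.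
have [S0|/set0P S0] := eqVneq S set0.
  by exists 1 => // n /normS[_]; rewrite S0.
have cS : compact S.
  apply: bounded_closed_compact.
    exists 1; split; first exact: num_real.
    by move=> M M1 x [_ /= ->]; exact: ltW.
  apply: closedI => //.
  have -> : [set x : 'rV[R]_d | `|x| = 1] = (fun x : 'rV[R]_d => `|x|) @^-1` [set 1].
    by [].
  by apply: closed_comp => [x _|]; [exact: norm_continuous|exact: closed_eq].
have hmin i : exists2 c : R, 0 < c & forall x, S x -> c <= x ord0 i.
  have [|x xS hx] := @EVT_min_rV R d (fun x => x ord0 i) S S0 cS.
    by apply: continuous_subspaceT => x; exact: coord_continuous.
  exists (x ord0 i); last by move=> y Sy; apply: hx; rewrite inE.
  move: xS; rewrite inE => -[Cx /= x1]; apply: hCpos => // xz.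
  by move: x1; rewrite xz normr0 => /eqP; rewrite eq_sym oner_eq0.
pose c i := projT1 (cid2 (hmin i)).
have c0 i : 0 < c i by rewrite /c; case: cid2.
have cle i x : S x -> c i <= x ord0 i.
  by rewrite /c; case: cid2 => /= c' _; exact.
(* The number 1/s is a positive lower bound for all [c i] at once, in place of their minimum. *)
pose s := \sum_i (c i)^-1.
have sle i : (c i)^-1 <= s.
  rewrite /s (bigD1 i)//= lerDl sumr_ge0// => j _.
  by rewrite invr_ge0 ltW.
have s0 : 0 < s by apply: lt_le_trans (sle (Ordinal d0)); rewrite invr_gt0.
exists s^-1; first by rewrite invr_gt0.
move=> n Cn i; have [N0 Sn] := normS n Cn.
have hi : s^-1 <= c i by rewrite -[leRHS]invrK lef_pV2 ?posrE ?invr_gt0.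
have := le_trans hi (cle i _ Sn); rewrite !mxE mulrC ler_pdivlMr// => h.
apply: le_trans h; rewrite ler_pM2l ?invr_gt0//.
have [j ->] : {j | (\max_j n ord0 j)%N = n ord0 j}.
  by apply: bigop.eq_bigmax; rewrite card_ord.
have -> : (n ord0 j)%:R = `|vecR R n ord0 j| by rewrite mxE normr_nat.
rewrite [leRHS]mx_normrE.
exact: (le_bigmax _ (fun ij => `|vecR R n ij.1 ij.2|) (ord0, j)).
Qed.


Lemma le_max_coord (n : 'rV[nat]_d) i : (n ord0 i <= \max_j n ord0 j)%N.
Proof. exact: (leq_bigmax i). Qed.

Definition scale (n : 'rV[nat]_d) : nat := up_log 2 (\max_j n ord0 j)%N.

Lemma lev_scale (n : 'rV[nat]_d) : lev n (cube d (scale n)).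
Proof.
apply/levP => i; rewrite mxE; apply: leq_trans (le_max_coord n i) _.
exact: up_logP.
Qed.

Lemma scale_ge (n : 'rV[nat]_d) K : (2 ^ K <= \max_j n ord0 j)%N -> (K <= scale n)%N.
Proof.
move=> h; rewrite -(@leq_exp2l 2)//; apply: (leq_trans h); exact: up_logP.
Qed.

Lemma pow_scale_le (n : 'rV[nat]_d) : posvec n -> (2 ^ scale n <= 2 * \max_j n ord0 j)%N.
Proof.
move=> pn; set N := (\max_j n ord0 j)%N.
have N0 : (0 < N)%N := leq_trans (pn (Ordinal d0)) (le_max_coord n _).
have [N1|N1] := leqP N 1%N.
  have N1' : N = 1%N by apply/eqP; rewrite eqn_leq N1 N0.
  by rewrite /scale -/N N1' up_log1.
have /andP[h _] := up_log_bounds (leqnn 2) N1.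
rewrite /scale -/N -[up_log 2 N]prednK ?up_log_gt0// expnS leq_mul2l/=.
exact: ltnW.
Qed.

Lemma cone_scale : exists2 A : R, 0 < A & forall n, cone_indices C n ->
  cvol d (scale n) <= A * (vol n)%:R :> R.
Proof.
have [c c0 hc] := cone_balanced.
exists ((2 / c) ^+ d); first by rewrite exprn_gt0// divr_gt0.
move=> n Cn.
have h1 i : (2 ^ scale n)%:R <= 2 / c * (n ord0 i)%:R :> R.
  apply: (@le_trans _ _ (2 * (\max_j n ord0 j)%N%:R)).
    by rewrite -natrM ler_nat pow_scale_le//; case: Cn.
  by rewrite -mulrA ler_pM2l// mulrC ler_pdivlMr// mulrC hc.
rewrite /cvol /vol expnM natrX (natr_prod R) -[d in X in X <= _]card_ord.
rewrite -[d in X in _ <= X * _]card_ord -!prodr_const -big_split/=.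
by apply: ler_prod => i _; rewrite ler0n h1.
Qed.

End cone.

Section strong_law_cone.
Context {R : realType} {d : nat}.
Context {dsp : measure_display} {Omega : measurableType dsp}.
Variable P : probability Omega R.
Variables (X : 'rV[nat]_d -> {RV P >-> R}) (xi : {RV P >-> R}).
Hypothesis d0 : (0 < d)%N.
Hypothesis hX : independent_copies (posvec (d := d)) X xi.
Hypothesis hint : P.-integrable setT (EFin \o xi).
Variable C : set 'rV[R]_d.
Hypothesis hCclosed : closed C.
Hypothesis hCcone : is_cone C.
Hypothesis hCpos : forall x, C x -> x <> 0 -> forall i, 0 < x ord0 i.

Lemma cone_oo_near (Q : 'rV[nat]_d -> Prop) K0 :
  (forall n, cone_indices C n -> (K0 <= scale n)%N -> Q n) ->
  \forall n \near cone_oo C, Q n.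
Proof.
move=> hQ; exists (2 ^ K0)%N => // n [Cn hn]; apply: hQ => //.
exact: scale_ge.
Qed.

Lemma strong_law_cone (beta : R) : 1 <= beta < 2 ->
  P.-integrable setT (EFin \o (fun w => `|xi w| `^ beta)) ->
  {ae P, forall w, (fun n => partial_sum X n w - Ex P xi * (vol n)%:R : R^o)
         =o_ (cone_oo C) (fun n => (vol n)%:R `^ beta^-1 : R^o)}.
Proof.
move=> beta12 hbeta.
have b0 : 0 < beta by case/andP: beta12 => h _; exact: lt_le_trans h.
apply: filterS (strong_law_cubes d0 hX hint beta12 hbeta) => w hw.
have [A A0 hA] := cone_scale d0 hCclosed hCcone hCpos.
have A'0 : 0 < A `^ beta^-1 by rewrite powR_gt0.
apply/eqoP => e e0.
have e1 : 0 < e / A `^ beta^-1 by rewrite divr_gt0.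
have [K0 hK0] := hw _ e1.
apply: (@cone_oo_near _ K0) => n Cn nK.
apply: (le_trans (hK0 _ nK _ (lev_scale n))).
rewrite [X in _ <= e * X]ger0_norm ?powR_ge0// mulrAC ler_pdivrMr// -mulrA ler_pM2l//.
rewrite mulrC -powRM ?ler0n ?(ltW A0)// /lev1.
apply: ge0_ler_powR; rewrite ?nnegrE ?invr_ge0 ?(ltW b0)// ?ler0n//.
  by rewrite mulr_ge0// ltW.
exact: hA.
Qed.

End strong_law_cone.

(** * The law of the iterated logarithm *)

Section series_facts.
Context {R : realType}.

Lemma bounded_sums_small (u : nat -> R) (C : R) : (forall k, 0 <= u k) ->
  (forall N, \sum_(k < N) u k <= C) ->
  forall e, 0 < e -> exists K, forall k, (K <= k)%N -> u k <= e.
Proof.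
move=> u0 uC e e0.
have cv : cvgn (series u).
  apply: nondecreasing_is_cvgn.
    by apply/nondecreasing_seqP => n; rewrite seriesSr lerDl.
  by exists C => _ [n _ <-]; rewrite /series/= big_mkord.
have /cvgrPdist_le/(_ _ e0)[K _ hK] := cvg_series_cvg_0 cv.
exists K => k Kk; have := hK k Kk; rewrite sub0r normrN.
exact: le_trans (ler_norm _).
Qed.

(** The terms are i^-(1+dl) and are compared with differences of f(i) = (i+1)^-dl, which
    telescope. *)
Lemma p_series_bounded (dl : R) : 0 < dl -> exists C : R, forall N,
  \sum_(i < N) expR (- ((1 + dl) * ln i%:R)) <= C.
Proof.
move=> dl0; exists (2 + dl^-1) => N.
pose f (i : nat) : R := expR (- (dl * ln i.+1%:R)).
have step (i : nat) : expR (- ((1 + dl) * ln i.+2%:R)) <= (f i - f i.+1) / dl.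
  rewrite ler_pdivlMr//.
  have i0 : 0 < (i.+2%:R : R)^-1 by rewrite invr_gt0.
  have lni : (i.+2%:R)^-1 <= ln i.+2%:R - ln i.+1%:R :> R.
    have -> : ln i.+2%:R - ln i.+1%:R = - ln (1 + - (i.+2%:R)^-1 : R).
      have -> : 1 + - (i.+2%:R)^-1 = i.+1%:R / i.+2%:R :> R.
        have -> : i.+1%:R = i.+2%:R - 1 :> R by rewrite -[i.+2%:R]natr1 addrK.
        by rewrite mulrBl divff ?pnatr_eq0// mul1r.
      by rewrite lnM ?posrE ?invr_gt0// lnV ?posrE//; ring.
    rewrite lerNr; apply: le_ln1Dx.
    by rewrite ltrN2 invf_lt1// ltr1n.
  have -> : f i = f i.+1 * expR (dl * (ln i.+2%:R - ln i.+1%:R)).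
    by rewrite /f -expRD; congr expR; ring.
  have -> : expR (- ((1 + dl) * ln i.+2%:R)) = f i.+1 * (i.+2%:R)^-1.
    rewrite /f -[X in _ = _ * X^-1]lnK ?posrE// -expRN -expRD.
    by congr expR; ring.
  have f0 : 0 < f i.+1 by exact: expR_gt0.
  rewrite -mulrA -[X in _ - X]mulr1 -mulrBr ler_pM2l//.
  have h1 := expR_ge1Dx (dl * (ln i.+2%:R - ln i.+1%:R)).
  have h2 : (i.+2%:R)^-1 * dl <= (ln i.+2%:R - ln i.+1%:R) * dl by rewrite ler_pM2r.
  by apply: (le_trans h2); rewrite lerBrDl [X in 1 + X]mulrC.
have key n : \sum_(i < n.+2) expR (- ((1 + dl) * ln i%:R)) <=
    2 + (1 - f n) / dl.
  elim: n => [|n IH].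
    (* Since [ln] is 0 at 0 by convention, the terms of index 0 and 1 both equal 1; they account for
       the constant 2. *)
    rewrite !big_ord_recr big_ord0/= ln0// ln1 /f ln1 !mulr0 oppr0 !expR0; lra.
  by rewrite big_ord_recr/=; have := step n; lra.
apply: (@le_trans _ _ (\sum_(i < N.+2) expR (- ((1 + dl) * ln i%:R)))).
  rewrite 2!big_ord_recr/= -addrA lerDl.
  by rewrite addr_ge0 ?expR_ge0.
apply: (le_trans (key N)); rewrite lerD2l ler_piMl ?invr_ge0 ?ltW//.
by rewrite gtrBl expR_gt0.
Qed.

Lemma ln_nat_unbounded (M : R) : exists K, forall k, (K <= k)%N -> M <= ln k%:R.
Proof.
exists (Num.truncn (expR M)).+1 => k Kk.
rewrite -[leLHS]expRK ler_ln ?posrE ?expR_gt0//; last first.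
  by rewrite ltr0n (leq_trans _ Kk).
apply: (@le_trans _ _ (Num.truncn (expR M)).+1%:R); last by rewrite ler_nat.
by rewrite ltW// Num.Theory.truncnS_gt.
Qed.

(** A bound on the sums of [p] would bound the harmonic series: its first [k0] terms contribute at
    most 1 each, the others at most [p k / c]. *)
Lemma harmonic_unbounded (p : nat -> R) (c : R) k0 : 0 < c -> (forall k, 0 <= p k) ->
  (forall k, (k0 <= k)%N -> c / k.+1%:R <= p k) ->
  forall M : R, exists N, M <= \sum_(k < N) p k.
Proof.
move=> c0 p0 hp M; apply: contrapT => hM.
apply: (@dvg_harmonic R); apply: nondecreasing_is_cvgn.
  by apply/nondecreasing_seqP => n; rewrite seriesSr lerDl invr_ge0.
exists (k0%:R + M / c) => _ [n _ <-]; rewrite /series/= big_mkord.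
have hM' : \sum_(k < n) p k <= M.
  by rewrite leNgt; apply/negP => h; apply: hM; exists n; exact: ltW.
apply: (@le_trans _ _ (\sum_(k < n) ((k < k0)%N%:R + p k / c))).
  apply: ler_sum => k _; rewrite /harmonic; have [kk|kk] := ltnP k k0.
    rewrite -[leLHS]addr0 lerD// ?divr_ge0 ?(ltW c0)//.
    by rewrite invf_le1 ?ltr0n// ler1n.
  by rewrite add0r ler_pdivlMr// mulrC; exact: hp.
rewrite big_split/=; apply: lerD; last first.
  by rewrite -mulr_suml ler_pM2r// invr_gt0.
rewrite -natr_sum ler_nat -[leqRHS]card_ord -sum1_card.
elim: n {hM'} => [|n IH]; first by rewrite big_ord0.
rewrite sum1_card card_ord.
have [h|h] := leqP n.+1 k0.
  apply: (leq_trans _ h); rewrite -[leqRHS]card_ord -sum1_card leq_sum// => i _.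
  by case: (_ < _)%N.
have -> : (\sum_(i < n.+1) (i < k0) = \sum_(i < n) (i < k0))%N.
  by rewrite big_ord_recr/= (_ : (n < k0)%N = false) ?addn0//; apply/negbTE; rewrite -leqNgt -ltnS.
by move: IH; rewrite sum1_card card_ord.
Qed.

End series_facts.

Section transfer.
Context {dsp : measure_display} {Omega : measurableType dsp} {R : realType}.
Variable P : probability Omega R.

Lemma law_int (Y xi : {RV P >-> R}) (h : R -> R) : same_distribution Y xi ->
  measurable_fun setT h -> (forall x, 0 <= h x) ->
  P.-integrable setT (EFin \o (h \o xi)) ->
  P.-integrable setT (EFin \o (h \o Y)) /\ Ex P (h \o Y) = Ex P (h \o xi).
Proof.
move=> Yxi mh h0 ih.
have E := law_ge0_integral Yxi mh h0.
split; last by rewrite /Ex /Rintegral E.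
apply/integrableP; split.
  by apply/measurable_EFinP; exact: measurableT_comp.
have /integrableP[_] := ih; congr (_ < _)%E.
transitivity (\int[P]_w (h (xi w))%:E)%E.
  by apply: eq_integral => w _; rewrite /= ger0_norm.
by rewrite -E; apply: eq_integral => w _; rewrite /= ger0_norm.
Qed.

Lemma Ex_sum_int (I : eqType) (s : seq I) (f : I -> Omega -> R) :
  (forall i, i \in s -> P.-integrable setT (EFin \o f i)) ->
  P.-integrable setT (EFin \o (fun w => \sum_(i <- s) f i w)) /\
  Ex P (fun w => \sum_(i <- s) f i w) = \sum_(i <- s) Ex P (f i).
Proof.
elim: s => [|i s IH] hf.
  under eq_fun do rewrite big_nil; rewrite big_nil; split; last exact: Ex_cst.
  exact: (bm_int P (bm_cst 0)).
have [IH1 IH2] := IH (fun j js => hf j (@mem_behead _ (i :: s) _ js)).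
have fi := hf i (mem_head _ _).
under eq_fun do rewrite big_cons; rewrite big_cons; split.
  exact: (integrableD measurableT fi IH1).
by rewrite -IH2 /Ex RintegralD.
Qed.

Lemma markov_int (f : Omega -> R) (t : R) : 0 < t -> (forall w, 0 <= f w) ->
  P.-integrable setT (EFin \o f) ->
  measurable [set w | t < f w] /\ pr P [set w | t < f w] <= Ex P f / t.
Proof.
move=> t0 f0 fi.
have mf : measurable_fun setT f by apply/measurable_EFinP; case/integrableP: fi.
have mA : measurable [set w | t < f w].
  by rewrite -[X in measurable X]setTI; exact: measurable_fun_ltr.
split=> //; rewrite ler_pdivlMr// mulrC -Ex_indic// -ExZ; last exact: bm_indic.
apply: le_Ex_int => //; first by apply: bmZ; exact: bm_indic.
move=> w; rewrite indicE.
case: (boolP (w \in _)) => [|_] /=; last by rewrite mulr0.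
by rewrite inE /= mulr1 => /ltW.
Qed.

End transfer.

(** * Truncation levels for the iterated logarithm *)

Section levels.
Context {R : realType}.
Variable d : nat.
Hypothesis d2 : (2 <= d)%N.

(** The shift by three keeps the logarithm positive from k = 0 on and lets it at most double at each
    step. *)
Definition ln3 k : R := ln k.+3%:R.

Lemma ln3_gt0 k : 0 < ln3 k.
Proof. by rewrite ln_gt0// ltr1n. Qed.

Lemma ln3_le k k' : (k <= k')%N -> ln3 k <= ln3 k'.
Proof. by move=> kk; rewrite ler_ln ?posrE// ler_nat !ltnS. Qed.

Lemma ln3S k : ln3 k.+1 <= 2 * ln3 k.
Proof.
rewrite /ln3 mulr_natl -lnXn ?ltr0n// ler_ln ?posrE ?exprn_gt0//.
by rewrite -natrX ler_nat; lia.
Qed.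

(* Truncation level (up to the factor e0) and size of the k-th shell on the
   scale of the iterated logarithm. *)
Definition tlev (e0 : R) k : R := e0 * Num.sqrt (cvol d k / ln3 k).
Definition chis k : R := Num.sqrt (cvol d k * ln3 k).

Lemma cvol_ge4 k : 4 * cvol d k <= cvol d k.+1 :> R.
Proof.
rewrite cvolS ler_pM2r ?cvol_gt0// -[4]/(2 * 2)%:R natrM -expr2 -!natrX ler_nat.
by rewrite leq_exp2l.
Qed.

Lemma chis_gt0 k : 0 < chis k.
Proof. by rewrite sqrtr_gt0 mulr_gt0 ?cvol_gt0 ?ln3_gt0. Qed.

Lemma tlev_gt0 e0 k : 0 < e0 -> 0 < tlev e0 k.
Proof. by move=> e00; rewrite mulr_gt0// sqrtr_gt0 divr_gt0 ?cvol_gt0 ?ln3_gt0. Qed.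

Lemma sqrt2_gt1 : 1 < Num.sqrt 2 :> R.
Proof. by rewrite -[X in X < _]sqrtr1 ltr_sqrt ?ltr1n. Qed.

Lemma chisS k : Num.sqrt 2 * chis k <= chis k.+1.
Proof.
have c0 := cvol_gt0 (R := R) d k; have l0 := ln3_gt0 k.
rewrite /chis -sqrtrM// ler_sqrt; last by rewrite ltW// mulr_gt0 ?cvol_gt0 ?ln3_gt0.
rewrite mulrA; apply: ler_pM; [by rewrite mulr_ge0// ltW|exact: ltW| |].
  by have := cvol_ge4 k; lra.
exact: ln3_le.
Qed.

(** As d >= 2, one step multiplies [cvol] by at least 4 and the logarithm by at most 2. *)
Lemma tlevS e0 k : 0 < e0 -> Num.sqrt 2 * tlev e0 k <= tlev e0 k.+1.
Proof.
move=> e00; have c0 := cvol_gt0 (R := R) d k; have l0 := ln3_gt0 k.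
have l1 := ln3_gt0 k.+1.
rewrite /tlev mulrCA ler_pM2l// -sqrtrM// ler_sqrt; last first.
  by rewrite ltW// divr_gt0 ?cvol_gt0 ?ln3_gt0.
rewrite ler_pdivlMr// mulrA mulrAC ler_pdivrMr//.
apply: (@le_trans _ _ (2 * cvol d k * (2 * ln3 k))).
  by rewrite ler_pM2l ?mulr_gt0// ln3S.
have := cvol_ge4 k => h.
have := ler_wpM2r (ltW l0) h; lra.
Qed.

Lemma tlev_le e0 k k' : 0 < e0 -> (k <= k')%N -> tlev e0 k <= tlev e0 k'.
Proof.
move=> e00; elim: k' => [|k' IH]; first by rewrite leqn0 => /eqP ->.
rewrite leq_eqVlt => /orP[/eqP -> //|kk].
apply: (le_trans (IH kk)); apply: le_trans (tlevS k' e00).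
by rewrite ler_peMl ?ltW ?tlev_gt0 ?sqrt2_gt1.
Qed.

(** This identity turns tails normalized by [chis] into sums of truncation levels, which grow
    geometrically. *)
Lemma tlev_chis e0 k : 0 < e0 -> cvol d k / chis k = tlev e0 k / e0.
Proof.
move=> e00; have c0 := cvol_gt0 (R := R) d k; have l0 := ln3_gt0 k.
rewrite /tlev mulrAC divff ?gt_eqF// mul1r /chis sqrtrM ?ltW//.
rewrite sqrtrM ?ltW// sqrtrV ?ltW//.
rewrite -[X in X / _](@sqr_sqrtr _ (cvol d k)) ?ltW//; field.
by rewrite !gt_eqF ?sqrtr_gt0.
Qed.

End levels.

(** * The part discarded by truncation in the iterated logarithm *)

Section lil_tail.
Context {dsp : measure_display} {Omega : measurableType dsp} {R : realType}.
Variable P : probability Omega R.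
Variables (d : nat) (X : 'rV[nat]_d -> {RV P >-> R}) (xi : {RV P >-> R}).
Hypothesis d2 : (2 <= d)%N.
Hypothesis hX : independent_copies (posvec (d := d)) X xi.
Hypothesis hint : P.-integrable setT (EFin \o xi).
Hypothesis hsq : P.-integrable setT (EFin \o (fun w => xi w ^+ 2)).
Notation I := 'rV[nat]_d.
Notation mu := (Ex P xi).
Notation tlev := (tlev d).
Notation chis := (chis d).
Variable e0 : R.
Hypothesis e00 : 0 < e0.

Definition tailE k : R := Ex P (above (tlev e0 k) Num.norm \o xi).

Let iabove k : P.-integrable setT (EFin \o (above (tlev e0 k) Num.norm \o xi)).
Proof.
by apply: above_int; [exact: normr_measurable|exact: (integrable_norm hint)].
Qed.

Lemma tailE_ge0 k : 0 <= tailE k.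
Proof.
by apply: Rintegral_ge0 => w _; have /andP[] := above_le (tlev e0 k) (normr_ge0 (xi w)).
Qed.

(** By [tlev_chis] the integrand is |xi| / e0 times the sum of the levels below |xi|. That sum is at
    most a multiple of |xi|, which leaves xi^2. *)
Lemma tailE_sum N : \sum_(k < N) cvol d k / chis k * tailE k <=
  Num.sqrt 2 / (Num.sqrt 2 - 1) / e0 * Ex P (fun w => xi w ^+ 2).
Proof.
have hi k : P.-integrable setT (EFin \o (fun w => cvol d k / chis k *
    (above (tlev e0 k) Num.norm \o xi) w)) by exact: Zl_int.
have [h1 h2] := @Ex_sum_int _ _ _ P _ (index_enum 'I_N)
   (fun k w => cvol d k / chis k * (above (tlev e0 k) Num.norm \o xi) w)
   (fun k _ => hi k).
have -> : \sum_(k < N) cvol d k / chis k * tailE k =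
   \sum_(k < N) Ex P (fun w => cvol d k / chis k *
     (above (tlev e0 k) Num.norm \o xi) w).
  by apply: eq_bigr => k _; rewrite /tailE /Ex RintegralZl.
rewrite -h2 /Ex -RintegralZl//; apply: le_Rintegral => //; first exact: Zl_int.
move=> w _ /=.
have := @weight_sum_below _ _ _ sqrt2_gt1 (fun k => tlev_gt0 d k e00)
   (fun k => tlevS d2 k e00) `|xi w| N.
rewrite (max_idPl (normr_ge0 (xi w))) => h.
have -> : \sum_(k < N) cvol d k / chis k * above (tlev e0 k) Num.norm (xi w) =
   `|xi w| / e0 * \sum_(k < N) (if tlev e0 k < `|xi w| then tlev e0 k else 0).
  rewrite mulr_sumr; apply: eq_bigr => k _; rewrite (tlev_chis d k e00) /above.
  by rewrite ltNge; case: ifP => _ /=; rewrite ?mulr0//; ring.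
have x0 : 0 <= `|xi w| / e0 by rewrite divr_ge0// ltW.
apply: (le_trans (ler_wpM2l x0 h)).
rewrite -[in leRHS](@real_normK _ (xi w)) ?num_real// le_eqVlt; apply/orP; left.
by apply/eqP; ring.
Qed.

Lemma tailE_small (e : R) : 0 < e -> exists K, forall k, (K <= k)%N ->
  cvol d k * tailE k <= e * chis k.
Proof.
move=> e_gt0.
have u0 k : 0 <= cvol d k / chis k * tailE k.
  by rewrite mulr_ge0 ?tailE_ge0// divr_ge0 ?ltW ?cvol_gt0 ?chis_gt0.
have [K hK] := bounded_sums_small u0 tailE_sum e_gt0.
exists K => k Kk; have := hK k Kk.
by rewrite mulrAC ler_pdivrMr ?chis_gt0.
Qed.

Definition shell_tail k w : R :=
  \sum_(m <- shell d k) above (tlev e0 k) Num.norm (X m w).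

Lemma shell_tail_ge0 k w : 0 <= shell_tail k w.
Proof.
apply: sumr_ge0 => m _.
by have /andP[] := above_le (tlev e0 k) (normr_ge0 (X m w)).
Qed.

(** A first-moment bound is enough: Markov's inequality on each shell is summable by [tailE_sum]. *)
Lemma shell_tail_small : {ae P, forall w, forall e : R, 0 < e ->
  exists K, forall k, (K <= k)%N -> shell_tail k w <= e * chis k}.
Proof.
have habove k x : 0 <= above (tlev e0 k) Num.norm x.
  by have /andP[] := above_le (tlev e0 k) (normr_ge0 x).
have mabove k : measurable_fun setT (above (tlev e0 k) (@Num.norm R R)).
  by apply: above_measurable; exact: normr_measurable.
have hE k : P.-integrable setT (EFin \o shell_tail k) /\
    Ex P (shell_tail k) <= cvol d k * tailE k.
  have hm m : m \in shell d k -> _ := fun mk =>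
    law_int (hX.2 m (shell_posvec mk)) (mabove k) (habove k) (iabove k).
  have [h1 h2] := @Ex_sum_int _ _ _ P _ (shell d k)
    (fun m => above (tlev e0 k) Num.norm \o X m) (fun m mk => (hm m mk).1).
  split=> //; rewrite [leLHS]h2 (eq_big_seq (fun=> tailE k)); last first.
    by move=> m mk; exact: (hm m mk).2.
  rewrite big_const_seq count_predT iter_addr_0 -mulr_natl ler_wpM2r ?tailE_ge0//.
  by rewrite ler_nat size_shell.
have : {ae P, forall w, forall j : nat, exists K, forall k,
    (K <= k)%N -> ~ [set w | j.+1%:R^-1 * chis k < shell_tail k w] w}.
  apply/ae_foralln => j.
  have j0 : 0 < (j.+1%:R^-1 : R) by rewrite invr_gt0.
  have hk k := @markov_int _ _ _ P (shell_tail k) (j.+1%:R^-1 * chis k)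
     (mulr_gt0 j0 (chis_gt0 d k)) (shell_tail_ge0 k) (hE k).1.
  apply: (@ae_eventually_not _ _ _ P _ (j.+1%:R * (Num.sqrt 2 / (Num.sqrt 2 - 1)
     / e0 * Ex P (fun w => xi w ^+ 2)))).
    by move=> k; exact: (hk k).1.
  move=> N; apply: le_trans (ler_wpM2l _ (tailE_sum N)) => //.
  rewrite mulr_sumr; apply: ler_sum => k _.
  apply: (le_trans (hk k).2); rewrite invfM invrK.
  have := (hE k).2; rewrite -(ler_pM2r (x := j.+1%:R / chis k)); last first.
    by rewrite divr_gt0 ?chis_gt0.
  move=> h; apply: (le_trans h); rewrite le_eqVlt; apply/orP; left.
  by apply/eqP; ring.
apply: filterS => w hw e e_gt0.
pose j := Num.truncn e^-1.
have je : j.+1%:R^-1 <= e.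
  rewrite -[leRHS]invrK lef_pV2 ?posrE ?invr_gt0//.
  by rewrite ltW// Num.Theory.truncnS_gt.
have [K hK] := hw j; exists K => k Kk; have /negP := hK k Kk.
rewrite -leNgt => h; apply: (le_trans h); rewrite ler_pM2r//; exact: chis_gt0.
Qed.

(** The error is dominated by the absolute tails over the whole cube, so the bound holds for all
    subsets at once; it serves both boxes and blocks. *)
Lemma truncation_error : {ae P, forall w, forall e : R, 0 < e ->
  exists K0, forall K, (K0 <= K)%N -> forall s : seq I, uniq s ->
  {subset s <= bx (cube d K)} ->
  `|\sum_(m <- s) (X m w - mu) - \sum_(m <- s) tZ X xi (tlev e0 K) m w| <=
  e * chis K}.
Proof.
apply: filterS shell_tail_small => w hw e e_gt0.
have e2 : 0 < e / 2 by rewrite divr_gt0.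
have [K1 hK1] := tailE_small e2.
have hb k (x : unit) : `|shell_tail k w| <= shell_tail k w.
  by rewrite ger0_norm ?shell_tail_ge0.
have ha (e' : R) : 0 < e' -> exists k0, forall k, (k0 <= k)%N ->
    forall x : unit, `|shell_tail k w| <= e' * chis k.
  move=> /hw[K hK]; exists K => k Kk _.
  by rewrite ger0_norm ?shell_tail_ge0// hK.
have [K2 hK2] := toeplitz sqrt2_gt1 (chis_gt0 d) (chisS d2) hb ha e2.
exists (maxn K1 K2) => K; rewrite geq_max => /andP[K1K K2K] s us sK.
have b0 : 0 <= tlev e0 K by rewrite ltW// tlev_gt0.
have hs : `|\sum_(m <- s) (X m w - mu) - \sum_(m <- s) tZ X xi (tlev e0 K) m w| <=
   \sum_(m <- s) above (tlev e0 K) Num.norm (X m w) + (size s)%:R * tailE K.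
  rewrite -sumrB; apply: (le_trans (ler_norm_sum _ _ _)).
  have -> : (size s)%:R * tailE K = \sum_(m <- s) tailE K.
    by rewrite big_const_seq count_predT iter_addr_0 mulr_natl.
  rewrite -big_split/=; apply: ler_sum => m _.
  have -> : X m w - mu - ctrunc xi (tlev e0 K) (X m w) =
     (X m w - trunc (tlev e0 K) (X m w)) - (mu - tmean xi (tlev e0 K)).
    by rewrite /ctrunc; ring.
  apply: (le_trans (ler_normB _ _)); apply: lerD; last exact: mean_tmean.
  by rewrite sub_trunc /above; case: ifP; rewrite ?normr0.
apply: (le_trans hs).
have h1 : (size s)%:R * tailE K <= e / 2 * chis K.
  apply: le_trans (hK1 K K1K); rewrite ler_wpM2r ?tailE_ge0//.
  by rewrite ler_nat -vol_cube -size_bx; exact: uniq_leq_size.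
have h2 : \sum_(m <- s) above (tlev e0 K) Num.norm (X m w) <= e / 2 * chis K.
  have hpos m : 0 <= above (tlev e0 K) Num.norm (X m w).
    by have /andP[] := above_le (tlev e0 K) (normr_ge0 (X m w)).
  apply: (@le_trans _ _ (\sum_(m <- bx (cube d K))
      above (tlev e0 K) Num.norm (X m w))).
    have -> : \sum_(m <- s) above (tlev e0 K) Num.norm (X m w) =
      \sum_(m <- bx (cube d K) | m \in s) above (tlev e0 K) Num.norm (X m w).
      rewrite -[RHS]big_filter; apply: perm_big; apply: uniq_perm => //.
        by rewrite filter_uniq// bx_uniq.
      move=> m; rewrite mem_filter; case: (boolP (m \in s)) => //= ms.
      by rewrite sK.
    by rewrite [leRHS](bigID (fun m => m \in s))/= lerDl sumr_ge0.
  (* The cutoff belongs to the outer cube; lowering it to the level of the inner shell [k] only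
     enlarges the tail. *)
  rewrite sum_cube_shells; apply: le_trans (le_trans (ler_norm _) (hK2 K K2K tt)).
  apply: ler_sum => k _; apply: ler_sum => m _; rewrite /above.
  case: ifPn => xK; first by case: ifP.
  case: ifPn => // xk; move: xK; rewrite (le_trans xk)//.
  by rewrite tlev_le// -ltnS.
lra.
Qed.

End lil_tail.

Section ae_countable.
Context {dsp : measure_display} {Omega : measurableType dsp} {R : realType}.
Variable P : probability Omega R.

Lemma ae_forall_countType (T : countType) (G : T -> Omega -> Prop) :
  (forall t, {ae P, forall w, G t w}) -> {ae P, forall w, forall t, G t w}.
Proof.
move=> hG.
have : {ae P, forall w, forall k, if @choice.unpickle T k is Some t then G t w else True}.
  apply/ae_foralln => k; case: (@choice.unpickle T k) => [t|]; first exact: hG.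
  exact: aeW.
by apply: filterS => w hw t; have := hw (choice.pickle t); rewrite choice.pickleK.
Qed.

Lemma ae_forall_eps (G : R -> Omega -> Prop) :
  (forall e, 0 < e <= 1 -> {ae P, forall w, G e w}) ->
  (forall w e e', e <= e' -> G e w -> G e' w) ->
  {ae P, forall w, forall e, 0 < e -> G e w}.
Proof.
move=> hG mG.
have : {ae P, forall w, forall j : nat, G j.+1%:R^-1 w}.
  apply/ae_foralln => j; apply: hG.
  by rewrite invr_gt0 ltr0n/= invf_le1 ?ltr0n// ler1n.
apply: filterS => w hw e e0.
apply: mG (hw (Num.truncn e^-1)).
rewrite -[leRHS]invrK lef_pV2 ?posrE ?invr_gt0//.
by rewrite ltW// Num.Theory.truncnS_gt.
Qed.

End ae_countable.

Section dilations.
Variable d : nat.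
Notation I := 'rV[nat]_d.
Implicit Types (a m n : I).

Definition dil i a : I := \row_j (2 ^ i * a ord0 j)%N.

Lemma dil_posvec i a : posvec a -> posvec (dil i a).
Proof. by move=> pa j; rewrite mxE muln_gt0 expn_gt0 pa. Qed.

Lemma vol_dil i a : vol (dil i a) = (2 ^ (i * d) * vol a)%N.
Proof.
rewrite /vol (eq_bigr (fun j => 2 ^ i * a ord0 j)%N); last by move=> j _; rewrite mxE.
by rewrite big_split/= prod_nat_const card_ord expnM.
Qed.

Lemma vol_gt0 a : posvec a -> (0 < vol a)%N.
Proof. by move=> pa; rewrite /vol prodn_gt0. Qed.

Lemma lev_dil i a : lev (dil i a) (cube d (i + scale a)).
Proof.
apply/levP => j; have /levP := lev_scale a => /(_ j).
by rewrite !mxE expnD leq_mul2l => ->; rewrite orbT.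
Qed.

Lemma dil_lev i i' a : (i <= i')%N -> lev (dil i a) (dil i' a).
Proof. by move=> ii; apply/levP => j; rewrite !mxE leq_mul2r leq_exp2l// ii orbT. Qed.

End dilations.

(** * The iterated logarithm along the dilations of a fixed shape *)

Section lil_dilations.
Context {dsp : measure_display} {Omega : measurableType dsp} {R : realType}.
Variable P : probability Omega R.
Variables (d : nat) (X : 'rV[nat]_d -> {RV P >-> R}) (xi : {RV P >-> R}).
Hypothesis d2 : (2 <= d)%N.
Hypothesis hX : independent_copies (posvec (d := d)) X xi.
Hypothesis hint : P.-integrable setT (EFin \o xi).
Hypothesis hsq : P.-integrable setT (EFin \o (fun w => xi w ^+ 2)).
Notation I := 'rV[nat]_d.
Notation mu := (Ex P xi).
Variable sg : R.
Hypothesis sg0 : 0 < sg.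
Hypothesis hsg : Ex P (fun w => xi w ^+ 2) - mu ^+ 2 = sg ^+ 2.

Lemma tvar_cvg (e : R) : 0 < e -> exists B : R, forall b, B <= b -> 0 <= b ->
  `|tvar xi b - sg ^+ 2| <= e.
Proof.
move=> e0.
have msq : measurable_fun setT (fun x : R => x ^+ 2) by exact: exprn_measurable.
have mnm : measurable_fun setT (@Num.norm R R) by exact: normr_measurable.
(* The minimum with 1 bounds the factor 2 mu - (mu - m) by 2 |mu| + 1; the other entry then makes
   the product at most e/2. *)
pose e1 := Num.min 1 (e / (2 * (2 * `|mu| + 1))).
have m0 : 0 < 2 * (2 * `|mu| + 1) by have := normr_ge0 mu; lra.
have e10 : 0 < e1 by rewrite lt_min ltr01 divr_gt0.
have [B1 hB1] := above_small mnm (@normr_ge0 _ _) (integrable_norm hint) e10.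
have [||B2 hB2] := @above_small _ _ _ P xi (fun x => x ^+ 2) (e / 2) msq (@sqr_ge0 R).
- exact: hsq.
- by rewrite divr_gt0.
exists (Num.max B1 B2) => b; rewrite ge_max => /andP[B1b B2b] b0.
have h1 := hB1 b B1b; have h2 := hB2 b B2b.
have h3 := mean_tmean b0 hint.
have sqE : Ex P (fun w => trunc b (xi w) ^+ 2) =
    Ex P (fun w => xi w ^+ 2) - Ex P (above b (fun x => x ^+ 2) \o xi).
  rewrite /Ex -RintegralB//; last exact: above_int.
  apply: eq_Rintegral => w _ /=; rewrite /trunc /above.
  by case: ifP => _; rewrite ?subr0 ?subrr// expr0n.
have a0 : 0 <= Ex P (above b (fun x => x ^+ 2) \o xi).
  apply: Rintegral_ge0 => w _.
  by have /andP[] := above_le b (h := fun x => x ^+ 2) (sqr_ge0 (xi w)).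
rewrite tvarE// sqE -hsg.
set A := Ex P (above b (fun x => x ^+ 2) \o xi) in a0 h2 *.
set m := tmean xi b in h3 *.
have -> : Ex P (fun w => xi w ^+ 2) - A - m ^+ 2 -
    (Ex P (fun w => xi w ^+ 2) - mu ^+ 2) = (mu - m) * (2 * mu - (mu - m)) - A by ring.
have h4 : `|mu - m| <= e1 := le_trans h3 h1.
have h5 : `|2 * mu - (mu - m)| <= 2 * `|mu| + 1.
  apply: (le_trans (ler_normB _ _)); rewrite normrM normr_nat lerD2l.
  by apply: (le_trans h4); rewrite ge_min lexx.
have h6 : `|(mu - m) * (2 * mu - (mu - m))| <= e / 2.
  rewrite normrM; apply: (@le_trans _ _ (e / (2 * (2 * `|mu| + 1)) * (2 * `|mu| + 1))).
    apply: ler_pM => //; apply: (le_trans h4); by rewrite ge_min lexx orbT.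
  rewrite le_eqVlt; apply/orP; left; apply/eqP; field.
  by rewrite gt_eqF//; have := normr_ge0 mu; lra.
apply: (le_trans (ler_normB _ _)); rewrite (ger0_norm a0).
by apply: (le_trans (lerD h6 h2)); rewrite -splitr.
Qed.

(** The normalization with log i in place of log log |2^i a|, to which it is asymptotically equal
    for fixed [a]. *)
Definition zeta i (a : I) : R := Num.sqrt (2 * (vol (dil i a))%:R * ln i%:R).

Variable a : I.
Hypothesis pa : posvec a.

Let Q : R := cvol d (scale a) / (vol a)%:R.
Let V i : R := (vol (dil i a))%:R.

Let V0 i : 0 < V i. Proof. by rewrite ltr0n vol_gt0//; exact: dil_posvec. Qed.
Let Q0 : 0 < Q. Proof. by rewrite divr_gt0 ?cvol_gt0// ltr0n vol_gt0. Qed.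

Lemma cvol_dil i : cvol d (i + scale a) = V i * Q.
Proof.
have v0 : (vol a)%:R != 0 :> R by rewrite pnatr_eq0 -lt0n vol_gt0.
rewrite /V /Q vol_dil /cvol mulnDl expnD !natrM.
by move: v0 ((2 ^ (i * d))%:R) ((2 ^ (scale a * d))%:R) => v0 x y; move: (_%:R) v0 => v v0; field.
Qed.

Let lni0 i : (2 <= i)%N -> 0 < ln i%:R :> R.
Proof. by move=> i2; rewrite ln_gt0// ltr1n. Qed.

Lemma zetaE i : zeta i a = Num.sqrt (V i) * Num.sqrt (2 * ln i%:R).
Proof. by rewrite /zeta -sqrtrM ?ltW//; congr Num.sqrt; rewrite /V; ring. Qed.

(** The square root is [sg] times the Chernoff tilt, so tilt times truncation level is made as small
    as desired through [e0]. *)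
Lemma tlev_dil (e0 : R) i : 0 < e0 -> (2 <= i)%N ->
  tlev d e0 (i + scale a) * Num.sqrt (2 * ln i%:R / V i) <=
  e0 * Num.sqrt (2 * Q).
Proof.
move=> e00 i2; have l0 := lni0 i2.
rewrite /tlev -mulrA ler_pM2l// -sqrtrM; last first.
  by rewrite divr_ge0// ltW// ?cvol_gt0 ?ln3_gt0.
rewrite ler_sqrt; last by rewrite mulr_ge0// ltW.
rewrite cvol_dil mulrAC ler_pdivrMr ?ln3_gt0//.
have -> : V i * Q * (2 * ln i%:R / V i) = 2 * Q * ln i%:R.
  by have := lt0r_neq0 (V0 i); move: (V i) => v v0; field.
rewrite ler_pM2l; last by rewrite mulr_gt0.
rewrite /ln3 ler_ln ?posrE ?ltr0n ?(leq_trans _ i2)// ler_nat.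
by rewrite -addnS -addnS -addnS leq_addr.
Qed.

(** With s = scale a, i + s + 3 <= i (s + 4); as ln i >= 1 for i >= 3, the logarithm of s + 4 can be
    absorbed into a factor of ln i. *)
Lemma chis_dil : exists2 c : R, 0 < c & forall i, (3 <= i)%N ->
  chis d (i + scale a) <= c * zeta i a.
Proof.
pose s := scale a.
have l4 : 0 <= ln s.+4%:R :> R by rewrite ln_ge0// ler1n.
have q1 : 0 < Q * (1 + ln s.+4%:R) by rewrite mulr_gt0//; lra.
exists (Num.sqrt (Q * (1 + ln s.+4%:R))); first by rewrite sqrtr_gt0.
move=> i i3.
have li : 1 <= ln i%:R :> R.
  rewrite -[leLHS]expRK ler_ln ?posrE ?expR_gt0 ?ltr0n ?(leq_trans _ i3)//.
  apply: (@le_trans _ _ 3); last by rewrite ler_nat.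
  exact: expR1_le3.
rewrite /chis /zeta -sqrtrM; last exact: ltW.
rewrite ler_sqrt; last first.
  rewrite mulr_ge0 ?(ltW q1)// mulr_ge0 ?(le_trans ler01 li)//.
rewrite cvol_dil /ln3.
have h : ln (i + s).+3%:R <= ln i%:R * (1 + ln s.+4%:R) :> R.
  have : ln (i + s).+3%:R <= ln (i%:R * s.+4%:R) :> R.
    rewrite ler_ln ?posrE ?mulr_gt0 ?ltr0n ?(leq_trans _ i3)//.
    by rewrite -natrM ler_nat; nia.
  rewrite lnM ?posrE ?ltr0n ?(leq_trans _ i3)// => h; apply: (le_trans h).
  have := ler_wpM2r l4 li; lra.
have VQ : 0 <= V i * Q by rewrite mulr_ge0// ltW.
apply: (le_trans (ler_wpM2l VQ h)); rewrite -/(V i).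
have : 0 <= V i * Q * (ln i%:R * (1 + ln s.+4%:R)).
  by rewrite mulr_ge0// mulr_ge0//; lra.
by lra.
Qed.

(** One half of [eps] pays for the shift in the maximal inequality. At deviation (1 + eps/2) sg zeta
    the Chernoff exponent is at most -2 (1 + eps/2) L + (1 + eps/2) L with L = ln i. *)
Lemma upper_prob (eps : R) : 0 < eps <= 1 -> exists2 e0 : R, 0 < e0 &
  exists i0, forall i, (i0 <= i)%N ->
  pr P (exceed (tZ X xi (tlev d e0 (i + scale a))) d (bx (dil i a)) (dil i a)
    ((1 + eps) * sg * zeta i a)) <=
  2 ^+ d * (2 * expR (- ((1 + eps / 2) * ln i%:R))).
Proof.
move=> /andP[eps0 eps1].
(* Small enough for (1 + 2 eta)(1 + eta) <= 1 + eps/2, the moment and variance errors combined. *)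
pose eta := eps / 10.
have eta0 : 0 < eta by rewrite divr_gt0.
have sQ : 0 < Num.sqrt (2 * Q) by rewrite sqrtr_gt0 mulr_gt0.
pose e0 := eta * sg / (2 * Num.sqrt (2 * Q)).
have e00 : 0 < e0 by rewrite divr_gt0 ?mulr_gt0.
exists e0 => //.
have sg20 : 0 < sg ^+ 2 by rewrite exprn_gt0.
have [B hB] := tvar_cvg (mulr_gt0 eta0 sg20).
have [K0 hK0] := weight_unbounded sqrt2_gt1 (fun k => tlev_gt0 d k e00)
  (fun k => tlevS d2 k e00) B.
(* Once sqrt(2 L) >= M, the shift d 2^d s is at most (eps/2) sg zeta. *)
pose M : R := 4 * (d%:R * 2 ^+ d) / eps.
have [K1 hK1] := @ln_nat_unbounded R (M ^+ 2).
exists (maxn 2 (maxn K0 K1)) => i; rewrite !geq_max => /and3P[i2 K0i K1i].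
have L0 := lni0 i2.
set K := (i + scale a)%N; set b := tlev d e0 K; set L : R := ln i%:R in L0 *.
have b0 : 0 < b by exact: tlev_gt0.
have tv : tvar xi b <= sg ^+ 2 * (1 + eta).
  have := hB b (hK0 K (leq_trans K0i (leq_addr _ _))) (ltW b0).
  by rewrite ler_norml => /andP[_]; lra.
have sz : (size (bx (dil i a)))%:R = V i by rewrite size_bx.
have Vi := V0 i; have sV : 0 < Num.sqrt (V i) by rewrite sqrtr_gt0.
have sL : 0 < Num.sqrt (2 * L) by rewrite sqrtr_gt0 mulr_gt0.
have sV2 : Num.sqrt (V i) ^+ 2 = V i by rewrite sqr_sqrtr// ltW.
have sL2 : Num.sqrt (2 * L) ^+ 2 = 2 * L by rewrite sqr_sqrtr// mulr_ge0// ltW.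
have ML : M <= Num.sqrt (2 * L).
  have M0 : 0 <= M by rewrite /M divr_ge0 ?mulr_ge0 ?exprn_ge0// ltW.
  rewrite -[M]ger0_norm// -sqrtr_sqr ler_sqrt; last by rewrite mulr_ge0// ltW.
  by have := hK1 i K1i; rewrite -/L; lra.
pose x := (1 + eps / 2) * sg * zeta i a.
(* Twice the limiting standard deviation; a crude bound is enough, as it enters only through the
   shift. *)
pose s := 2 * sg * Num.sqrt (V i).
have s0 : 0 < s by rewrite /s !mulr_gt0.
have hvar : \sum_(m <- bx (dil i a)) Ex P (fun w => tZ X xi b m w ^+ 2) <= s ^+ 2.
  rewrite (eq_big_seq (fun=> tvar xi b)); last first.
    by move=> m /bx_posvec pm; rewrite (tZ_var hX)// ltW.
  rewrite big_const_seq count_predT iter_addr_0 -mulr_natl sz.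
  have -> : s ^+ 2 = V i * (4 * sg ^+ 2) by rewrite /s -[in RHS]sV2; ring.
  rewrite ler_pM2l//; apply: (le_trans tv).
  have : sg ^+ 2 * eta <= sg ^+ 2 * 1 by rewrite ler_pM2l// /eta; lra.
  by lra.
have hO := multi_ottaviani (tZ_indep hX b) (tZ_bm X xi (ltW b0))
  (fun m => tZ_mean hX (ltW b0) (i := m)) (leqnn d) (dil i a) x
  (bx_uniq (dil i a)) (@bx_posvec d (dil i a)) s0 hvar.
have hx : x + d%:R * 2 ^+ d * s <= (1 + eps) * sg * zeta i a.
  rewrite /x /s zetaE -/L.
  have h : d%:R * 2 ^+ d * 4 <= eps * Num.sqrt (2 * L).
    by move: ML; rewrite /M ler_pdivrMr//; lra.
  have p0 : 0 <= sg * Num.sqrt (V i) by rewrite mulr_ge0 ?ltW.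
  by have := ler_wpM2l p0 h; lra.
apply: (@le_trans _ _ (pr P (exceed (tZ X xi b) d (bx (dil i a)) (dil i a)
    (x + d%:R * 2 ^+ d * s)))).
  by apply: pr_le; [exact: exceed_measurable|exact: exceed_measurable|exact: exceed_anti].
apply: (le_trans hO); rewrite ler_pM2l ?exprn_gt0//.
(* The optimal tilt for deviation sg zeta and variance V sg^2. *)
pose t := Num.sqrt (2 * L / V i) / sg.
have t0 : 0 <= t by rewrite divr_ge0 ?sqrtr_ge0 ?ltW.
have te : t * (2 * b) <= eta.
  have := @tlev_dil e0 i e00 i2; rewrite -/K -/b -/L => h.
  have -> : t * (2 * b) = (b * Num.sqrt (2 * L / V i)) * (2 / sg).
    by rewrite /t; ring.
  have -> : eta = e0 * Num.sqrt (2 * Q) * (2 / sg).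
    by rewrite /e0; field; rewrite !gt_eqF.
  by rewrite ler_pM2r// divr_gt0.
have eta2 : eta <= 1 / 2 by rewrite /eta; lra.
have hE := exp_upper hX x (ltW b0) (bx_uniq (dil i a)) (@bx_posvec d (dil i a)) t0 te eta2.
have -> : [set w | x < `|psum (tZ X xi b) (bx (dil i a)) (dil i a) w|] =
    [set w | x < `|\sum_(m <- bx (dil i a)) tZ X xi b m w|].
  by apply/seteqP; split=> w; rewrite /= /psum -(sum_bx_sub _ (lev_refl _)).
apply: (le_trans hE); rewrite ler_pM2l// ler_expR sz.
have tE : t = Num.sqrt (2 * L) / Num.sqrt (V i) / sg.
  rewrite /t sqrtrM; last by rewrite mulr_ge0// ltW.
  by rewrite sqrtrV// ltW.
have -> : t * x = (1 + eps / 2) * (2 * L).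
  rewrite /x zetaE -/L tE -[in RHS]sL2; field.
  by rewrite !gt_eqF.
have -> : V i * ((1 + 2 * eta) * (t ^+ 2 * tvar xi b / 2)) =
   (1 + 2 * eta) * (tvar xi b / sg ^+ 2) * L.
  have -> : t ^+ 2 = 2 * L / (V i * sg ^+ 2).
    by rewrite tE -[in RHS]sL2 -[in RHS]sV2; field; rewrite !gt_eqF.
  by field; rewrite !gt_eqF.
have h1 : tvar xi b / sg ^+ 2 <= 1 + eta by rewrite ler_pdivrMr// mulrC.
have h2 : (1 + 2 * eta) * (tvar xi b / sg ^+ 2) <= 1 + eps / 2.
  apply: (@le_trans _ _ ((1 + 2 * eta) * (1 + eta))).
    by rewrite ler_wpM2l//; lra.
  have : eta * eta <= eta by rewrite ger_pMr//; lra.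
  by rewrite /eta; lra.
by have := ler_wpM2r (ltW L0) h2; lra.
Qed.


Notation dev m w := (\sum_(l <- bx m) (X l w - mu)).

Lemma zeta_ge0 i : 0 <= zeta i a. Proof. exact: sqrtr_ge0. Qed.

Lemma bx_dil_sub i m : lev m (dil i a) -> {subset bx m <= bx (cube d (i + scale a))}.
Proof.
move=> ma l /bxP[pl lm]; apply/bxP; split=> //.
exact: lev_trans lm (lev_trans ma (lev_dil i a)).
Qed.

(** Half of [eps] goes to the truncated sums, half to the truncation error. *)
Lemma upper_ae : {ae P, forall w, forall eps, 0 < eps -> exists i0,
  forall i, (i0 <= i)%N -> forall m, lev m (dil i a) ->
  `|dev m w| <= (1 + eps) * sg * zeta i a}.
Proof.
apply: ae_forall_eps; last first.
  move=> w e e' ee [i0 h]; exists i0 => i ii m ma; apply: (le_trans (h i ii m ma)).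
  rewrite ler_wpM2r ?zeta_ge0// ler_wpM2r ?(ltW sg0)//.
  by rewrite lerD2l.
move=> eps /andP[eps0 eps1].
have eps2 : 0 < eps / 2 <= 1 by apply/andP; lra.
have [e0 e00 [i0 hi0]] := upper_prob eps2.
have [c c0 hc] := chis_dil.
have dl0 : 0 < eps / 2 / 2 by rewrite !divr_gt0.
have [S hS] := @p_series_bounded R _ dl0.
pose E i := if (i0 <= i)%N then
   exceed (tZ X xi (tlev d e0 (i + scale a))) d (bx (dil i a)) (dil i a)
    ((1 + eps / 2) * sg * zeta i a) else set0.
have mE i : measurable (E i) by rewrite /E; case: ifP => _ //; exact: exceed_measurable.
have sE N : \sum_(i < N) pr P (E i) <= 2 ^+ d * (2 * S).
  apply: (@le_trans _ _ (\sum_(i < N) 2 ^+ d * (2 * expR (- ((1 + eps / 2 / 2) * ln i%:R))))).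
    apply: ler_sum => i _; rewrite /E; case: ifP => h; first exact: hi0.
    by rewrite /pr measure0 mulr_ge0 ?exprn_ge0// mulr_ge0// expR_ge0.
  by rewrite -!mulr_sumr !ler_pM2l ?exprn_gt0//; exact: hS.
have ee : 0 < eps / 2 * sg / c by rewrite divr_gt0// mulr_gt0// divr_gt0.
apply: filterS2 (ae_eventually_not mE sE) (truncation_error d2 hX hint hsq e00).
move=> w [k0 hk0] /(_ _ ee)[K0 hK0].
exists (maxn 3 (maxn i0 (maxn k0 K0))) => i; rewrite !geq_max => /and4P[i3 ii0 ik0 iK0] m ma.
have := hk0 i ik0; rewrite /E ii0 => nE.
have h1 : `|\sum_(l <- bx m) tZ X xi (tlev d e0 (i + scale a)) l w| <=
    (1 + eps / 2) * sg * zeta i a.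
  rewrite leNgt; apply/negP => h; apply: nE; exists m => //=.
    by split=> // j; rewrite leqNgt ltn_ord.
  by rewrite /psum -sum_bx_sub.
have h2 := hK0 (i + scale a)%N (leq_trans iK0 (leq_addr _ _)) (bx m) (bx_uniq m) (bx_dil_sub ma).
have h3 : eps / 2 * sg / c * chis d (i + scale a) <= eps / 2 * sg * zeta i a.
  rewrite -mulrA ler_pM2l; last by rewrite mulr_gt0// divr_gt0.
  by rewrite mulrC ler_pdivrMr// mulrC; exact: hc.
have -> : (1 + eps) * sg * zeta i a = eps / 2 * sg * zeta i a + (1 + eps / 2) * sg * zeta i a.
  by field.
rewrite -[X in `|X|](subrK (\sum_(l <- bx m) tZ X xi (tlev d e0 (i + scale a)) l w)).
apply: (le_trans (ler_normD _ _)); apply: lerD => //.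
exact: le_trans h2 h3.
Qed.

Section blocks.
Variable q : nat.
Hypothesis q0 : (0 < q)%N.

Definition block k : seq I :=
  [seq m <- bx (dil (q * k.+1) a) | ~~ lev m (dil (q * k) a)].

Lemma block_uniq k : uniq (block k).
Proof. by rewrite filter_uniq// bx_uniq. Qed.

Lemma block_sub k : {subset block k <= bx (dil (q * k.+1) a)}.
Proof. by move=> m; rewrite mem_filter => /andP[]. Qed.

Lemma sum_block k (f : I -> R) : \sum_(m <- bx (dil (q * k.+1) a)) f m =
  \sum_(m <- block k) f m + \sum_(m <- bx (dil (q * k) a)) f m.
Proof.
have h : lev (dil (q * k) a) (dil (q * k.+1) a) by rewrite dil_lev// leq_mul2l leqnSn orbT.
rewrite (bigID (fun m => lev m (dil (q * k) a)))/= -(sum_bx_sub _ h) addrC.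
by congr (_ + _); rewrite /block big_filter.
Qed.

Lemma size_block k : (size (block k))%:R = V (q * k.+1) - V (q * k).
Proof.
have := sum_block k (fun=> 1); rewrite !big_const_seq !count_predT !iter_addr_0.
by rewrite !size_bx => h; rewrite /V h addrK.
Qed.

Lemma block_disjoint i j : (i < j)%N -> [set` block i] `&` [set` block j] = set0.
Proof.
move=> ij; rewrite -subset0 => m /= [] /block_sub/bxP[_ mi].
rewrite mem_filter => /andP[/negP nm _]; apply: nm.
by apply: lev_trans mi _; rewrite dil_lev// leq_mul2l ij orbT.
Qed.

End blocks.


(** The volume ratio is 2^-(qd) <= (2^-q)^2 <= e1^2 since d >= 2; after a square root [zeta] loses
    the factor [e1]. *)
Lemma V_block (e1 : R) q k : 0 < e1 -> 1 <= e1 * 2 ^+ q ->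
  V (q * k) <= e1 ^+ 2 * V (q * k.+1).
Proof.
move=> e10 hq; rewrite /V !vol_dil mulnS mulnDl expnD !natrM.
rewrite -[X in _ <= _ * X]mulrA [leRHS]mulrA ler_peMl ?ler0n//.
apply: (@le_trans _ _ ((e1 * 2 ^+ q) ^+ 2)); first by rewrite exprn_ege1.
rewrite exprMn ler_wpM2l ?sqr_ge0// natrX -exprM ler_weXn2l ?ler1n//.
by rewrite leq_mul2l d2 orbT.
Qed.

Lemma zeta_block (e1 : R) q k : 0 < e1 -> 1 <= e1 * 2 ^+ q -> (0 < q)%N -> (0 < k)%N ->
  zeta (q * k) a <= e1 * zeta (q * k.+1) a.
Proof.
move=> e10 hq q0 k0; rewrite /zeta -(ger0_norm (ltW e10)) -sqrtr_sqr -sqrtrM ?sqr_ge0//.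
have l0 : 0 <= ln (q * k)%:R :> R by rewrite ln_ge0// ler1n muln_gt0 q0.
have ll : ln (q * k)%:R <= ln (q * k.+1)%:R :> R.
  by rewrite ler_ln ?posrE ?ltr0n ?muln_gt0 ?q0// ler_nat leq_mul2l leqnSn orbT.
rewrite ler_sqrt; last first.
  by rewrite mulr_ge0 ?sqr_ge0// mulr_ge0 ?mulr_ge0// (le_trans l0).
rewrite [leRHS](_ : _ = 2 * (e1 ^+ 2 * V (q * k.+1) * ln (q * k.+1)%:R)); last first.
  by rewrite /V; ring.
rewrite -mulrA ler_pM2l//.
by apply: ler_pM => //; exact: V_block.
Qed.

(** The tilt is taken with t^2 v = (1 - e1)^2 2 L, where L = ln (q (k+1)), so the lower bound is at
    least exp(-L) / 2, a harmonic term. The level (1 - dl) t v reached, with sqrt v >= (1 - e1) sg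
    sqrt V, accounts for 1 - 3 e1. *)
Lemma lower_prob (e1 : R) : 0 < e1 <= 1 / 8 -> exists2 e0 : R, 0 < e0 &
  exists q, [/\ (0 < q)%N, 1 <= e1 * 2 ^+ q & exists k0, forall k, (k0 <= k)%N ->
   (2 * q%:R)^-1 / k.+1%:R <= pr P [set w | (1 - 3 * e1) * sg * zeta (q * k.+1) a <
    \sum_(m <- block q k) tZ X xi (tlev d e0 (q * k.+1 + scale a)) m w]].
Proof.
move=> /andP[e10 e18].
pose dl := e1 / 4; pose eta := dl ^+ 2 / 24.
have dl0 : 0 < dl by rewrite divr_gt0.
have dl1 : dl <= 1 by rewrite /dl; lra.
have eta0 : 0 < eta by rewrite divr_gt0 ?exprn_gt0.
have sQ : 0 < Num.sqrt (2 * Q) by rewrite sqrtr_gt0 mulr_gt0.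
pose e0 := eta * sg / (8 * Num.sqrt (2 * Q)).
have e00 : 0 < e0 by rewrite divr_gt0 ?mulr_gt0.
exists e0 => //.
pose q := (Num.truncn e1^-1).+1.
have q0 : (0 < q)%N by [].
have hq : 1 <= e1 * 2 ^+ q.
  rewrite -ler_pdivrMl// mulr1 (le_trans (ltW (Num.Theory.truncnS_gt _)))//.
  by rewrite -natrX ler_nat ltnW// ltn_expl.
exists q; split=> //.
have sg20 : 0 < sg ^+ 2 by rewrite exprn_gt0.
have e120 : 0 < e1 ^+ 2 by rewrite exprn_gt0.
have e121 : e1 ^+ 2 <= e1 / 8 by rewrite expr2 ler_pM2l//; lra.
have [B hB] := tvar_cvg (mulr_gt0 e120 sg20).
have [K0 hK0] := weight_unbounded sqrt2_gt1 (fun k => tlev_gt0 d k e00)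
  (fun k => tlevS d2 k e00) B.
(* Large L secures the requirement 8 <= t^2 v dl^2, because 2 (1 - e1)^2 >= 1. *)
have [K1 hK1] := @ln_nat_unbounded R (8 / dl ^+ 2).
exists (maxn 2 (maxn K0 K1)) => k; rewrite !geq_max => /and3P[k2 K0k K1k].
set i := (q * k.+1)%N.
have ki : (k <= i)%N by apply: (@leq_trans (q * k)%N); rewrite ?leq_pmull// leq_mul2l leqnSn orbT.
have i2 : (2 <= i)%N := leq_trans k2 ki.
have L0 := lni0 i2.
have hL := hK1 i (leq_trans K1k ki).
set K := (i + scale a)%N; set b := tlev d e0 K; set L : R := ln i%:R in L0 hL *.
have b0 : 0 < b by exact: tlev_gt0.
have tv : (1 - e1 ^+ 2) * sg ^+ 2 <= tvar xi b.
  have := hB b (hK0 K (leq_trans K0k (leq_trans ki (leq_addr _ _)))) (ltW b0).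
  by rewrite ler_norml => /andP[h _]; lra.
have Vi := V0 i; have sV : 0 < Num.sqrt (V i) by rewrite sqrtr_gt0.
have sL : 0 < Num.sqrt (2 * L) by rewrite sqrtr_gt0 mulr_gt0.
have sV2 : Num.sqrt (V i) ^+ 2 = V i by rewrite sqr_sqrtr// ltW.
have sL2 : Num.sqrt (2 * L) ^+ 2 = 2 * L by rewrite sqr_sqrtr// mulr_ge0// ltW.
pose v := (size (block q k))%:R * tvar xi b.
have v1 : ((1 - e1) * sg) ^+ 2 * V i <= v.
  have h : (1 - e1 ^+ 2) * V i <= (size (block q k))%:R.
    by rewrite size_block; have := V_block k e10 hq; rewrite -/i; lra.
  have h0 : 0 <= 1 - e1 ^+ 2 by lra.
  have := ler_pM (mulr_ge0 h0 (ltW Vi)) (mulr_ge0 h0 (ltW sg20)) h tv.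
  rewrite -/v; apply: le_trans.
  have -> : ((1 - e1) * sg) ^+ 2 * V i = (1 - e1) ^+ 2 * (sg ^+ 2 * V i) by ring.
  have -> : (1 - e1 ^+ 2) * V i * ((1 - e1 ^+ 2) * sg ^+ 2) =
    (1 - e1 ^+ 2) ^+ 2 * (sg ^+ 2 * V i) by ring.
  rewrite ler_pM2r ?mulr_gt0// lerXn2r ?nnegrE//; lra.
have cc : 0 < (1 - e1) * sg by rewrite mulr_gt0//; lra.
have v0 : 0 < v by apply: lt_le_trans v1; rewrite mulr_gt0// exprn_gt0.
have sv : 0 < Num.sqrt v by rewrite sqrtr_gt0.
have sv2 : Num.sqrt v ^+ 2 = v by rewrite sqr_sqrtr// ltW.
have sv1 : (1 - e1) * sg * Num.sqrt (V i) <= Num.sqrt v.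
  rewrite -(ger0_norm (ltW cc)) -sqrtr_sqr -sqrtrM ?sqr_ge0// ler_sqrt//.
  exact: ltW.
pose t := (1 - e1) * Num.sqrt (2 * L) / Num.sqrt v.
have t0 : 0 <= t by rewrite divr_ge0 ?(ltW sv)// mulr_ge0 ?(ltW sL)//; lra.
have tE : t ^+ 2 * v = (1 - e1) ^+ 2 * (2 * L).
  by rewrite /t -[X in _ * X = _]sv2 -[in RHS]sL2; field; rewrite gt_eqF.
have tb : (1 + dl) * t * (2 * b) <= eta.
  have h := @tlev_dil e0 i e00 i2; rewrite -/K -/b -/L in h.
  have sVL : Num.sqrt (2 * L / V i) = Num.sqrt (2 * L) / Num.sqrt (V i).
    rewrite sqrtrM; last by rewrite mulr_ge0// ltW.
    by rewrite sqrtrV// ltW.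
  have h1 : t <= Num.sqrt (2 * L / V i) / sg.
    rewrite /t sVL ler_pdivrMr// -mulrA -mulrA.
    rewrite [leLHS]mulrC -[leRHS]mulrC; move: sv1 sL sV sg0; clear.
    move: (Num.sqrt v) (Num.sqrt (V i)) (Num.sqrt (2 * L)) => x y z h z0 y0 s0.
    rewrite [leRHS](_ : _ = z * (x / (y * sg))); last by field; rewrite !gt_eqF.
    by rewrite ler_pM2l// ler_pdivlMr ?mulr_gt0//; lra.
  have h2 : t * b <= e0 * Num.sqrt (2 * Q) / sg.
    have := ler_wpM2r (ltW b0) h1 => /le_trans; apply.
    by rewrite mulrAC ler_pM2r ?invr_gt0// mulrC.
  have h3 : eta = 8 * (e0 * Num.sqrt (2 * Q) / sg) by rewrite /e0; field; rewrite !gt_eqF.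
  have tb0 : 0 <= t * b by rewrite mulr_ge0// ltW.
  have h4 : (1 + dl) * (t * b) <= 4 * (t * b) by apply: ler_wpM2r => //; lra.
  by rewrite h3; lra.
have big : 8 <= t ^+ 2 * v * dl ^+ 2.
  rewrite tE; move: hL; rewrite ler_pdivrMr ?exprn_gt0// => hL.
  apply: (le_trans hL); rewrite ler_pM2r ?exprn_gt0//.
  rewrite mulrA ler_peMl ?(ltW L0)//.
  have : (7 / 8) ^+ 2 <= (1 - e1) ^+ 2 by rewrite lerXn2r ?nnegrE//; lra.
  by lra.
have dl01 : 0 < dl <= 1 by rewrite dl0.
have bs : [set` block q k] `<=` posvec (d := d).
  by move=> m /block_sub; exact: (@bx_posvec d (dil i a)).
have hP := exp_lower hX (ltW b0) (block_uniq q k) bs t0 tb dl01 (lexx _) big.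
apply: (@le_trans _ _ (expR (- L) / 2)).
  rewrite expRN lnK; last by rewrite posrE ltr0n (leq_trans _ i2).
  by rewrite /i natrM -!invfM le_eqVlt; apply/orP; left; apply/eqP; congr (_^-1); ring.
apply: (le_trans (le_trans _ hP)).
  rewrite ler_pM2r// ler_expR lerN2 -/v tE.
  have -> : (1 - e1) ^+ 2 * (2 * L) * (1 / 2 + 2 * dl) = (1 - e1) ^+ 2 * (1 + e1) * L.
    by rewrite /dl; field.
  rewrite ler_piMl ?(ltW L0)//.
  have -> : (1 - e1) ^+ 2 * (1 + e1) = (1 - e1) * (1 - e1 ^+ 2) by ring.
  rewrite mulr_ile1//; lra.
have ms (x : R) : measurable [set w | x < \sum_(m <- block q k) tZ X xi b m w].
  have := (tsum_bm X xi (block q k) (ltW b0)).1.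
  by move=> /(_ measurableT `]x, +oo[%classic (measurable_itv _)); rewrite setTI set_itvoy.
apply: pr_le => //; move=> w /=; apply: le_lt_trans.
rewrite -/v zetaE -/L.
have -> : (1 - dl) * t * v = (1 - dl) * (1 - e1) * Num.sqrt (2 * L) * Num.sqrt v.
  by rewrite /t -[X in _ * X = _]sv2; field; rewrite gt_eqF.
have h0 : 0 <= (1 - dl) * (1 - e1) * Num.sqrt (2 * L).
  by rewrite mulr_ge0 ?(ltW sL)// mulr_ge0; lra.
apply: (le_trans _ (ler_wpM2l h0 sv1)).
have -> : (1 - dl) * (1 - e1) * Num.sqrt (2 * L) * ((1 - e1) * sg * Num.sqrt (V i)) =
  ((1 - dl) * (1 - e1) ^+ 2) * (sg * Num.sqrt (V i) * Num.sqrt (2 * L)) by ring.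
have -> : (1 - 3 * e1) * sg * (Num.sqrt (V i) * Num.sqrt (2 * L)) =
  (1 - 3 * e1) * (sg * Num.sqrt (V i) * Num.sqrt (2 * L)) by ring.
rewrite ler_wpM2r ?mulr_ge0 ?(ltW sg0) ?sqrtr_ge0//.
have h7 : (1 - e1) * (1 - e1) ^+ 2 <= (1 - dl) * (1 - e1) ^+ 2.
  by rewrite ler_wpM2r ?sqr_ge0// /dl; lra.
apply: le_trans h7.
have -> : (1 - e1) * (1 - e1) ^+ 2 = 1 - 3 * e1 + e1 ^+ 2 * (3 - e1) by ring.
by rewrite lerDl mulr_ge0 ?sqr_ge0//; lra.
Qed.

(** The box is the last block plus the previous box. The previous box is at most 2 sg zeta(qk) <= 2
    e1 sg zeta by [upper_ae]; with 3 e1 from the block and e1 from truncation the loss is 6 e1,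
    below eps = 8 e1. *)
Lemma lower_ae : {ae P, forall w, forall eps, 0 < eps -> forall i0,
  exists i, (i0 <= i)%N /\ (1 - eps) * sg * zeta i a <= `|dev (dil i a) w|}.
Proof.
apply: ae_forall_eps; last first.
  move=> w e e' ee h i0; have [i [ii hi]] := h i0; exists i; split=> //.
  apply: le_trans hi; rewrite ler_wpM2r ?zeta_ge0// ler_wpM2r ?(ltW sg0)//.
  by rewrite lerD2l lerN2.
move=> eps /andP[eps0 eps1].
pose e1 := eps / 8.
have e18 : 0 < e1 <= 1 / 8 by apply/andP; rewrite /e1; lra.
have e10 : 0 < e1 by case/andP: e18.
have [e0 e00 [q [q0 hq [k0 hk0]]]] := lower_prob e18.
have [c c0 hc] := chis_dil.
pose E k := [set w | (1 - 3 * e1) * sg * zeta (q * k.+1) a <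
    \sum_(m <- block q k) tZ X xi (tlev d e0 (q * k.+1 + scale a)) m w].
(* The truncation level varies with k, so the [tZ] of different blocks form different families;
   independence is therefore read off from the common family [X]. *)
have sE k : sig X [set` block q k] (E k).
  have := @smf_sum _ _ _ _ _ X [set` block q k] (block q k)
    (fun m => tZ X xi (tlev d e0 (q * k.+1 + scale a)) m).
  move=> /(_ _ `](1 - 3 * e1) * sg * zeta (q * k.+1) a, +oo[%classic (measurable_itv _)).
  rewrite set_itvoy; apply => m mb.
  by apply: (smf_comp (ctrunc_measurable _ _)); exact: smf_RV.
have hdiv := harmonic_unbounded (c := (2 * q%:R)^-1) _ (fun k => pr_ge0 P (E k)) hk0.
have bs k : [set` block q k] `<=` posvec (d := d).
  by move=> m /block_sub; exact: (@bx_posvec d (dil (q * k.+1) a)).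
have c20 : 0 < (2 * q%:R)^-1 :> R by rewrite invr_gt0 mulr_gt0// ltr0n.
have hBC := borel_cantelli2 hX.1 bs (@block_disjoint q) sE (hdiv c20).
have ee : 0 < e1 * sg / c by rewrite divr_gt0// mulr_gt0.
apply: filterS3 hBC (truncation_error d2 hX hint hsq e00) upper_ae.
move=> w hE /(_ _ ee)[K0 hK0] /(_ _ (@ltr01 R))[i1 hi1] i0.
have [k [kk Ek]] := hE (maxn 3 (maxn i0 (maxn i1 K0))).
move: kk; rewrite !geq_max => /and4P[k3 ki0 ki1 kK0].
have kq : (k <= q * k)%N by rewrite leq_pmull.
have qq : (q * k <= q * k.+1)%N by rewrite leq_mul2l leqnSn orbT.
have ki := leq_trans kq qq.
exists (q * k.+1)%N; split; first exact: leq_trans ki0 ki.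
set i := (q * k.+1)%N in qq ki *.
have z0 := zeta_ge0 i.
have h2 := hK0 (i + scale a)%N (leq_trans kK0 (leq_trans ki (leq_addr _ _)))
  (block q k) (block_uniq q k)
  (fun m mb => bx_dil_sub (lev_refl (dil i a)) (block_sub mb)).
have h3 : e1 * sg / c * chis d (i + scale a) <= e1 * sg * zeta i a.
  rewrite -mulrA ler_pM2l; last by rewrite mulr_gt0.
  by rewrite mulrC ler_pdivrMr// mulrC; apply: hc; exact: leq_trans k3 ki.
have h4 := hi1 (q * k)%N (leq_trans ki1 kq) _ (lev_refl _).
have h5 := zeta_block e10 hq q0 (leq_trans (isT : (0 < 3)%N) k3).
rewrite -/i in h5.
have h6 : sg * zeta (q * k) a <= e1 * (sg * zeta i a).
  by rewrite mulrCA ler_pM2l.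
have := le_trans (le_trans _ h2) h3 => /(_ _ (lexx _)) h7.
rewrite sum_block (le_trans _ (ler_norm _))//.
move: Ek h7 h4 h6; rewrite /E/= -/i.
set A := \sum_(m <- block q k) (X m w - mu); set T := \sum_(m <- block q k) _.
set Y := \sum_(m <- _) _ => Ek.
rewrite !ler_norml => /andP[h7 _] /andP[h4 _] h6.
rewrite /e1 in Ek h7 h6; rewrite -!mulrA in Ek h7 h4 *; move: Ek h7 h4 h6.
have : 0 <= eps * (sg * zeta i a) by rewrite mulr_ge0 ?(ltW eps0)// mulr_ge0// ltW.
move: (sg * zeta i a) (sg * zeta (q * k) a); clear => z z' h; lra.
Qed.
End lil_dilations.

Lemma uniform_threshold (T : eqType) (s : seq T) (G : T -> nat -> Prop) :
  (forall a, a \in s -> exists i0, forall i, (i0 <= i)%N -> G a i) ->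
  exists i0, forall a, a \in s -> forall i, (i0 <= i)%N -> G a i.
Proof.
elim: s => [|b s IH] h; first by exists 0%N.
have [i1 h1] := h b (mem_head _ _).
have [|i2 h2] := IH; first by move=> a sa; apply: h; rewrite inE sa orbT.
exists (maxn i1 i2) => a; rewrite inE => /orP[/eqP ->|sa] i; rewrite geq_max => /andP[i1i i2i].
  exact: h1.
exact: h2.
Qed.

(** * Rounding an index up to a dyadic grid *)

Section round_up.
Variable d : nat.
Notation I := 'rV[nat]_d.

(** The shape [a] for which 2^i a lies just above n; when 2^i is a fixed fraction of the enclosing
    cube only finitely many shapes occur. *)
Definition roundup i (n : I) : I := \row_j (n ord0 j %/ 2 ^ i).+1.

Lemma roundup_lev i (n : I) : lev n (dil i (roundup i n)).
Proof.
apply/levP => j; rewrite !mxE mulnC; apply: ltnW.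
by rewrite -ltn_divLR ?expn_gt0.
Qed.

Lemma roundup_bx i p (n : I) : (forall j, n ord0 j <= 2 ^ (i + p))%N ->
  roundup i n \in bx (const_mx (2 ^ p).+1 : I).
Proof.
move=> hn; apply/bxP; split; first by move=> j; rewrite mxE.
apply/levP => j; rewrite !mxE ltnS.
by rewrite -(@leq_pmul2r (2 ^ i)) ?expn_gt0// (leq_trans (leq_divM _ _))// mulnC -expnD.
Qed.

Lemma vol_roundup {R : realType} (dl : R) i (n : I) : 0 <= dl ->
  (forall j, (2 ^ i)%:R <= dl * (n ord0 j)%:R) ->
  (vol (dil i (roundup i n)))%:R <= (1 + dl) ^+ d * (vol n)%:R.
Proof.
move=> dl0 hn; rewrite /vol !(natr_prod R) -[d in X in _ <= X * _]card_ord.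
rewrite -prodr_const -big_split/=; apply: ler_prod => j _; rewrite ler0n/=.
apply: (@le_trans _ _ (n ord0 j + 2 ^ i)%N%:R); last first.
  by rewrite natrD mulrDl mul1r lerD2l.
by rewrite ler_nat !mxE mulnS addnC leq_add2r mulnC leq_divM.
Qed.

End round_up.

(** * From dilations to all indices of the cone *)

Section lil_cone.
Context {R : realType} {d : nat}.
Context {dsp : measure_display} {Omega : measurableType dsp}.
Variable P : probability Omega R.
Variables (X : 'rV[nat]_d -> {RV P >-> R}) (xi : {RV P >-> R}).
Hypothesis d2 : (2 <= d)%N.
Hypothesis hX : independent_copies (posvec (d := d)) X xi.
Hypothesis hint : P.-integrable setT (EFin \o xi).
Hypothesis hsq : P.-integrable setT (EFin \o (fun w => xi w ^+ 2)).
Notation I := 'rV[nat]_d.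
Notation mu := (Ex P xi).
Variable sg : R.
Hypothesis sg0 : 0 < sg.
Hypothesis hsg : Ex P (fun w => xi w ^+ 2) - mu ^+ 2 = sg ^+ 2.
Variable C : set 'rV[R]_d.
Hypothesis hCclosed : closed C.
Hypothesis hCcone : is_cone C.
Hypothesis hCpos : forall x, C x -> x <> 0 -> forall i, 0 < x ord0 i.

Let d0 : (0 < d)%N. Proof. exact: ltnW. Qed.
Notation dev m w := (\sum_(l <- bx m) (X l w - mu)).
Notation lil n := (Num.sqrt (2 * (vol n)%:R * ln (ln (vol n)%:R)) : R).

(** At scale k the volume is at least 4^k / A, as d >= 2, and (4/3)^k eventually beats A, leaving
    3^k >= e^k. Hence log log |n| is at least the logarithm of the scale, and |n| passes e^e. *)
Lemma vol_ge_expR : exists K, forall n : I, cone_indices C n -> (K <= scale n)%N ->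
  expR (scale n)%:R <= (vol n)%:R :> R.
Proof.
have [A A0 hA] := cone_scale d0 hCclosed hCcone hCpos.
pose g k : R := (4 / 3) ^+ k.
have g0 k : 0 < g k by rewrite exprn_gt0// divr_gt0.
have [K hK] := @weight_unbounded R (4 / 3) g ltac:(lra) g0
  (fun k => ltac:(by rewrite /g exprS)) A.
exists K => n Cn Kn.
have h1 := hA n Cn; have h2 := hK _ Kn.
have h3 : 4 ^+ scale n <= cvol d (scale n) :> R.
  rewrite /cvol natrX mulnC exprM lerXn2r ?nnegrE ?exprn_ge0//.
  by rewrite (_ : 4 = 2 ^+ 2 :> R) ?ler_weXn2l ?ler1n// -natrX.
have e3 : expR (scale n)%:R <= 3 ^+ scale n :> R.
  rewrite -[X in expR X]mulr1 expRM_natl lerXn2r ?nnegrE ?expR_ge0//.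
  exact: expR1_le3.
apply: (le_trans e3).
have h4 : 4 ^+ scale n = 3 ^+ scale n * g (scale n) :> R.
  by rewrite /g -exprMn; congr (_ ^+ _); field.
have p3 : 0 < 3 ^+ scale n :> R by rewrite exprn_gt0.
rewrite -(ler_pM2l A0); apply: le_trans h1; apply: le_trans h3.
by rewrite h4 mulrC ler_pM2l.
Qed.

(** The null set is chosen once for all the countably many shapes; for given [eps] the rounded
    shapes lie in one finite box, so a single threshold serves them all. *)
Lemma lil_upper_ae : {ae P, forall w, forall eps, 0 < eps -> exists K,
  forall n : I, cone_indices C n -> (K <= scale n)%N ->
  `|dev n w| <= (1 + eps) * sg * lil n}.
Proof.
have : {ae P, forall w, forall a : I, posvec a -> forall eps, 0 < eps -> exists i0,
  forall i, (i0 <= i)%N -> forall m, lev m (dil i a) ->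
  `|dev m w| <= (1 + eps) * sg * zeta i a :> R}.
  apply: ae_forall_countType => a.
  have [pa|npa] := pselect (posvec a); last by apply: aeW.
  by apply: filterS (upper_ae d2 hX hint hsq sg0 hsg pa) => w h _.
apply: filterS => w hw eps eps0.
have [c c0 hc] := cone_balanced d0 hCclosed hCcone hCpos.
have [K1 hK1] := vol_ge_expR.
(* One factor 1 + e1 pays for the fluctuation bound, another for rounding; as e1 <= 1, their product
   is at most 1 + 3 e1 <= 1 + eps. *)
pose e1 := Num.min 1 eps / 3.
have m0 : 0 < Num.min 1 eps by rewrite lt_min ltr01.
have e10 : 0 < e1 by rewrite divr_gt0.
have e1e : (1 + e1) * (1 + e1) <= 1 + eps.
  have : e1 * e1 <= e1 * 1.
    have h : e1 <= 1 / 3 by rewrite /e1 ler_pM2r// ge_min lexx.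
    by rewrite ler_pM2l//; lra.
  have : e1 <= eps / 3 by rewrite /e1 ler_pM2r// ge_min lexx orbT.
  by move: (e1) (eps0) => e; lra.
pose dl : R := ln (1 + e1) / d%:R.
have dR : 0 < d%:R :> R by rewrite ltr0n.
have dl0 : 0 < dl by rewrite divr_gt0// ln_gt0// ltrDl.
have hdl : (1 + dl) ^+ d <= 1 + e1.
  apply: (@le_trans _ _ (expR dl ^+ d)).
    by rewrite lerXn2r ?nnegrE ?expR_ge0 ?expR_ge1Dx// addr_ge0// ltW.
  rewrite -expRM_natl /dl mulrCA divff ?gt_eqF// mulr1 lnK// posrE.
  by rewrite addr_gt0.
(* Every coordinate is at least c 2^(scale - 1), so the grid step 2^(scale - p) is at most dl times
   each coordinate. *)
pose p := (Num.truncn (2 / (c * dl))).+1.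
have hp : 2 / (c * dl) <= (2 ^ p)%:R.
  rewrite (le_trans (ltW (Num.Theory.truncnS_gt _)))//.
  by rewrite ler_nat ltnW// ltn_expl.
have [|i0 hi0] := @uniform_threshold I (bx (const_mx (2 ^ p).+1 : I))
   (fun a i => forall m, lev m (dil i a) -> `|dev m w| <= (1 + e1) * sg * zeta i a :> R).
  by move=> a /bxP[pa _]; exact: hw.
exists (maxn K1 (p + maxn 1 i0)) => n Cn; rewrite geq_max => /andP[Kn pn].
have [pon _] := Cn.
pose i := (scale n - p)%N.
have ps : (p <= scale n)%N := leq_trans (leq_addr _ _) pn.
have iE : (i + p)%N = scale n by rewrite subnK.
have : (maxn 1 i0 <= i)%N by rewrite -(leq_add2l p) [X in (_ <= X)%N]addnC iE.
rewrite geq_max => /andP[i1 i0i].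
have mb : roundup i n \in bx (const_mx (2 ^ p).+1 : I).
  by apply: roundup_bx => j; have /levP/(_ j) := lev_scale n; rewrite mxE iE.
apply: (le_trans (hi0 _ mb i i0i n (roundup_lev i n))).
apply: (@le_trans _ _ ((1 + e1) * sg * ((1 + e1) * lil n))); last first.
  rewrite [leLHS](_ : _ = (1 + e1) * (1 + e1) * (sg * lil n)); last by ring.
  rewrite -[leRHS]mulrA; apply: ler_wpM2r => //.
  by rewrite mulr_ge0 ?sqrtr_ge0// ltW.
rewrite ler_pM2l; last by rewrite mulr_gt0// addr_gt0.
have hvol : (vol (dil i (roundup i n)))%:R <= (1 + dl) ^+ d * (vol n)%:R.
  apply: vol_roundup; first exact: ltW.
  move=> j; have hj := hc n Cn j.
  have h1 : (2 ^ scale n)%:R <= 2 * (\max_j n ord0 j)%N%:R :> R.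
    by rewrite -natrM ler_nat pow_scale_le.
  move: h1; rewrite -iE expnD natrM => h1.
  rewrite -(@ler_pM2l _ (c * (2 ^ p)%:R)); last by rewrite mulr_gt0// ltr0n expn_gt0.
  have h2 : c * (2 ^ p)%:R * (2 ^ i)%:R <= 2 * (n ord0 j)%:R.
    apply: (@le_trans _ _ (c * (2 * (\max_j n ord0 j)%N%:R))).
      by rewrite -mulrA ler_pM2l// mulrC.
    by rewrite mulrCA ler_pM2l.
  apply: (le_trans h2); rewrite mulrA ler_wpM2r ?ler0n//.
  by move: hp; rewrite (ler_pdivrMr _ _ (mulr_gt0 c0 dl0)) mulrCA mulrA.
have hln : ln i%:R <= ln (ln (vol n)%:R) :> R.
  have i0R : 0 < i%:R :> R by rewrite ltr0n.
  have h1 : i%:R <= ln (vol n)%:R :> R.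
    have v0 : 0 < (vol n)%:R :> R by rewrite ltr0n vol_gt0.
    rewrite -[leLHS]expRK ler_ln ?posrE ?expR_gt0//.
    by apply: le_trans (hK1 n Cn Kn); rewrite ler_expR ler_nat leq_subr.
  by rewrite ler_ln ?posrE// (lt_le_trans i0R).
have l0 : 0 <= ln i%:R :> R by rewrite ln_ge0// ler1n.
have e11 : 0 <= 1 + e1 by rewrite addr_ge0// ltW.
rewrite /zeta -[X in X * lil n](ger0_norm e11) -sqrtr_sqr -sqrtrM ?sqr_ge0// ler_sqrt; last first.
  by rewrite mulr_ge0 ?sqr_ge0// mulr_ge0// (le_trans l0).
rewrite [leRHS](_ : _ = 2 * ((1 + e1) ^+ 2 * (vol n)%:R) * ln (ln (vol n)%:R)); last by ring.
apply: ler_pM => //; rewrite ?mulr_ge0// ler_pM2l//.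
apply: (le_trans hvol); rewrite ler_wpM2r ?ler0n// (le_trans hdl)//.
by rewrite expr2 ler_peMr// lerDl ltW.
Qed.

Lemma dil_cone i (n : I) : cone_indices C n -> cone_indices C (dil i n).
Proof.
move=> [pn Cn]; split; first exact: dil_posvec.
have -> : vecR R (dil i n) = (2 ^ i)%:R *: vecR R n.
  by apply/rowP => j; rewrite !mxE natrM.
by apply: hCcone => //; rewrite ltr0n expn_gt0.
Qed.

(** The logarithm of |2^i a| is at most c i, so its logarithm exceeds ln i by at most ln c, which is
    below eps ln i for large i. *)
Lemma lil_dil (eps : R) (a : I) : 0 < eps -> posvec a -> exists i0, forall i, (i0 <= i)%N ->
  lil (dil i a) <= (1 + eps) * zeta i a.
Proof.
move=> eps0 pa.
pose c : R := (d + vol a)%:R.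
have c0 : 0 < c by rewrite ltr0n addn_gt0 d0.
have [K1 hK1] := @ln_nat_unbounded R (ln c / eps).
have [K2 hK2] := @ln_nat_unbounded R 1.
exists (maxn 2 (maxn K1 K2)) => i; rewrite !geq_max => /and3P[i2 K1i K2i].
have h1 := hK1 i K1i; rewrite ler_pdivrMr// in h1.
have L1 := hK2 i K2i.
have iR : 0 < i%:R :> R by rewrite ltr0n ltnW.
have i1R : 1 <= i%:R :> R by rewrite ler1n ltnW.
have va : (0 < vol a)%N by exact: vol_gt0.
have vd : 0 < (vol (dil i a))%:R :> R by rewrite ltr0n vol_gt0//; exact: dil_posvec.
have v1 : ln (vol (dil i a))%:R <= i%:R * c.
  rewrite vol_dil natrM lnM ?posrE ?ltr0n ?expn_gt0// natrX lnXn//.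
  have l2 : ln 2 <= 1 :> R by have := @le_ln1Dx R 1 ltac:(lra).
  have lv : ln (vol a)%:R <= (vol a)%:R :> R.
    have := @le_ln1Dx R ((vol a)%:R - 1); rewrite addrCA subrr addr0 => h.
    have : ln (vol a)%:R <= (vol a)%:R - 1 :> R.
      by apply: h; rewrite ltrBDr addrC subrr ltr0n.
    by lra.
  rewrite /c natrD mulrDr lerD//.
    by rewrite -[ln 2 *+ _]mulr_natr natrM mulrC ler_piMr// mulr_ge0.
  by apply: (le_trans lv); rewrite ler_peMl.
(* If the inner logarithm is at most 1, the radicand is nonpositive and [Num.sqrt] returns 0. *)
have [neg|pos] := leP (ln (vol (dil i a))%:R) (1 : R).
  have lneg : ln (ln (vol (dil i a))%:R) <= 0 :> R by exact: ln_le0.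
  rewrite ler0_sqrtr ?mulr_ge0 ?sqrtr_ge0//; last by rewrite mulr_ge0_le0// mulr_ge0.
  by rewrite addr_ge0// ltW.
have lpos : 0 < ln (vol (dil i a))%:R :> R by exact: lt_trans pos.
have h2 : ln (ln (vol (dil i a))%:R) <= (1 + eps) * ln i%:R.
  apply: (@le_trans _ _ (ln (i%:R * c))); first by rewrite ler_ln ?posrE ?mulr_gt0.
  by rewrite lnM ?posrE//; lra.
have e1 : 0 <= 1 + eps by rewrite addr_ge0// ltW.
rewrite /zeta -[X in X * Num.sqrt (_ * ln i%:R)](ger0_norm e1) -sqrtr_sqr -sqrtrM ?sqr_ge0//.
have L0 : 0 <= ln i%:R :> R by lra.
rewrite ler_sqrt; last by rewrite mulr_ge0 ?sqr_ge0// mulr_ge0// mulr_ge0// ltW.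
rewrite mulrCA ler_wpM2l ?mulr_ge0 ?(ltW vd)//.
apply: (le_trans h2); rewrite ler_wpM2r// expr2 ler_peMr// lerDl; exact: ltW.
Qed.

(** A single index of the cone suffices, since the cone contains all its dilations. *)
Lemma lil_lower_ae : cone_indices C !=set0 -> {ae P, forall w, forall eps, 0 < eps ->
  forall K, exists n : I, [/\ cone_indices C n, (K <= scale n)%N &
    (1 - eps) * sg * lil n <= `|dev n w|]}.
Proof.
move=> [a Ca]; have [pa _] := Ca.
apply: filterS (lower_ae d2 hX hint hsq sg0 hsg pa) => w hw eps eps0 K.
have [epsl|epsg] := leP 1 eps.
  exists (dil K a); split; first exact: dil_cone.
    apply: scale_ge; apply: (leq_trans _ (le_max_coord _ (Ordinal d0))).
    by rewrite mxE leq_pmulr// pa.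
  apply: (le_trans _ (normr_ge0 _)); rewrite -mulrA mulr_le0_ge0 ?subr_le0//.
  by rewrite mulr_ge0 ?sqrtr_ge0// ltW.
(* Halving works because (1 - eps)(1 + eps/2) <= 1 - eps/2. *)
have e2 : 0 < eps / 2 by rewrite divr_gt0.
have [i0 hi0] := lil_dil e2 pa.
have [i [ii hi]] := hw _ e2 (maxn i0 K).
move: ii; rewrite geq_max => /andP[i0i Ki].
exists (dil i a); split; first exact: dil_cone.
  apply: (leq_trans Ki); apply: scale_ge.
  apply: (leq_trans _ (le_max_coord _ (Ordinal d0))).
  by rewrite mxE leq_pmulr// pa.
apply: le_trans hi.
have h := hi0 i i0i.
have se : 0 <= (1 - eps) * sg by rewrite mulr_ge0 ?(ltW sg0)// subr_ge0 ltW.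
apply: (le_trans (ler_wpM2l se h)).
rewrite !mulrA ler_wpM2r ?sqrtr_ge0// mulrAC ler_pM2r//.
have : 0 <= eps * (eps / 2) by rewrite mulr_ge0 ?ltW.
by lra.
Qed.

Lemma dev_partial_sum (n : I) w : dev n w = partial_sum X n w - mu * (vol n)%:R.
Proof.
by rewrite partial_sumE sumrB big_const_seq count_predT iter_addr_0 size_bx mulr_natr.
Qed.

(** Nonemptiness excludes the degenerate filter, along which the limsup would be minus infinity.
    Past [K0] the volume exceeds e^e, so [chi] has its prescribed form there. *)
Lemma lil_cone (chi : R -> R) : is_chi chi -> cone_indices C !=set0 ->
  {ae P, forall w, limf_esup (fun n =>
    (`|partial_sum X n w - mu * (vol n)%:R| / (sg * chi (vol n)%:R))%:E)
    (cone_oo C) = 1%E}.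
Proof.
move=> [chiE chi0 _] C0.
apply: filterS2 lil_upper_ae (lil_lower_ae C0) => w hU hL.
have [K1 hK1] := vol_ge_expR.
pose K0 := maxn 3 K1.
have hchi n : cone_indices C n -> (K0 <= scale n)%N ->
    chi (vol n)%:R = lil n /\ 0 < lil n.
  move=> Cn; rewrite geq_max => /andP[n3 nK].
  have ev : expR (expR 1) <= (vol n)%:R :> R.
    apply: le_trans (hK1 n Cn nK); rewrite ler_expR.
    by apply: (le_trans expR1_le3); rewrite ler_nat.
  by rewrite -chiE//; split=> //; exact: chi0.
rewrite limf_esupE; apply/eqP; rewrite eq_le; apply/andP; split.
- apply/lee_addgt0Pr => e e0.
  have [K hK] := hU e e0.
  apply: (@le_trans _ _ (ereal_sup [set (`|partial_sum X n w - mu * (vol n)%:R| /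
      (sg * chi (vol n)%:R))%:E | n in [set n | cone_indices C n /\
      (2 ^ maxn K0 K <= \max_i n ord0 i)%N]])).
    apply: ereal_inf_lbound; exists [set n | cone_indices C n /\
      (2 ^ maxn K0 K <= \max_i n ord0 i)%N] => //.
    by exists (2 ^ maxn K0 K)%N.
  apply: ge_ereal_sup => _ [n [Cn /scale_ge nK] <-].
  move: nK; rewrite geq_max => /andP[nK0 nK].
  have [-> l0] := hchi n Cn nK0.
  rewrite -EFinD lee_fin ler_pdivrMr ?mulr_gt0// mulrA -dev_partial_sum.
  exact: hK.
- apply: le_ereal_inf_tmp => _ [V [N _ hN] <-].
  apply/lee_subgt0Pr => e e0.
  have [n [Cn nK hn]] := hL e e0 (maxn K0 N).
  move: nK; rewrite geq_max => /andP[nK0 nN].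
  have [cE l0] := hchi n Cn nK0.
  have VN : V n.
    apply: hN; split=> //; apply: (leq_trans nN).
    have pn : posvec n by case: Cn.
    have h := pow_scale_le d0 pn.
    have : (scale n < 2 ^ scale n)%N by rewrite ltn_expl.
    set s := scale n in h *; set M := (\max_i n ord0 i)%N in h *.
    (* Together with 2^s <= 2 M this gives s <= M, so an index of scale at least N has a maximal
       coordinate of at least N. *)
    have : (2 * s <= 2 ^ s)%N by elim: (s) => // k IH; rewrite expnS; nia.
    by lia.
  apply: (@le_trans _ _ (`|partial_sum X n w - mu * (vol n)%:R| / (sg * chi (vol n)%:R))%:E).
    rewrite cE -EFinB lee_fin ler_pdivlMr ?mulr_gt0// mulrA -dev_partial_sum.
    exact: hn.
  by apply: ereal_sup_ubound; exists n.
Qed.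

End lil_cone.

Lemma expectation_lty_integrable {dsp : measure_display} {Omega : measurableType dsp}
    {R : realType} (P : probability Omega R) (f : Omega -> R) :
  measurable_fun setT f -> (forall w, 0 <= f w) -> ('E_P[f] < +oo)%E ->
  P.-integrable setT (EFin \o f).
Proof.
move=> mf f0; rewrite unlock => h; apply/integrableP; split.
  exact/measurable_EFinP.
by rewrite (eq_integral (fun w => (f w)%:E))// => w _; rewrite /= ger0_norm.
Qed.

Lemma variance_Ex {dsp : measure_display} {Omega : measurableType dsp}
    {R : realType} (P : probability Omega R) (xi : {RV P >-> R}) :
  P.-integrable setT (EFin \o xi) -> P.-integrable setT (EFin \o (fun w => xi w ^+ 2)) ->
  ('V_P[xi] = (Ex P (fun w => xi w ^+ 2) - Ex P xi ^+ 2)%R%:E)%E.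
Proof.
move=> h1 h2; have E1 : ('E_P[xi] = (Ex P xi)%:E)%E by rewrite unlock ExE.
have l1 : (xi : Omega -> R) \in Lfun P 1 by exact/Lfun1_integrable.
have sqE : (xi : Omega -> R) * xi = fun w => xi w ^+ 2 by apply/funext.
have l2 : (xi : Omega -> R) * xi \in Lfun P 1 by rewrite sqE; exact/Lfun1_integrable.
rewrite /variance covarianceE// E1 sqE.
have -> : ('E_P[fun w => (xi w ^+ 2)%R] = (Ex P (fun w => xi w ^+ 2))%:E)%E by rewrite unlock ExE.
by rewrite EFinB EFinM.
Qed.

Unset Implicit Arguments.

Theorem theorem8p1 (R : realType) (d : nat) (hd : (2 <= d)%N)
    (dsp : measure_display) (Omega : measurableType dsp)
    (P : probability Omega R)
    (xi : {RV P >-> R}) (X : 'rV[nat]_d -> {RV P >-> R})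
    (hX : independent_copies (posvec (d := d)) X xi)
    (hint : P.-integrable [set: Omega] (EFin \o xi))
    (mu : R) (hmu : ('E_P[xi] = mu%:E)%E) (hmu0 : 0 < mu)
    (chi : R -> R) (hchi : is_chi chi)
    (C : set 'rV[R]_d) (hCclosed : closed C) (hCconvex : convex_set C)
    (hCcone : is_cone C)
    (hCpos : forall x, C x -> x <> 0 -> forall i, 0 < x ord0 i) :
  (forall beta : R, 1 <= beta < 2 ->
     ('E_P[fun w => (`|xi w| `^ beta)%R] < +oo)%E ->
     {ae P, forall w,
       (fun n => partial_sum X n w - mu * (vol n)%:R : R^o)
         =o_ (cone_oo C) (fun n => (vol n)%:R `^ beta^-1 : R^o)})
  /\
  (forall sigma : R,
     ('E_P[fun w => (xi w ^+ 2)%R] < +oo)%E ->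
     ('V_P[xi] = (sigma ^+ 2)%:E)%E -> 0 < sigma ->
     cone_indices C !=set0 ->
     {ae P, forall w,
       limf_esup (fun n =>
         (`|partial_sum X n w - mu * (vol n)%:R|
            / (sigma * chi (vol n)%:R))%:E) (cone_oo C) = 1%E}).
Proof.
have muE : mu = Ex P xi.
  by apply: EFin_inj; rewrite -hmu unlock ExE.
rewrite muE; split.
- move=> beta hb he; apply: strong_law_cone => //; first exact: ltnW.
  apply: expectation_lty_integrable he.
    apply: (measurableT_comp (measurable_powR beta)).
    exact: measurableT_comp.
  by move=> w; rewrite powR_ge0.
- move=> sigma he hV s0 C0.
  have hsq : P.-integrable setT (EFin \o (fun w => xi w ^+ 2)).
    apply: expectation_lty_integrable he => [|w]; last exact: sqr_ge0.
    exact: measurable_funX.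
  apply: (lil_cone hd hX hint hsq s0) => //.
  by apply: EFin_inj; rewrite -variance_Ex.
Qed.
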